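(* If $\Omega$ is an almost John domain and $p>Q-1$, then every $\mathrm{Mod}_p$-end is a prime end with singleton impression.
   Context: Setting: $(X,d,\mu)$ is a metric measure space with more than one point, $\mu$ is a Borel measure with $0<\mu(B)<\infty$ for all balls $B$, and $1\le p<\infty$ is fixed. $X$ is complete, $\mu$ is doubling (there is $C_\mu>0$ with $\mu(B(x,2r))\le C_\mu\mu(B(x,r))$ for all balls), and $X$ supports a $p$-Poincaré inequality: there are $C_{PI}>0$, $\lambda\ge1$ such that for all balls $B$ and all $u\in N^{1,p}(X)$, $\frac{1}{\mu(B)}\int_B|u-u_B|\,d\mu\le C_{PI}\operatorname{diam}(B)\bigl(\frac{1}{\mu(\lambda B)}\int_{\lambda B}g_u^p\,d\mu\bigr)^{1/p}$, where $u_B=\frac{1}{\mu(B)}\int_B u\,d\mu$. Here a nonnegative Borel function $g$ is an upper gradient of $u:X\to[-\infty,\infty]$ if for every nonconstant rectifiable curve $\gamma:[0,l_\gamma]\to X$ parameterized by arc length, $|u(\gamma(0))-u(\gamma(l_\gamma))|\le\int_\gamma g\,ds$ when both values are finite, and $\int_\gamma g\,ds=\infty$ otherwise; $N^{1,p}(X)$ is the space of measurable $u$ with $\int_X|u|^p\,d\mu+\inf_g\int_X g^p\,d\mu<\infty$ (infimum over upper gradients $g$ of $u$), and $g_u$ is the minimal $p$-weak upper gradient of $u$ (the a.e.-smallest $L^p$ function satisfying the upper gradient inequality for all curves except a family $\Gamma$ for which some nonnegative Borel $\rho\in L^p(X)$ has $\int_\gamma\rho\,ds=\infty$ for all $\gamma\in\Gamma$).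 $\Omega\subsetneq X$ is a bounded domain (bounded nonempty connected open set); closures and boundaries of subsets of $\Omega$ are taken in $X$. Exponent $Q$: $Q>0$ is an exponent for which there is $C>0$ such that $\frac{\mu(B(y,r))}{\mu(B(x,R))}\ge\frac1C\left(\frac rR\right)^Q$ for all $x\in X$, $0<r\le R$ and $y\in B(x,R)$ (such $Q$ exists by doubling). John domains: write $\delta_\Omega(x)=\operatorname{dist}(x,X\setminus\Omega)$. A domain $\Omega$ is a John domain if there are $C_\Omega\ge1$ and $x_0\in\Omega$ such that every $x\in\Omega$ can be joined to $x_0$ by a rectifiable curve $\gamma:[0,l_\gamma]\to\Omega$ parameterized by arc length with $\gamma(0)=x$, $\gamma(l_\gamma)=x_0$ and $t\le C_\Omega\delta_\Omega(\gamma(t))$ for $0\le t\le l_\gamma$. The 1-dimensional Hausdorff content is $\mathcal H^1_\infty(E)=\inf\{\sum_{j=1}^\infty r_j: E\subset\bigcup_{j=1}^\infty B(x_j,r_j)\}$. A domain $\Omega$ is an almost John domain if for each $r>0$ there is a closed set $F\subset\overline\Omega$ such that $\mathcal H^1_\infty(F)<r$ and $\Omega\setminus F$ is a John domain (the John constant and center may depend on $r$). Ends: A bounded connected set $E\subsetneq\Omega$ is acceptable if $\overline E\cap\partial\Omega\ne\varnothing$. A sequence $\{E_k\}_{k=1}^\infty$ of acceptable sets is a chain if (i) $E_{k+1}\subset E_k$ for all $k$; (ii) $\operatorname{dist}(\Omega\cap\partial E_{k+1},\Omega\cap\partial E_k)>0$ for all $k$; (iii) the impression $\bigcap_{k=1}^\infty\overline{E}_k$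 is contained in $\partial\Omega$. A chain $\{E_k\}$ divides a chain $\{F_k\}$ if for each $k$ there is $l$ with $E_l\subset F_k$. Two chains are equivalent if they divide each other; an end $[E_k]$ is an equivalence class of chains, and its impression $I[E_k]$ is the impression of any representative chain. Division is well defined between ends. A prime end is an end that is not divisible by any other end. Modulus: for a family $\Gamma$ of nonconstant rectifiable curves, $\mathrm{Mod}_p(\Gamma)=\inf_\rho\int_X\rho^p\,d\mu$, the infimum over nonnegative Borel $\rho$ with $\int_\gamma\rho\,ds\ge1$ for all $\gamma\in\Gamma$. $\mathrm{Mod}_p(E,F,U)$ is the $p$-modulus of the family of nonconstant rectifiable curves in $U$ starting in $E$ and ending in $F$. A chain $\{E_k\}$ is a $\mathrm{Mod}_p$-chain if $\lim_{k\to\infty}\mathrm{Mod}_p(E_k,K,\Omega)=0$ for every compact $K\subset\Omega$. An end is a $\mathrm{Mod}_p$-end if some $\mathrm{Mod}_p$-chain represents it. *)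

(* Defs.v *)
From HB Require Import structures.
From mathcomp Require Import all_boot all_order all_algebra.
From mathcomp Require Import all_classical all_reals all_analysis.
From mathcomp Require Import measurable_realfun.

Set Implicit Arguments.
Unset Strict Implicit.
Unset Printing Implicit Defensive.
Import Order.TTheory GRing.Theory Num.Theory.
Import numFieldNormedType.Exports.
Local Open Scope classical_set_scope.
Local Open Scope ring_scope.

(* Pointedness is only what g_sigma_algebraType asks for in order to put the
   Borel sigma-algebra on the space. *)
#[short(type="completeMetricType")]
HB.structure Definition CompleteMetric (R : numDomainType) :=
  {T of Complete T & Pointed T & Metric R T}.

Notation borel X := (g_sigma_algebraType (@open X)).

Section metric_notions.
Context {R : realType} {X : completeMetricType R}.
Implicit Types (A B : set X).

Definition mbounded A := exists (x : X) (r : R), A `<=` ball x r.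

Definition boundary A : set X := closure A `\` interior A.

(* +oo if A or B is empty *)
Definition set_dist A B : \bar R :=
  ereal_inf [set (mdist x y)%:E | x in A & y in B].

Definition diam A : \bar R :=
  ereal_sup [set (mdist x y)%:E | x in A & y in A].

Definition hausdorff_content1 A : \bar R :=
  ereal_inf [set (\sum_(0 <= j <oo) (xr j).2%:E)%E | xr in
    [set xr : nat -> X * R | (forall j, 0 < (xr j).2) /\
       A `<=` \bigcup_j ball (xr j).1 (xr j).2]].

Definition curve_length (c : R -> X) (a b : R) : \bar R :=
  ereal_sup [set
    (\sum_(0 <= n < size s)
        mdist (c (nth b (a :: s) n)) (c (nth b (a :: s) n.+1)))%:E
    | s in itv_partition a b].

(* A rectifiable curve [0, len] -> X parameterized by arc length; the values of
   path outside [0, len] are irrelevant. The constant curves have len = 0. *)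
Record curve := Curve {
  len : R;
  path :> R -> X;
  len_ge0 : 0 <= len;
  path_arclength : forall s t : R, 0 <= s -> s <= t -> t <= len ->
    curve_length path s t = (t - s)%:E }.

Definition curve_in (g : curve) A := forall t : R, 0 <= t <= len g -> A (g t).

Definition nonconstant (g : curve) :=
  exists s t : R, [/\ 0 <= s <= len g, 0 <= t <= len g & g s <> g t].

Definition line_integral (g : curve) (f : X -> \bar R) : \bar R :=
  (\int[lebesgue_measure]_(t in `[0%R, len g]) f (g t))%E.

Definition joining_curves (E F U : set X) : set curve :=
  [set g | [/\ nonconstant g, curve_in g U, E (g 0) & F (g (len g))]].

Definition nonneg_borel (f : X -> \bar R) :=
  measurable_fun [set: borel X] f /\ (forall x, (0 <= f x)%E).

End metric_notions.

Section metric_measure_notions.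
Context {R : realType} {X : completeMetricType R}.
Variables (mu : {measure set (borel X) -> \bar R}) (p : R).
Local Open Scope ereal_scope.

Definition Lp_integral (f : X -> \bar R) : \bar R :=
  \int[mu]_x (`|f x| `^ p).

Definition average (B : set X) (f : X -> \bar R) : \bar R :=
  (fine (mu B))^-1%:E * \int[mu]_(x in B) f x.

(* measurability with respect to the completion of mu *)
Definition mu_measurable (u : X -> \bar R) :=
  exists2 v : X -> \bar R, measurable_fun [set: borel X] v &
    {ae mu, forall x, u x = v x}.

Definition balls_pos_finite :=
  forall (x : X) (r : R), (0 < r)%R -> 0 < mu (ball x r) < +oo.

Definition doubling :=
  exists2 C : R, (0 < C)%R & forall (x : X) (r : R), (0 < r)%R ->
    mu (ball x (2 * r)%R) <= C%:E * mu (ball x r).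

Definition lower_mass_exponent (Q : R) :=
  exists2 C : R, (0 < C)%R & forall (x y : X) (r s : R),
    (0 < r)%R -> (r <= s)%R -> ball x s y ->
    (C^-1 * (r / s) `^ Q <= fine (mu (ball y r)) / fine (mu (ball x s)))%R.

Definition Modp (Gamma : set (@curve R X)) : \bar R :=
  ereal_inf [set Lp_integral rho | rho in
    [set rho | nonneg_borel rho /\
       (forall g, Gamma g -> 1 <= line_integral g rho)]].

Definition upper_gradient_along (u f : X -> \bar R) (g : curve) :=
  let a := u (g 0%R) in let b := u (g (len g)) in
  let ab_fin := (a \is a fin_num) && (b \is a fin_num) in
  (ab_fin -> `|a - b| <= line_integral g f) /\
  (~~ ab_fin -> line_integral g f = +oo).

Definition upper_gradient (u f : X -> \bar R) :=
  nonneg_borel f /\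
  forall g : curve, nonconstant g -> upper_gradient_along u f g.

Definition exceptional (Gamma : set (@curve R X)) :=
  exists rho : X -> \bar R, [/\ nonneg_borel rho, Lp_integral rho < +oo &
    forall g, Gamma g -> line_integral g rho = +oo].

Definition weak_upper_gradient (u f : X -> \bar R) :=
  nonneg_borel f /\
  exists2 Gamma, exceptional Gamma &
    forall g : curve, nonconstant g -> ~ Gamma g -> upper_gradient_along u f g.

Definition newtonian (u : X -> \bar R) :=
  mu_measurable u /\
  Lp_integral u + ereal_inf [set Lp_integral f | f in upper_gradient u] < +oo.

(* The minimal p-weak upper gradient is unique only up to null sets, hence a
   relation between u and its representatives. *)
Definition minimal_weak_upper_gradient (u gu : X -> \bar R) :=
  [/\ weak_upper_gradient u gu, Lp_integral gu < +oo &
      forall f, weak_upper_gradient u f -> Lp_integral f < +oo ->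
        {ae mu, forall x, gu x <= f x}].

Definition poincare :=
  exists C lambda : R, [/\ (0 < C)%R, (1 <= lambda)%R &
    forall (x : X) (r : R) (u gu : X -> \bar R), (0 < r)%R ->
      newtonian u -> minimal_weak_upper_gradient u gu ->
      let B := ball x r in
      average B (fun y => `|u y - average B u|) <=
      C%:E * diam B *
        (average (ball x (lambda * r)%R) (fun y => gu y `^ p)) `^ p^-1].

End metric_measure_notions.

Section domains_and_ends.
Context {R : realType} {X : completeMetricType R}.

Definition bounded_domain (Omega : set X) :=
  [/\ Omega `<` setT, open Omega, Omega !=set0, connected Omega &
      mbounded Omega].

Definition john_domain (Omega : set X) :=
  bounded_domain Omega /\
  exists (C : R) (x0 : X), [/\ 1 <= C, Omega x0 &
    forall x, Omega x -> exists g : curve,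
      [/\ curve_in g Omega, g 0 = x, g (len g) = x0 &
          forall t : R, 0 <= t <= len g ->
            (t%:E <= C%:E * set_dist [set g t] (~` Omega))%E]].

Definition almost_john_domain (Omega : set X) :=
  bounded_domain Omega /\
  forall r : R, 0 < r -> exists F : set X,
    [/\ closed F, F `<=` closure Omega, (hausdorff_content1 F < r%:E)%E &
        john_domain (Omega `\` F)].

Variable Omega : set X.

Definition acceptable (E : set X) :=
  [/\ mbounded E, connected E, E `<` Omega &
      closure E `&` boundary Omega !=set0].

Definition impression (E : nat -> set X) : set X := \bigcap_k closure (E k).

Definition chain (E : nat -> set X) :=
  [/\ forall k, acceptable (E k),
      forall k, E k.+1 `<=` E k,
      forall k, (0 < set_dist (Omega `&` boundary (E k.+1))
                              (Omega `&` boundary (E k)))%E &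
      impression E `<=` boundary Omega].

Definition divides (E F : nat -> set X) := forall k, exists l, E l `<=` F k.

Definition equivalent_chains (E F : nat -> set X) :=
  divides E F /\ divides F E.

(* An end is an equivalence class of chains, represented as a set of chains. *)
Definition is_end (e : set (nat -> set X)) :=
  exists2 E, chain E & e = [set F | chain F /\ equivalent_chains E F].

Definition end_divides (e f : set (nat -> set X)) :=
  exists E F, [/\ e E, f F & divides E F].

Definition prime_end (e : set (nat -> set X)) :=
  is_end e /\ forall f, is_end f -> end_divides f e -> f = e.

Definition singleton_impression (e : set (nat -> set X)) :=
  exists x, forall E, e E -> impression E = [set x].

Definition mod_chain (mu : {measure set (borel X) -> \bar R}) (p : R)
    (E : nat -> set X) :=
  chain E /\ forall K, compact K -> K `<=` Omega ->
    Modp mu p (joining_curves (E k) K Omega) @[k --> \oo] --> 0%E.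

Definition mod_end (mu : {measure set (borel X) -> \bar R}) (p : R)
    (e : set (nat -> set X)) :=
  is_end e /\ exists2 E, e E & mod_chain mu p E.

End domains_and_ends.

(* Main.v *)
From HB Require Import structures.
Require Import Defs.
From mathcomp Require Import all_boot all_order all_algebra.
From mathcomp Require Import all_classical all_reals all_analysis.
From mathcomp Require Import measurable_realfun.
From mathcomp Require finmap.
From mathcomp Require Import ring lra.

Set Implicit Arguments.
Unset Strict Implicit.
Unset Printing Implicit Defensive.
Import Order.TTheory GRing.Theory Num.Theory.
Import numFieldNormedType.Exports.
Local Open Scope classical_set_scope.
Local Open Scope ring_scope.

(* Suppose that the impression of a Mod_p-chain E_k contains two points, so that
   every E_k has diameter at least 2d.  Remove from Omega a closed set F of
   content less than d/8 such that Omega \ F is a John domain with center x0, and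
   let Z be a small closed ball around x0.  For large k the modulus of the curves
   from E_k to Z is tiny; take an almost optimal density rho and replace it by a
   supremum f >= rho of an increasing sequence of Lipschitz functions with
   comparable energy.  For x in E_k \ F, the least f-length of a path to Z
   truncated at 1, regularized through chains of points with small steps, is a
   continuous function that equals 1 on Z, is at most 1/2 at x, and has f as
   an upper gradient near the John curve from x to x0: the only obstruction would
   be limits of chains, which are curves from x to Z of small rho-length.
   Telescoping the Poincare inequality along the John curve, with geometrically
   decreasing radii and p > Q - 1, yields a ball B of radius comparable to its
   distance from x with (radius of B) <= C \int_B f^p.  A Vitali covering then
   bounds the content of E_k \ F by C \int_Omega f^p, which is arbitrarily small;
   but a connected set of diameter at least d has content at least d/2, a
   contradiction.  So the impression is a singleton.  An end whose impression is a
   singleton is prime: if F_k divides E_k and E_k does not divide F_k, connected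
   sets E_l of arbitrarily small diameter join the boundaries of two
   consecutive F_k, which lie at a positive distance from each other. *)

(** The Poincare inequality speaks of minimal weak upper gradients, while the argument produces an
    ordinary upper gradient [f]. A minimal one below [f] must therefore be shown to exist, which
    rests on stability of weak upper gradients under minima and decreasing limits. Nothing makes the
    least [rho]-length of curves ending in Z continuous. Chains of points repair this, but they may
    jump across places where no curve passes, and out of Omega. A penalty near the boundary confines
    cheap chains to a compact part of Omega, where they accumulate at a genuine curve; a supremum of
    Lipschitz functions is lower semicontinuous, which is what lets the cost bound survive the
    limit. A jump of size r^beta between means at scale r costs energy of order r^((beta - 1) p +
    Q). Covering by balls of a one-dimensional content calls for the power r^1, which forces beta =
    (1 + p - Q) / p; the jumps are summable along geometric radii exactly when beta > 0, that is, p
    > Q - 1. *)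

(** * Lipschitz functions, truncated distances and Borel sets *)

Section metric_space.
Context {R : realType} {X : completeMetricType R}.
Implicit Types (A B : set X) (x y z : X).

Lemma mballE x r y : ball x r y = (mdist x y < r) :> Prop.
Proof. by rewrite ballEmdist. Qed.

Lemma mdist_triangle_sym x y z : mdist x y <= mdist z x + mdist z y.
Proof. by rewrite (metric_sym z x) metric_triangle. Qed.

Lemma mdist_diff x y z : `|mdist x z - mdist y z| <= mdist x y.
Proof.
rewrite ler_norml; apply/andP; split.
  rewrite lerBrDr addrC lerBlDr addrC (metric_sym x y).
  exact: metric_triangle.
by rewrite lerBlDr; exact: metric_triangle.
Qed.

Definition lipschitz_fun (k : R) (f : X -> R) :=
  0 <= k /\ forall x y, `|f x - f y| <= k * mdist x y.

Lemma lipschitz_fun_continuous k f : lipschitz_fun k f -> continuous f.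
Proof.
move=> [k0 fk] x; apply/cvgrPdist_lt => e e0.
have k1 : 0 < k + 1 by lra.
near=> y.
have xy : mdist x y < e / (k + 1).
  rewrite -mballE; near: y; apply: nbhsx_ballx; exact: divr_gt0.
apply: (le_lt_trans (fk x y)).
apply: (@le_lt_trans _ _ ((k + 1) * mdist x y)).
  by rewrite ler_wpM2r ?mdist_ge0//; lra.
by rewrite mulrC -ltr_pdivlMr.
Unshelve. all: by end_near. Qed.

Lemma lipschitz_fun_cst c : lipschitz_fun 0 (fun=> c).
Proof. by split=> // x y; rewrite subrr normr0 mul0r. Qed.

Lemma lipschitz_funW k l f : k <= l -> lipschitz_fun k f -> lipschitz_fun l f.
Proof.
move=> kl [k0 fk]; split=> [|x y]; first exact: le_trans kl.
by rewrite (le_trans (fk x y))// ler_wpM2r// mdist_ge0.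
Qed.

Lemma lipschitz_fun_max k f g : lipschitz_fun k f -> lipschitz_fun k g ->
  lipschitz_fun k (fun x => Num.max (f x) (g x)).
Proof.
move=> [k0 fk] [_ gk]; split=> // x y; have := fk x y; have := gk x y.
rewrite !ler_norml => /andP[g1 g2] /andP[f1 f2].
by rewrite /Num.max; case: ltP => h1; case: ltP => h2; apply/andP; split; lra.
Qed.

Lemma lipschitz_fun_min k f g : lipschitz_fun k f -> lipschitz_fun k g ->
  lipschitz_fun k (fun x => Num.min (f x) (g x)).
Proof.
move=> [k0 fk] [_ gk]; split=> // x y; have := fk x y; have := gk x y.
rewrite !ler_norml => /andP[g1 g2] /andP[f1 f2].
by rewrite /Num.min; case: ltP => h1; case: ltP => h2; apply/andP; split; lra.
Qed.

Lemma lipschitz_funZ k c f : 0 <= c -> lipschitz_fun k f ->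
  lipschitz_fun (c * k) (fun x => c * f x).
Proof.
move=> c0 [k0 fk]; split=> [|x y]; first exact: mulr_ge0.
by rewrite -mulrBr normrM (ger0_norm c0) -mulrA ler_wpM2l.
Qed.

(* The distance to A truncated at 1, which also makes sense for A = set0. *)
Definition dist1 A x : R := inf ([set 1] `|` [set mdist x y | y in A]).

Let dist1_set A x := [set 1] `|` [set mdist x y | y in A].

Lemma dist1_has_inf A x : has_inf (dist1_set A x).
Proof.
split; first by exists 1; left.
exists 0 => _ [-> //|[y _ <-]]; exact: mdist_ge0.
Qed.

Lemma dist1_ge A x r : r <= 1 -> (forall y, A y -> r <= mdist x y) ->
  r <= dist1 A x.
Proof.
move=> r1 Ar; apply: lb_le_inf; first by exists 1; left.
by move=> _ [-> //|[y /Ar + <-]].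
Qed.

Lemma dist1_ge0 A x : 0 <= dist1 A x.
Proof. by apply: dist1_ge => // y _; exact: mdist_ge0. Qed.

Lemma dist1_le1 A x : dist1 A x <= 1.
Proof. by apply: ge_inf; [exact: (dist1_has_inf A x).2|left]. Qed.

Lemma dist1_le A x y : A y -> dist1 A x <= mdist x y.
Proof.
by move=> Ay; apply: ge_inf; [exact: (dist1_has_inf A x).2|right; exists y].
Qed.

Lemma dist1_eq0 A x : A x -> dist1 A x = 0.
Proof.
move=> Ax; apply/eqP; rewrite eq_le dist1_ge0 andbT.
by rewrite (le_trans (dist1_le _ Ax))// mdistxx.
Qed.

Lemma dist1_gt0 A x : closed A -> ~ A x -> 0 < dist1 A x.
Proof.
move=> cA Ax; have : nbhs x (~` A).
  by apply: open_nbhs_nbhs; split=> //; exact: closed_openC.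
move=> /nbhs_ballP[e /= e0 xeA].
apply: (@lt_le_trans _ _ (Num.min 1 e)); first by rewrite lt_min ltr01.
apply: dist1_ge => [|y Ay]; first by rewrite ge_min lexx.
rewrite leNgt; apply/negP; rewrite lt_min => /andP[_].
by rewrite -mballE => /xeA.
Qed.

Lemma dist1_lipschitz A : lipschitz_fun 1 (dist1 A).
Proof.
have H x y : dist1 A x <= dist1 A y + mdist x y.
  rewrite -lerBlDr; apply: dist1_ge => [|z Az].
    by rewrite lerBlDr (le_trans (dist1_le1 _ _))// lerDl mdist_ge0.
  rewrite lerBlDr (le_trans (dist1_le _ Az))// addrC.
  exact: metric_triangle.
split=> // x y; rewrite mul1r ler_norml; apply/andP; split.
  by have := H y x; rewrite metric_sym; lra.
by have := H x y; lra.
Qed.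

End metric_space.

Section connected_boundary.
Context {T : topologicalType}.

(** If [S] missed the boundary of [A], then [A], its interior and its closure would have the same
    trace on [S], and this trace would be open and closed in [S]. *)
Lemma connected_meets_boundary (S A : set T) (a b : T) :
  connected S -> S a -> S b -> A a -> ~ A b -> S `&` (closure A `\` interior A) !=set0.
Proof.
move=> cS Sa Sb Aa Ab; apply: contrapT => /set0P/negP/negPn/eqP SA0.
suff SA : S `&` A = S by move: Sb; rewrite -SA => -[].
have cl_int x : S x -> closure A x -> interior A x.
  move=> Sx Ax; apply: contrapT => nAx.
  by have : (S `&` (closure A `\` interior A)) x by []; rewrite SA0.
apply: cS.
- by exists a.
- exists (interior A); first exact: open_interior.
  apply/seteqP; split=> [x [Sx Ax]|x [Sx /interior_subset Ax]]; split=> //.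
  by apply: cl_int => //; exact: subset_closure.
- exists (closure A); first exact: closed_closure.
  apply/seteqP; split=> [x [Sx Ax]|x [Sx Ax]]; split=> //.
    exact: subset_closure.
  by apply: interior_subset; exact: cl_int.
Qed.

End connected_boundary.

Section borel_sets.
Context {R : realType} {X : completeMetricType R}.

Lemma measurable_open (A : set X) : open A -> measurable (A : set (borel X)).
Proof. exact: sub_gen_smallest. Qed.

Lemma measurable_closed (A : set X) : closed A -> measurable (A : set (borel X)).
Proof.
move=> cA; rewrite -(setCK A); apply: (@measurableC _ (borel X)).
by apply: measurable_open; exact: closed_openC.
Qed.

Lemma open_mball (x : X) r : open (ball x r).
Proof.
rewrite openE => y; rewrite mballE => yr.
apply/nbhs_ballP; exists (r - mdist x y); first by rewrite /= subr_gt0.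
move=> z; rewrite !mballE => yz.
by apply: (le_lt_trans (metric_triangle x y z)); lra.
Qed.

Lemma measurable_mball (x : X) r : measurable (ball x r : set (borel X)).
Proof. exact: measurable_open (open_mball x r). Qed.

Lemma mballS (x y : X) r s : mdist x y + s <= r -> ball y s `<=` ball x r.
Proof.
move=> ys z; rewrite !mballE => yz.
by apply: (le_lt_trans (metric_triangle x y z)); lra.
Qed.

Lemma mball_center (x : X) r : 0 < r -> ball x r x.
Proof. by move=> r0; rewrite mballE mdistxx. Qed.

End borel_sets.

(** * Compactness of closed bounded sets *)

Section proper_space.
Context {R : realType} {X : completeMetricType R}.
Variables (mu : {measure set (borel X) -> \bar R}) (Q : R).
Hypothesis mu_balls : balls_pos_finite mu.
Hypothesis mu_Q : lower_mass_exponent mu Q.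

Lemma mu_ball_fin x r : 0 < r -> mu (ball x r) \is a fin_num.
Proof.
by move=> r0; rewrite ge0_fin_numE//; have /andP[] := mu_balls x r0.
Qed.

Lemma fine_mu_ball_gt0 x r : 0 < r -> 0 < fine (mu (ball x r)).
Proof. by move=> r0; rewrite fine_gt0//; exact: mu_balls. Qed.

(** Otherwise points of the ball at mutual distance at least [e] can be chosen forever. The balls of
    radius [e / 2] around them are disjoint, lie in [ball x (r + e)], and each has measure at least
    [m] by the lower mass bound, which contradicts finiteness of the measure of the large ball. *)
Lemma ball_totally_bounded x r e : 0 < e ->
  exists s : seq X, forall y, ball x r y -> exists2 z, z \in s & mdist z y < e.
Proof.
move=> e0; apply: contrapT => /forallNP noS.
have r0 : 0 < r.
  rewrite ltNge; apply/negP => r0; apply: (noS [::]) => y; rewrite mballE => xy.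
  by have := mdist_ge0 x y; rewrite leNgt (lt_le_trans xy).
have /choice[f fP] : forall s : seq X, exists y, ball x r y /\
    forall z, z \in s -> e <= mdist z y.
  move=> s; have /existsNP[y] := noS s.
  move=> /not_implyP[xy nz]; exists y; split=> // z zs.
  by rewrite leNgt; apply/negP => zy; apply: nz; exists z.
pose L n := iter n (fun s => f s :: s) [::].
pose U (s : seq X) : set X := foldr (fun z V => ball z (e / 2) `|` V) set0 s.
have UE s y : U s y -> exists2 z, z \in s & mdist z y < e / 2.
  elim: s => [//|z s ih] /= [|/ih[w ws wy]].
    by rewrite mballE => zy; exists z => //; rewrite mem_head.
  by exists w => //; rewrite inE ws orbT.
have mU s : measurable (U s : set (borel X)).
  elim: s => [|z s ih] /=; first exact: (@measurable0 _ (borel X)).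
  by apply: (@measurableU _ (borel X)) => //; exact: measurable_mball.
have LU n : U (L n) `<=` ball x (r + e).
  elim: n => [//|n ih] y /= [|/ih//]; rewrite !mballE => fy.
  have [/=] := fP (L n); rewrite mballE => xf _.
  by apply: (le_lt_trans (metric_triangle x (f (L n)) y)); lra.
have [C C0 CQ] := mu_Q.
have re0 : 0 < r + e by lra.
pose m := C^-1 * (e / 2 / (r + e)) `^ Q * fine (mu (ball x (r + e))).
have m0 : 0 < m.
  rewrite /m mulr_gt0//; last exact: fine_mu_ball_gt0.
  by rewrite mulr_gt0 ?invr_gt0// powR_gt0// divr_gt0//; lra.
have mL n : ((m *+ n)%:E <= mu (U (L n)))%E.
  elim: n => [|n ih]; first by rewrite mulr0n measure0.
  have dj : ball (f (L n)) (e / 2) `&` U (L n) = set0.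
    apply/seteqP; split=> // y [/=]; rewrite mballE => fy /UE[z zL zy].
    have [_ /(_ _ zL)] := fP (L n).
    rewrite leNgt => /negP; apply.
    apply: (le_lt_trans (metric_triangle z y _)).
    by rewrite (metric_sym y); lra.
  rewrite [U _]/= (measureU mu (measurable_mball _ _) (mU _) dj).
  rewrite mulrS EFinD leeD//.
  have [/= xf _] := fP (L n).
  have : ball x (r + e) (f (L n)).
    by move: xf; rewrite !mballE => xf; lra.
  have e2re : e / 2 <= r + e by lra.
  have e20 : 0 < e / 2 by lra.
  move=> /(CQ _ _ _ _ e20 e2re).
  rewrite ler_pdivlMr ?fine_mu_ball_gt0// => mf.
  by rewrite -(fineK (mu_ball_fin (f (L n)) e20)) lee_fin.
have Mfin := mu_ball_fin x re0.
have [n nM] : exists n : nat, fine (mu (ball x (r + e))) < m *+ n.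
  exists (Num.truncn (fine (mu (ball x (r + e))) / m)).+1.
  by rewrite -mulr_natr mulrC -ltr_pdivrMr// truncnS_gt.
have : (mu (U (L n)) <= mu (ball x (r + e)))%E.
  apply: le_measure; rewrite ?inE; [exact: mU|exact: measurable_mball|exact: LU].
move=> /(le_trans (mL n)).
by rewrite -(fineK Mfin) lee_fin leNgt nM.
Qed.

(** An ultrafilter containing a finite union of balls contains one of them; by total boundedness it
    is Cauchy, and completeness gives the limit. *)
Lemma compact_closed_bounded (A : set X) : closed A -> mbounded A -> compact A.
Proof.
move=> cA [x [r Ar]]; rewrite compact_ultra => F UF FA.
have cF : cauchy F.
  apply: cauchy_exP => e e0.
  have [s sP] := ball_totally_bounded x r e0.
  have : F (\big[setU/set0]_(z <- s) ball z e).
    apply: filterS FA => y /Ar /sP[z zs zy].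
    by rewrite -bigcup_seq; exists z => //; rewrite mballE.
  elim: s {sP} => [|z s ih].
    by rewrite big_nil => /(@filter_not_empty _ F _).
  rewrite big_cons; have [Fz _|Fz] := in_ultra_setVsetC (ball z e) UF.
    by exists z.
  move=> FU; apply: ih; apply: filterS (filterI Fz FU).
  by move=> y [nzy [/nzy//|]].
have Fcvg : F --> lim F := cauchy_cvg F cF.
exists (lim F); split; last exact: Fcvg.
have /closure_id -> := cA; move=> N /Fcvg FN.
exact: (filter_ex (filterI FA FN)).
Qed.

End proper_space.

(** * Ends with singleton impression *)

Section nested_compact.
Context {T : topologicalType}.
Variable C : nat -> set T.
Hypothesis C_closed : forall k, closed (C k).
Hypothesis C_decr : forall k, C k.+1 `<=` C k.
Hypothesis C_compact : compact (C 0%N).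

Lemma nested_sub (D : nat -> set T) k l : (forall k, D k.+1 `<=` D k) ->
  (k <= l)%N -> D l `<=` D k.
Proof.
move=> Dd /subnK <-; elim: (l - k)%N => [//|n ih].
by rewrite addSn; apply: subset_trans ih; exact: Dd.
Qed.

Lemma nested_compact_nonempty : (forall k, C k !=set0) -> \bigcap_k C k !=set0.
Proof.
move=> /choice[x xC].
have Cx k : (x @ \oo) (C k).
  exists k => // n /= kn; exact: (nested_sub C_decr kn).
have [p [C0p clp]] := C_compact _ (Cx 0%N); exists p => k _.
suff: closure (C k) p by exact: C_closed.
by move=> B Bp; have [q [? ?]] := clp _ _ (Cx k) Bp; exists q.
Qed.

(** If no [C k] lies in [U], the sets [D k] are nonempty, closed and decreasing, so they have a
    common point, which would belong to every [C k] but not to [U]. *)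
Lemma nested_compact_sub (U : set T) : open U -> \bigcap_k C k `<=` U ->
  exists k, C k `<=` U.
Proof.
move=> oU CU; apply: contrapT => /forallNP nC.
pose D k := C k `\` U.
have cD k : closed (D k) by apply: closedI => //; exact: open_closedC.
have Dd k : D k.+1 `<=` D k by move=> x [/C_decr].
have [p pD] : \bigcap_k D k !=set0.
  have D0 k : exists y, D k y.
    apply: contrapT => Dk0; apply: (nC k) => x Cx; apply: contrapT => nUx.
    by apply: Dk0; exists x.
  move: D0 => /choice[x xD].
  have Dx k : (x @ \oo) (D k).
    by exists k => // n /= kn; exact: (nested_sub Dd kn).
  have cD0 : compact (D 0%N).
    by apply: (subclosed_compact (cD 0%N) C_compact) => ? [].
  have [p [D0p clp]] := cD0 _ _ (Dx 0%N); exists p => k _.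
  suff: closure (D k) p by exact: cD.
  by move=> B Bp; have [q [? ?]] := clp _ _ (Dx k) Bp; exists q.
have : U p by apply: CU => k _; have [] := pD k I.
by have [] := pD 0%N I.
Qed.

End nested_compact.

Section ends_with_singleton_impression.
Context {R : realType} {X : completeMetricType R}.
Hypothesis proper : forall A : set X, closed A -> mbounded A -> compact A.
Variable Omega : set X.
Implicit Types E F : nat -> set X.

Lemma closure_mball (x : X) r s : r < s -> closure (ball x r) `<=` ball x s.
Proof.
rewrite -subr_gt0 => rs y yr; have [z] := yr _ (nbhsx_ballx y (s - r) rs).
rewrite mballE => -[]; rewrite !mballE => xz yz.
by apply: (le_lt_trans (metric_triangle x z y)); rewrite (metric_sym z y); lra.
Qed.

Lemma mbounded_closure (A : set X) : mbounded A -> mbounded (closure A).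
Proof.
move=> [x [r Ar]]; exists x, (r + 1).
by apply: subset_trans (closureS Ar) _; apply: closure_mball; lra.
Qed.

Lemma chain_closure_compact E k : chain Omega E -> compact (closure (E k)).
Proof.
move=> [accE _ _ _]; apply: proper; first exact: closed_closure.
by apply: mbounded_closure; have [] := accE k.
Qed.

Lemma chain_closure_decr E k : chain Omega E -> closure (E k.+1) `<=` closure (E k).
Proof. by move=> [_ dE _ _]; exact: closureS. Qed.

Lemma chain_nonempty E k : chain Omega E -> E k !=set0.
Proof.
move=> [accE _ _ _]; have [_ _ _ [x [clx _]]] := accE k.
by have [y [Ey _]] := clx _ filterT; exists y.
Qed.

Lemma impression_nonempty E : chain Omega E -> impression E !=set0.
Proof.
move=> cE; apply: nested_compact_nonempty.
- by move=> k; exact: closed_closure.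
- by move=> k; exact: chain_closure_decr.
- exact: chain_closure_compact.
- move=> k; have [x] := chain_nonempty k cE.
  by move=> /subset_closure; exists x.
Qed.

Lemma impression_sub_open E (U : set X) : chain Omega E -> open U ->
  impression E `<=` U -> exists k, closure (E k) `<=` U.
Proof.
move=> cE; apply: nested_compact_sub.
- by move=> k; exact: closed_closure.
- by move=> k; exact: chain_closure_decr.
- exact: chain_closure_compact.
Qed.

Lemma divides_impression E F : divides E F -> impression E `<=` impression F.
Proof. by move=> EF x xE k _; have [l /closureS] := EF k; apply; exact: xE. Qed.

Lemma divides_trans E F G : divides E F -> divides F G -> divides E G.
Proof.
move=> EF FG k; have [l FGk] := FG k; have [m EFl] := EF l.
by exists m; exact: subset_trans FGk.
Qed.

(* A connected set E_l that meets F_{k+1} and leaves F_k joins the disjoint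
   relative boundaries of F_{k+1} and F_k, hence is not small. *)
Lemma singleton_impression_divides E F x : chain Omega E -> chain Omega F ->
  impression E = [set x] -> divides F E -> divides E F.
Proof.
move=> cE cF Ex FE k; apply: contrapT => /forallNP nEF.
have [accE _ _ _] := cE; have [accF decF distF _] := cF.
have [r r0 rdist] : exists2 r, 0 < r & forall y z,
    (Omega `&` boundary (F k.+1)) y -> (Omega `&` boundary (F k)) z ->
    r <= mdist y z.
  have : (0 < set_dist (Omega `&` boundary (F k.+1))
                       (Omega `&` boundary (F k)))%E by exact: distF.
  case Hd : (set_dist _ _) => [s| |] // s0.
    exists s; first by rewrite -lte_fin.
    move=> y z Fy Fz; rewrite -lee_fin -Hd; apply: ereal_inf_lbound.
    by exists y => //; exists z.
  (* Here the distance is [+oo], so there is no pair [y], [z] and any positive number will do. *)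
  exists 1 => // y z Fy Fz.
  have : (set_dist (Omega `&` boundary (F k.+1)) (Omega `&` boundary (F k))
          <= (mdist y z)%:E)%E.
    by apply: ereal_inf_lbound; exists y => //; exists z.
  by rewrite Hd.
have r20 : 0 < r / 2 by lra.
have [l El] : exists l, closure (E l) `<=` ball x (r / 2).
  apply: impression_sub_open => //; first exact: open_mball.
  by rewrite Ex => _ ->; exact: mball_center.
have [m FEm] := FE l.
have [p Fp] := chain_nonempty (maxn m k.+1) cF.
have Ep : E l p.
  by apply: FEm; apply: (nested_sub decF) Fp; exact: leq_maxl.
have Fkp : F k.+1 p by apply: (nested_sub decF) Fp; exact: leq_maxr.
have [q Eq nFq] : exists2 q, E l q & ~ F k q.
  apply: contrapT => nq; apply: (nEF l) => q Eq.
  by apply: contrapT => nFq; apply: nq; exists q.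
have [_ conE [EOm _] _] := accE l.
have [y [Ey By]] := connected_meets_boundary conE Ep Eq Fkp
  (fun h => nFq (decF _ _ h)).
have [z [Ez Bz]] := connected_meets_boundary conE Ep Eq (decF _ _ Fkp) nFq.
have := rdist y z (conj (EOm _ Ey) By) (conj (EOm _ Ez) Bz).
have := El _ (subset_closure Ey); have := El _ (subset_closure Ez).
rewrite !mballE => xz xy; rewrite leNgt => /negP; apply.
by apply: (le_lt_trans (mdist_triangle_sym y z x)); lra.
Qed.

Lemma prime_end_of_singleton E x : chain Omega E -> impression E = [set x] ->
  let e := [set F | chain Omega F /\ equivalent_chains E F] in
  prime_end Omega e /\ singleton_impression e.
Proof.
move=> cE Ex e; split; last first.
  exists x => F [_ [EF FE]]; rewrite -Ex; apply/seteqP.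
  by split; exact: divides_impression.
split; first by exists E.
move=> _ [G cG ->] [G' [E' [[cG' [GG' G'G]] [cE' [EE' E'E]] G'E']]].
have GE : divides G E.
  by apply: divides_trans E'E; apply: divides_trans G'E'.
have EG := singleton_impression_divides cE cG Ex GE.
apply/seteqP; split=> F [cF [H1 H2]]; split=> //; split.
- exact: divides_trans EG H1.
- exact: divides_trans H2 GE.
- exact: divides_trans GE H1.
- exact: divides_trans H2 EG.
Qed.

End ends_with_singleton_impression.

(** * Curves and line integrals *)

Section curve_length.
Context {R : realType} {X : completeMetricType R}.
Implicit Types (c : R -> X) (s : seq R).

(** The sum of [curve_length] in a recursive form, suited to induction on partitions; [vsumE] links
    the two. *)
Fixpoint vsum c a s : R :=
  if s is x :: s' then mdist (c a) (c x) + vsum c x s' else 0.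

Lemma vsumE c a b s :
  \sum_(0 <= n < size s) mdist (c (nth b (a :: s) n)) (c (nth b (a :: s) n.+1))
  = vsum c a s.
Proof.
elim: s a => [a|x s ih a]; first by rewrite big_nil.
by rewrite [size _]/= big_nat_recl//= -ih.
Qed.

Lemma curve_lengthE c a b :
  curve_length c a b = ereal_sup [set (vsum c a s)%:E | s in itv_partition a b].
Proof.
by rewrite /curve_length; congr ereal_sup; apply: eq_imagel => s _; rewrite vsumE.
Qed.

Lemma vsum_cat c a s t : vsum c a (s ++ t) = vsum c a s + vsum c (last a s) t.
Proof. by elim: s a => [|x s ih] a /=; rewrite ?add0r// ih addrA. Qed.

Lemma vsum_map c f a s : vsum (c \o f) a s = vsum c (f a) (map f s).
Proof. by elim: s a => [//|x s ih] a /=; rewrite ih. Qed.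

Lemma itv_partition_ex (a b : R) : a <= b -> exists s, itv_partition a b s.
Proof.
rewrite le_eqVlt => /predU1P[->|ab]; first by exists [::]; split=> /=.
by exists [:: b]; exact: itv_partition1.
Qed.

Lemma vsum_le c (G : R -> R) a b s :
  (forall u v, a <= u -> u <= v -> v <= b -> mdist (c u) (c v) <= G v - G u) ->
  itv_partition a b s -> vsum c a s <= G b - G a.
Proof.
elim: s a => [a H|x s ih a H].
  by move=> /itv_partition_nil ->; rewrite subrr.
move=> abs; have xbs := itv_partition_cons abs.
have xb := itv_partition_le xbs.
have ax : a <= x by case: abs => /= /andP[/ltW].
have := ih x; move=> /(_ _ xbs) Hx.
have := H a x (lexx _) ax xb.
have : vsum c x s <= G b - G x.
  by apply: Hx => u v xu; apply: H; exact: le_trans xu.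
by rewrite /=; lra.
Qed.

Lemma vsum_ge_dist c a s : mdist (c a) (c (last a s)) <= vsum c a s.
Proof.
elim: s a => [a|x s ih a] /=; first by rewrite mdistxx.
by apply: (le_trans (metric_triangle _ (c x) _)); rewrite lerD2l.
Qed.

(** By the triangle inequality, inserting the point [m] into the partition does not decrease the
    sum. *)
Lemma vsum_split c a b m s : itv_partition a b s -> a <= m -> m <= b ->
  exists s1 s2, [/\ itv_partition a m s1, itv_partition m b s2 &
    vsum c a s <= vsum c a s1 + vsum c m s2].
Proof.
elim: s a => [a /itv_partition_nil <- am ma|x s ih a abs am mb].
  have -> : m = a by apply/eqP; rewrite eq_le am ma.
  by exists [::], [::]; split; [split=> /=|split=> /=|rewrite /= addr0].
have [->|] := eqVneq m a.
  by exists [::], (x :: s); split; [split=> /=| |rewrite /= add0r].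
move=> /eqP ma; have {ma}am : a < m by rewrite lt_neqAle am andbT; apply/eqP => /esym.
have [mx|xm] := ltP m x.
  exists [:: m], (x :: s); split; first exact: itv_partition1.
    by case: abs => /= /andP[_ xs] lb; split=> //=; rewrite mx.
  by rewrite /= addr0 addrA lerD2r metric_triangle.
have [s1 [s2 [p1 p2 le12]]] := ih x (itv_partition_cons abs) xm mb.
exists (x :: s1), s2; split=> //.
  by case: abs => /= /andP[ax _] _; case: p1 => xs1 l1; split; rewrite //= ax.
by rewrite /= -addrA lerD2l.
Qed.

Lemma vsum_weakly_sorted c a b s : path <=%O a s -> last a s = b ->
  exists2 t, itv_partition a b t & vsum c a t = vsum c a s.
Proof.
elim: s a => [a _ /= ->|x s ih a /= /andP[ax xs] lb].
  by exists [::] => //; split=> /=.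
have [t xbt tE] := ih x xs lb.
have [ax'|ax'] := eqVneq a x.
  by exists t; rewrite ax'// mdistxx add0r.
exists (x :: t); last by rewrite /= tE.
by case: xbt => xt lt; split=> //=; rewrite xt lt_neqAle ax' ax.
Qed.

Definition clen c a b : R := sup [set vsum c a s | s in itv_partition a b].

Section lipschitz_path.
Variables (c : R -> X) (L : R).
Hypothesis L0 : 0 <= L.
Hypothesis cL : forall u v, mdist (c u) (c v) <= L * `|u - v|.

Let cLe u v : u <= v -> mdist (c u) (c v) <= L * v - L * u.
Proof. by move=> uv; rewrite -mulrBr (le_trans (cL u v))// distrC ger0_norm// subr_ge0. Qed.

Lemma clen_has_sup a b : a <= b -> has_sup [set vsum c a s | s in itv_partition a b].
Proof.
move=> ab; split.
  by have [s abs] := itv_partition_ex ab; exists (vsum c a s), s.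
exists (L * b - L * a) => _ [s abs <-].
by apply: (vsum_le (G := fun x => L * x)) abs => u v _ uv _; exact: cLe.
Qed.

Lemma clen_ub a b s : itv_partition a b s -> vsum c a s <= clen c a b.
Proof.
move=> abs; apply: ub_le_sup; last by exists s.
by have [] := clen_has_sup (itv_partition_le abs).
Qed.

Lemma clen_le a b M : a <= b ->
  (forall s, itv_partition a b s -> vsum c a s <= M) -> clen c a b <= M.
Proof.
move=> ab H; apply: ge_sup; first by have [] := clen_has_sup ab.
by move=> _ [s abs <-]; exact: H.
Qed.

Lemma curve_length_clen a b : a <= b -> curve_length c a b = (clen c a b)%:E.
Proof.
move=> ab; rewrite curve_lengthE; apply/eqP; rewrite eq_le; apply/andP; split.
  by apply: ge_ereal_sup => _ [s abs <-]; rewrite lee_fin clen_ub.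
have [s0 abs0] := itv_partition_ex ab.
have : (((vsum c a s0)%:E)%E <= ereal_sup [set (vsum c a s)%:E | s in itv_partition a b])%E.
  by apply: ereal_sup_ubound; exists s0.
case H : (ereal_sup _) => [r| |] // _; last by rewrite leey.
rewrite lee_fin; apply: clen_le => // s abs; rewrite -lee_fin -H.
by apply: ereal_sup_ubound; exists s.
Qed.

Lemma clen_ge_dist a b : a <= b -> mdist (c a) (c b) <= clen c a b.
Proof.
move=> ab; have [s abs] := itv_partition_ex ab.
apply: le_trans (clen_ub abs); have [_ /eqP <-] := abs; exact: vsum_ge_dist.
Qed.

Lemma clen_ge0 a b : a <= b -> 0 <= clen c a b.
Proof. by move=> ab; apply: le_trans (clen_ge_dist ab); exact: mdist_ge0. Qed.

Lemma clen_le_lip a b : a <= b -> clen c a b <= L * (b - a).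
Proof.
move=> ab; apply: clen_le => // s abs; rewrite mulrBr.
by apply: (vsum_le (G := fun x => L * x)) abs => u v _ uv _; exact: cLe.
Qed.

Lemma clenD a m b : a <= m -> m <= b -> clen c a b = clen c a m + clen c m b.
Proof.
move=> am mb; have ab := le_trans am mb.
apply/eqP; rewrite eq_le; apply/andP; split.
  apply: clen_le => // s abs.
  have [s1 [s2 [p1 p2 /le_trans]]] := vsum_split c abs am mb; apply.
  by apply: lerD; exact: clen_ub.
rewrite -lerBrDr; apply: clen_le => // s1 p1.
rewrite lerBrDr addrC -lerBrDr; apply: clen_le => // s2 p2.
rewrite lerBrDr addrC.
have := clen_ub (itv_partition_cat p1 p2); rewrite vsum_cat.
by have [_ /eqP ->] := p1.
Qed.

Lemma clenxx a : clen c a a = 0.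
Proof. by apply: (@addIr _ (clen c a a)); rewrite -clenD// add0r. Qed.

(** [s] is the length function of [c], and the curve is [c] composed with a right inverse [tau] of
    [s]. The choice of [tau] is immaterial: [c] does not move between two parameters at which [s]
    agrees. *)
Lemma arclength_reparametrization (a : R) : 0 <= a ->
  exists (g : @curve R X) (s : R -> R),
  [/\ s 0 = 0, s a = len g,
      forall u v, 0 <= u -> u <= v -> s v - s u = clen c u v,
      forall u, 0 <= u -> u <= a -> g (s u) = c u &
      forall x, 0 <= x -> x <= len g -> exists u, [/\ 0 <= u, u <= a & s u = x]].
Proof.
(* The maximum extends the length function to negative arguments, so that it is continuous on all of
   [R]. *)
move=> a0; pose s u := clen c 0 (Num.max 0 u).
have sE u : 0 <= u -> s u = clen c 0 u by move=> u0; rewrite /s max_r.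
have sB u v : 0 <= u -> u <= v -> s v - s u = clen c u v.
  move=> u0 uv; rewrite !sE//; last exact: le_trans uv.
  by rewrite (clenD u0 uv) addrAC subrr add0r.
have s00 : s 0 = 0 by rewrite sE// clenxx.
have s_le u v : 0 <= u -> u <= v -> s u <= s v.
  by move=> u0 uv; rewrite -subr_ge0 sB// clen_ge0.
have s_lip u v : `|s u - s v| <= L * `|u - v|.
  wlog uv : u v / u <= v.
    move=> H; have [/H//|/ltW/H] := leP u v.
    by rewrite distrC (distrC v).
  have m0 (w : R) : 0 <= Num.max 0 w by rewrite le_max lexx.
  have muv : Num.max 0 u <= Num.max 0 v by rewrite ge_max m0 /=; move: uv; rewrite /Num.max; case: ltP; lra.
  have sm w : s w = s (Num.max 0 w) by rewrite /s (max_r (m0 w)).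
  rewrite distrC (sm u) (sm v) sB// ger0_norm ?clen_ge0//.
  apply: (le_trans (clen_le_lip muv)); rewrite ler_wpM2l// distrC ger0_norm ?subr_ge0//.
  by rewrite /Num.max; case: ltP => h1; case: ltP => h2; lra.
have s_cont : continuous s.
  move=> u; apply/cvgrPdist_le => e e0.
  have L1 : 0 < L + 1 by rewrite ltr_wpDl.
  have eL : 0 < e / (L + 1) by exact: divr_gt0.
  apply: filterS (nbhsx_ballx u _ eL) => v uv.
  apply: (le_trans (s_lip u v)).
  apply: (@le_trans _ _ ((L + 1) * `|u - v|)); first by rewrite ler_wpM2r//; lra.
  by rewrite mulrC -ler_pdivlMr//; exact: ltW.
have sur x : 0 <= x -> x <= s a -> exists u, [/\ 0 <= u, u <= a & s u = x].
  move=> x0 xa; have [] := @IVT _ s 0 a x a0.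
  - exact: continuous_subspaceT.
  - by rewrite s00 ge_min x0/= le_max xa orbT.
  - by move=> u; rewrite in_itv /= => /andP[? ?] <-; exists u.
have /choice[tau tauP] : forall x, exists u, 0 <= x -> x <= s a ->
    [/\ 0 <= u, u <= a & s u = x].
  move=> x; have [x0|x0] := leP 0 x; last by exists 0.
  have [xa|xa] := leP x (s a); last by exists 0 => _; rewrite ?leNgt ?xa.
  by have [u H] := sur x x0 xa; exists u.
have c_tau u x : 0 <= u -> u <= a -> s u = x -> c (tau x) = c u.
  move=> u0 ua sux.
  have x0 : 0 <= x by rewrite -sux -s00 s_le.
  have xa : x <= s a by rewrite -sux s_le.
  have [t0 ta tx] := tauP x x0 xa.
  apply: mdist_positivity; apply/eqP; rewrite eq_le mdist_ge0 andbT.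
  have [ut|/ltW tu] := leP u (tau x).
    by rewrite metric_sym (le_trans (clen_ge_dist ut))// -sB// tx sux subrr.
  by rewrite (le_trans (clen_ge_dist tu))// -sB// tx sux subrr.
have cd x y : 0 <= x -> x <= y -> y <= s a ->
    mdist (c (tau x)) (c (tau y)) <= y - x.
  move=> x0 xy ya.
  have [t0 ta tx] := tauP x x0 (le_trans xy ya).
  have [u0 ua uy] := tauP y (le_trans x0 xy) ya.
  have [tu|/ltW ut] := leP (tau x) (tau y).
    by apply: (le_trans (clen_ge_dist tu)); rewrite -sB// tx uy.
  have xy' : x = y.
    by apply/eqP; rewrite eq_le xy -tx -uy s_le.
  by rewrite xy' mdistxx subrr.
have arc x y : 0 <= x -> x <= y -> y <= s a ->
    curve_length (c \o tau) x y = (y - x)%:E.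
  move=> x0 xy ya; apply/eqP; rewrite eq_le; apply/andP; split.
    rewrite curve_lengthE; apply: ge_ereal_sup => _ [t xyt <-].
    rewrite lee_fin; apply: (vsum_le (G := id)) xyt => u v xu uv vy /=.
    apply: cd => //; first exact: le_trans xu.
    exact: le_trans ya.
  have [xx|xy'] := eqVneq x y.
    rewrite xx subrr curve_lengthE; apply: ereal_sup_ubound.
    by exists [::] => //; split=> /=.
  (* For the converse inequality, partitions of the interval from [tau x] to [tau y] are pushed
     forward by [s], which changes none of the visited points. *)
  have [t0 ta tx] := tauP x x0 (le_trans xy ya).
  have [u0 ua uy] := tauP y (le_trans x0 xy) ya.
  have tu : tau x <= tau y.
    rewrite leNgt; apply/negP => /ltW/(s_le _ _ u0); rewrite tx uy => yx.
    by move: xy'; rewrite eq_le xy yx.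
  have -> : y - x = clen c (tau x) (tau y) by rewrite -sB// tx uy.
  rewrite -(curve_length_clen tu) !curve_lengthE.
  apply: ge_ereal_sup => _ [t tut <-].
  have [||t' p' t'E] := @vsum_weakly_sorted (c \o tau) x y (map s t).
  - have [pt _] := tut; rewrite -tx.
    elim: t (tau x) t0 pt {tut ta tx tu} => [//|z t ih] w w0 /= /andP[wz zt].
    by rewrite s_le//= ?ih// ?(le_trans w0)// ltW.
  - by rewrite -tx last_map; have [_ /eqP ->] := tut.
  apply: ereal_sup_ubound; exists t' => //; congr (_%:E).
  rewrite t'E.
  have tzP z : tau x <= z -> z <= tau y -> c (tau (s z)) = c z.
    move=> xz zy; apply: (@c_tau z) => //; first exact: le_trans xz.
    exact: le_trans ua.
  rewrite -{1}tx -(vsum_map (c \o tau) s).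
  elim: t (tau x) tzP tut {t0 ta tx tu p' t'E} => [//|z t ih] w tzP tut /=.
  have zt := itv_partition_cons tut; have zy := itv_partition_le zt.
  have wz : w <= z by case: tut => /= /andP[/ltW].
  rewrite tzP// ?tzP// ?(le_trans wz)//.
  congr (_ + _); apply: ih => // v zv; apply: tzP; exact: le_trans zv.
have sa0 : 0 <= s a by rewrite -s00 s_le.
exists (@Curve R X (s a) (c \o tau) sa0 arc), s.
split=> //= u u0 ua; exact: c_tau.
Qed.

End lipschitz_path.
End curve_length.

Section line_integrals.
Context {R : realType}.
Local Notation leb := (@lebesgue_measure R).
Implicit Types (f : R -> \bar R) (a b c : R).

Lemma itv_integralD f a b c : a <= b -> b <= c ->
  measurable_fun (`[a, c]%classic : set R) f ->
  (forall t, a <= t <= c -> (0 <= f t)%E) ->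
  (\int[leb]_(t in `[a, c]) f t =
   \int[leb]_(t in `[a, b]) f t + \int[leb]_(t in `[b, c]) f t)%E.
Proof.
move=> ab bc mf f0.
have U : `[a, c]%classic = `[a, b[%classic `|` `[b, c]%classic :> set R.
  apply/seteqP; split=> t /=; rewrite !in_itv /=.
    move=> /andP[at' tc]; have [tb|bt] := ltP t b; first by left; rewrite at'.
    by right; rewrite tc.
  move=> [/andP[-> /ltW tb]|/andP[bt ->]]; first by rewrite (le_trans tb).
  by rewrite (le_trans ab).
rewrite U ge0_integral_setU//=.
- congr (_ + _)%E; apply: integral_itv_bndo_bndc.
  apply: measurable_funS mf => // t /=; rewrite !in_itv /= => /andP[-> /ltW tb].
  exact: le_trans bc.
- by rewrite -U.
- by move=> t Ut; have : `[a, c]%classic t by [rewrite U]; rewrite /= in_itv; exact: f0.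
- apply/disj_setPS => t [/=]; rewrite !in_itv /= => /andP[_ tb] /andP[bt _].
  by have := lt_le_trans tb bt; rewrite ltxx.
Qed.

Lemma itv_integral_cst (M a b : R) : a <= b ->
  (\int[leb]_(t in `[a, b]) M%:E = (M * (b - a))%:E)%E.
Proof.
move=> ab; rewrite integral_cst//= lebesgue_measure_itv/= lte_fin.
case: ltP => h; first by rewrite -EFinD -EFinM.
by rewrite mule0 (_ : b = a) ?subrr ?mulr0//; apply/eqP; rewrite eq_le ab h.
Qed.

Lemma itv_integral_le f (M a b : R) : a <= b -> 0 <= M ->
  measurable_fun (`[a, b]%classic : set R) f ->
  (forall t, a <= t <= b -> (0 <= f t <= M%:E)%E) ->
  (\int[leb]_(t in `[a, b]) f t <= (M * (b - a))%:E)%E.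
Proof.
move=> ab M0 mf fM; rewrite -itv_integral_cst//; apply: ge0_le_integral => //.
- by move=> t /=; rewrite in_itv => /fM/andP[].
- by move=> t /=; rewrite in_itv => /fM/andP[].
Qed.

Lemma itv_integral_ge f (M a b : R) : a <= b ->
  measurable_fun (`[a, b]%classic : set R) f ->
  (forall t, a <= t <= b -> (0 <= f t)%E /\ (M%:E <= f t)%E) ->
  ((M * (b - a))%:E <= \int[leb]_(t in `[a, b]) f t)%E.
Proof.
move=> ab mf fM; have [M0|/ltW M0] := leP 0 M.
  rewrite -itv_integral_cst//; apply: ge0_le_integral => //.
  by move=> t /=; rewrite in_itv => /fM[].
apply: (@le_trans _ _ 0%E).
  by rewrite lee_fin mulr_le0_ge0// subr_ge0.
by apply: integral_ge0 => t /=; rewrite in_itv => /fM[].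
Qed.

(** The last clause is a first-order expansion of the primitive with a quadratic error: the form
    consumed by [quadratic_increments_le], with no derivative involved. *)
Lemma lipschitz_primitive (h : R -> R) (K l : R) : 0 <= l -> 0 <= K ->
  (forall s t, 0 <= s <= l -> 0 <= t <= l -> `|h s - h t| <= K * `|s - t|) ->
  (forall t, 0 <= t <= l -> 0 <= h t) ->
  measurable_fun (`[0, l]%classic : set R) (EFin \o h) ->
  exists I : R -> R, [/\ I 0 = 0,
    forall t, 0 <= t <= l -> (\int[leb]_(u in `[0%R, t]) (h u)%:E = (I t)%:E)%E &
    forall s t, 0 <= s -> s <= t -> t <= l ->
      (t - s) * (h s - K * (t - s)) <= I t - I s <= (t - s) * (h s + K * (t - s))].
Proof.
move=> l0 K0 hK h0 mh.
pose J (s t : R) := (\int[leb]_(u in `[s, t]) (h u)%:E)%E.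
have mJ s t : 0 <= s -> t <= l -> measurable_fun (`[s, t]%classic : set R) (EFin \o h).
  move=> s0 tl; apply: measurable_funS mh => // u /=; rewrite !in_itv /= => /andP[su ut].
  by rewrite (le_trans s0)// (le_trans ut).
have Jb s t : 0 <= s -> s <= t -> t <= l ->
    (((h s - K * (t - s)) * (t - s))%:E <= J s t <= ((h s + K * (t - s)) * (t - s))%:E)%E.
  move=> s0 st tl; have hu u : s <= u <= t -> 0 <= h u /\ `|h u - h s| <= K * (t - s).
    move=> /andP[su ut].
    have u0l : 0 <= u <= l by rewrite (le_trans s0)// (le_trans ut).
    have s0l : 0 <= s <= l by rewrite s0 (le_trans st).
    split; first exact: h0.
    apply: (le_trans (hK u s u0l s0l)).
    by rewrite ler_wpM2l// ger0_norm ?subr_ge0// lerD2r.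
  apply/andP; split.
    apply: itv_integral_ge => //; first exact: mJ.
    move=> u /hu[u0]; rewrite ler_norml !lee_fin => /andP[? ?]; split=> //; lra.
  apply: itv_integral_le => //; last 2 first.
  - exact: mJ.
  - by move=> u /hu[u0]; rewrite ler_norml !lee_fin => /andP[? ?]; rewrite u0/=; lra.
  rewrite addr_ge0// ?mulr_ge0// ?subr_ge0//; apply: h0.
  by rewrite s0 (le_trans st).
have Jfin t : 0 <= t <= l -> J 0 t \is a fin_num.
  move=> /andP[t0 tl]; have /andP[J1 J2] := Jb 0 t (lexx _) t0 tl.
  by rewrite fin_numElt (lt_le_trans _ J1) ?ltNyr// (le_lt_trans J2)// ltry.
exists (fun t => fine (J 0 t)); split.
- by rewrite /J set_itv1 integral_set1.
- by move=> t tl; rewrite fineK//; exact: Jfin.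
move=> s t s0 st tl.
have := Jb s t s0 st tl.
have JD : J 0 t = (J 0%R s + J s t)%E.
  apply: itv_integralD => //; first exact: mJ.
  by move=> u /andP[u0 ut]; rewrite lee_fin h0// u0 (le_trans ut).
have Js : J 0 s \is a fin_num by apply: Jfin; rewrite s0 (le_trans st).
have Jt : J 0 t \is a fin_num by apply: Jfin; rewrite tl (le_trans s0).
have -> : J s t = (fine (J 0 t) - fine (J 0 s))%:E.
  rewrite EFinB !fineK// JD addeAC subee ?add0e//.
by rewrite !lee_fin ![(t - s) * _]mulrC.
Qed.

(** Over [N] equal steps the errors add up to [C * a ^+ 2 / N], which tends to 0. *)
Lemma quadratic_increments_le (F : R -> R) (a C e : R) : 0 <= a -> 0 < e -> 0 <= C ->
  (forall s t, 0 <= s -> s <= t -> t <= a -> t - s <= e ->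
    F t - F s <= C * (t - s) ^+ 2) ->
  F a <= F 0.
Proof.
move=> a0 e0 C0 H; apply/ler_addgt0Pr => d d0.
pose N := (maxn (Num.truncn (a / e)) (Num.truncn (C * a ^+ 2 / d))).+1.
have N0 : 0 < N%:R :> R by rewrite ltr0n.
have Ne : a / N%:R <= e.
  rewrite ler_pdivrMr// mulrC -ler_pdivrMr// ltW//.
  apply: (lt_le_trans (truncnS_gt (a / e))); rewrite ler_nat ltnS; exact: leq_maxl.
have Nd : C * a ^+ 2 / N%:R <= d.
  rewrite ler_pdivrMr// [d * _]mulrC -ler_pdivrMr// ltW//.
  apply: (lt_le_trans (truncnS_gt (C * a ^+ 2 / d))); rewrite ler_nat ltnS; exact: leq_maxr.
set h := a / N%:R in Ne.
have h0 : 0 <= h by rewrite divr_ge0// ltW.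
have step k : (k <= N)%N -> F (k%:R * h) <= F 0 + k%:R * (C * h ^+ 2).
  elim: k => [_|k ih kN]; first by rewrite !mul0r addr0.
  have kh : k%:R * h <= k.+1%:R * h by rewrite ler_wpM2r// ler_nat.
  have kha : k.+1%:R * h <= a.
    by rewrite /h mulrA ler_pdivrMr// mulrC ler_wpM2l// ler_nat.
  have hE : k.+1%:R * h - k%:R * h = h by rewrite -mulrBl -natrB// subSnn mul1r.
  have := H _ _ (mulr_ge0 (ler0n _ _) h0) kh kha; rewrite hE => /(_ Ne).
  have := ih (ltnW kN); rewrite -(natr1 k) !mulrDl !mul1r; lra.
have := step N (leqnn _).
have -> : N%:R * h = a by rewrite /h mulrC divfK// gt_eqF.
move=> /le_trans; apply; rewrite lerD2l.
apply: le_trans Nd; rewrite /h expr_div_n mulrCA.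
rewrite (_ : N%:R * (a ^+ 2 / N%:R ^+ 2) = a ^+ 2 / N%:R) ?mulrA//.
by field; rewrite gt_eqF.
Qed.

End line_integrals.

Section curves.
Context {R : realType} {X : completeMetricType R}.
Implicit Types (g : @curve R X).
Local Notation leb := (@lebesgue_measure R).

Lemma curve_lipschitz g s t : 0 <= s <= len g -> 0 <= t <= len g ->
  mdist (g s) (g t) <= `|s - t|.
Proof.
wlog st : s t / s <= t.
  move=> H hs ht; have [/H|/ltW/H] := leP s t; first exact.
  by rewrite metric_sym distrC; apply.
move=> /andP[s0 sl] /andP[t0 tl].
rewrite distrC ger0_norm ?subr_ge0// -lee_fin -(path_arclength s0 st tl).
rewrite curve_lengthE; have [u stu] := itv_partition_ex st.
apply: (@le_trans _ _ (vsum g s u)%:E).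
  by rewrite lee_fin; have [_ /eqP <-] := stu; exact: vsum_ge_dist.
by apply: ereal_sup_ubound; exists u.
Qed.

(** A curve is arbitrary outside its parameter interval; clamping the parameter to that interval
    gives a 1-Lipschitz map on [R], which is Borel. *)
Lemma measurable_curve g : exists gt : R -> borel X,
  measurable_fun [set: R] gt /\ (forall t, 0 <= t <= len g -> gt t = g t).
Proof.
pose cl (t : R) := Num.max 0 (Num.min t (len g)).
have clE t : 0 <= t <= len g -> cl t = t.
  by move=> /andP[t0 tl]; rewrite /cl min_l// max_r.
have clI t : 0 <= cl t <= len g.
  by rewrite /cl le_max lexx/= ge_max len_ge0/= ge_min lexx orbT.
have min1 (c x y : R) : x <= y -> `|Num.min x c - Num.min y c| <= y - x.
  move=> xy; rewrite ler_norml /Num.min.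
  by case: ltP => ?; case: ltP => ?; apply/andP; split; lra.
have max1 (c x y : R) : x <= y -> `|Num.max c x - Num.max c y| <= y - x.
  move=> xy; rewrite ler_norml /Num.max.
  by case: ltP => ?; case: ltP => ?; apply/andP; split; lra.
have cl1 s t : `|cl s - cl t| <= `|s - t|.
  wlog st : s t / s <= t.
    by move=> H; have [/H//|/ltW/H] := leP s t; rewrite distrC (distrC t).
  have [m1|m1] := leP (Num.min s (len g)) (Num.min t (len g)).
    apply: (le_trans (max1 _ _ _ m1)).
    by have := min1 (len g) s t st; rewrite (distrC s) (ger0_norm (_ : 0 <= t - s)) ?subr_ge0// ler_norml => /andP[? _]; lra.
  rewrite distrC; apply: (le_trans (max1 _ _ _ (ltW m1))).
  by have := min1 (len g) s t st; rewrite (distrC s) (ger0_norm (_ : 0 <= t - s)) ?subr_ge0// ler_norml => /andP[_ ?]; lra.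
exists (fun t => g (cl t)); split; last by move=> t tl; rewrite clE.
apply: (@measurability _ _ _ (borel X) setT _ (@open X)) => //.
move=> _ [U oU <-]; rewrite setTI.
apply: open_measurable; rewrite openE => t /= Ut.
have : nbhs (g (cl t)) U by apply: open_nbhs_nbhs.
move=> /nbhs_ballP[e /= e0 eU]; apply/nbhs_ballP; exists e => // s /= ts.
apply: eU; rewrite mballE (le_lt_trans _ ts)//.
by apply: le_trans (cl1 _ _); apply: curve_lipschitz.
Qed.

Lemma measurable_along g (f : X -> \bar R) (a b : R) : 0 <= a -> b <= len g ->
  measurable_fun [set: borel X] f ->
  measurable_fun (`[a, b]%classic : set R) (fun t => f (g t)).
Proof.
move=> a0 bl mf; have [gt [mgt gtE]] := measurable_curve g.
apply: (@eq_measurable_fun _ _ _ _ _ (f \o gt)).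
  move=> t; rewrite inE /= in_itv /= => /andP[at' tb]; rewrite gtE//.
  by rewrite (le_trans a0)// (le_trans tb).
apply: (@measurable_comp _ _ _ _ _ _ [set: borel X]) => //.
exact: measurable_funS mgt.
Qed.

Lemma lipschitz_borel k (f : X -> R) : lipschitz_fun k f ->
  measurable_fun [set: borel X] (EFin \o f).
Proof.
move=> /lipschitz_fun_continuous cf; apply/measurable_EFinP.
apply: (measurability _ (RGenOpens.measurableE R)).
move=> _ [_ [a [b ->] <-]]; rewrite setTI; apply: measurable_open.
by move/continuousP : cf; apply; exact: interval_open.
Qed.

Lemma curve_lipschitz_primitive g k (phi : X -> R) : lipschitz_fun k phi ->
  (forall x, 0 <= phi x) ->
  exists I : R -> R, [/\ I 0 = 0,
    forall t, 0 <= t <= len g ->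
      (\int[leb]_(u in `[0%R, t]) (phi (g u))%:E = (I t)%:E)%E &
    forall s t, 0 <= s -> s <= t -> t <= len g ->
      (t - s) * (phi (g s) - k * (t - s)) <= I t - I s <=
      (t - s) * (phi (g s) + k * (t - s))].
Proof.
move=> kphi phi0; have [k0 phik] := kphi.
apply: lipschitz_primitive => //; first exact: len_ge0.
- move=> s t hs ht; apply: (le_trans (phik _ _)).
  by rewrite ler_wpM2l//; exact: curve_lipschitz.
- by apply: (measurable_along (f := EFin \o phi)) => //; exact: lipschitz_borel kphi.
Qed.

(* The difference of v along g and the line integral of phi has quadratically
   small increments, hence no increment at all. *)
Lemma local_slope_upper_gradient (v phi : X -> R) (k e : R) : 0 < e ->
  lipschitz_fun k phi -> (forall x, 0 <= phi x) ->
  (forall x y, mdist x y <= e ->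
     `|v x - v y| <= mdist x y * Num.max (phi x) (phi y)) ->
  forall g, (`|v (g 0) - v (g (len g))|%:E <= line_integral g (EFin \o phi))%E.
Proof.
move=> e0 kphi phi0 vphi g; have [k0 phik] := kphi.
have [I [I0 IE Ib]] := curve_lipschitz_primitive g kphi phi0.
have l0 := len_ge0 g.
rewrite /line_integral IE ?lexx ?l0// lee_fin.
have step s t : 0 <= s -> s <= t -> t <= len g -> t - s <= e ->
    `|v (g t) - v (g s)| <= I t - I s + 2 * k * (t - s) ^+ 2.
  move=> s0 st tl tse.
  have gst : mdist (g t) (g s) <= t - s.
    have := @curve_lipschitz g t s; rewrite ger0_norm ?subr_ge0//.
    by apply; rewrite ?s0 ?tl ?(le_trans st)// (le_trans s0).
  have /andP[Ib1 _] := Ib s t s0 st tl.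
  apply: (le_trans (vphi _ _ (le_trans gst tse))).
  have := phik (g t) (g s); rewrite ler_norml => /andP[_ p1].
  have kd : k * mdist (g t) (g s) <= k * (t - s) by rewrite ler_wpM2l.
  have : Num.max (phi (g t)) (phi (g s)) <= phi (g s) + k * (t - s).
    by rewrite ge_max; apply/andP; split; [lra|rewrite lerDl mulr_ge0// subr_ge0].
  move=> p2.
  apply: (@le_trans _ _ ((t - s) * (phi (g s) + k * (t - s)))).
    by apply: ler_pM => //; [exact: mdist_ge0|rewrite le_max phi0].
  by apply: le_trans (_ : _ <= (t - s) * (phi (g s) - k * (t - s)) + 2 * k * (t - s) ^+ 2) _; [rewrite le_eqVlt; apply/orP; left; apply/eqP; ring|rewrite lerD2r].
have k20 : 0 <= 2 * k by rewrite mulr_ge0.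
have H1 : v (g (len g)) - I (len g) <= v (g 0) - I 0.
  apply: (@quadratic_increments_le _ (fun t => v (g t) - I t) _ (2 * k) e) => //.
  move=> s t s0 st tl tse; have := step s t s0 st tl tse.
  by rewrite ler_norml => /andP[? ?]; lra.
have H2 : - v (g (len g)) - I (len g) <= - v (g 0) - I 0.
  apply: (@quadratic_increments_le _ (fun t => - v (g t) - I t) _ (2 * k) e) => //.
  move=> s t s0 st tl tse; have := step s t s0 st tl tse.
  by rewrite ler_norml => /andP[? ?]; lra.
by rewrite ler_norml; apply/andP; split; lra.
Qed.

(* c is parametrized by cost: its speed is at most 1/phi.  Passing to arc
   length turns this into a bound for the line integral of phi. *)
Lemma line_integral_le_cost g (s : R -> R) (c : R -> X) (L a k : R) (phi : X -> R) :
  0 <= a -> 0 < L -> (forall u v, mdist (c u) (c v) <= L * `|u - v|) ->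
  s 0 = 0 -> s a = len g ->
  (forall u v, 0 <= u -> u <= v -> s v - s u = clen c u v) ->
  (forall u, 0 <= u -> u <= a -> g (s u) = c u) ->
  lipschitz_fun k phi -> (forall x, L^-1 <= phi x) ->
  (forall u v, 0 <= u -> u <= v -> v <= a ->
    mdist (c u) (c v) * (phi (c u) - k * L * (v - u)) <= v - u) ->
  (line_integral g (EFin \o phi) <= a%:E)%E.
Proof.
move=> a0 L0 cL s0 sa sB gs kphi Lphi cphi; have [k0 phik] := kphi.
have phi0 x : 0 <= phi x by rewrite (le_trans _ (Lphi x))// invr_ge0 ltW.
have [I [I0 IE Ib]] := curve_lipschitz_primitive g kphi phi0.
have l0 := len_ge0 g.
rewrite /line_integral IE ?lexx ?l0// lee_fin -sa.
have kL : 0 <= k * L by rewrite mulr_ge0// ltW.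
(* On increments this short, [A - 2 * (k * L * h)] stays positive because [phi >= L^-1]. The factor
   3 in the error constant counts two terms [k * L * h] lost in the speed bound and one lost in the
   expansion of the primitive. *)
have e0 : 0 < L^-1 / (2 * (k * L) + 1) by rewrite divr_gt0 ?invr_gt0//; lra.
suff : I (s a) - a <= I (s 0) - 0 by rewrite s0 I0; lra.
apply: (@quadratic_increments_le _ (fun t => I (s t) - t) _ (3 * k * L ^+ 2)
  (L^-1 / (2 * (k * L) + 1))) => //.
  by have L1 := ltW L0; rewrite !mulr_ge0.
move=> u v u0 uv va; rewrite ler_pdivlMr; last by lra.
set h := v - u => hs.
have h0 : 0 <= h by rewrite subr_ge0.
have klh : 0 <= k * L * h by rewrite mulr_ge0.
set D := clen c u v.
have DE : s v - s u = D by exact: sB.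
have D0 : 0 <= D by apply: clen_ge0 cL _ _ uv; exact: ltW.
have DL : D <= L * h by apply: clen_le_lip cL _ _ uv; exact: ltW.
set A := phi (c u).
have A2 : 0 < A - 2 * (k * L * h) \/ h = 0.
  have := Lphi (c u); rewrite -/A; have [->|hn0] := eqVneq h 0; first by right.
  by left; have hp : 0 < h by [rewrite lt_neqAle eq_sym hn0]; lra.
have DA : D * (A - 2 * (k * L * h)) <= h.
  have [A2' |hz] := A2; last first.
    by have -> : D = 0 by [move: DL; rewrite hz mulr0; lra]; rewrite mul0r.
  rewrite -ler_pdivlMr//; apply: (clen_le cL) => //.
  move=> t uvt; rewrite /h mulrBl.
  apply: (vsum_le (G := fun x => x / (A - 2 * (k * L * h)))) uvt.
  move=> x y ux xy yv; rewrite -mulrBl ler_pdivlMr//.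
  have x0 := le_trans u0 ux.
  apply: le_trans (cphi x y x0 xy (le_trans yv va)).
  rewrite ler_wpM2l ?mdist_ge0//.
  have : A - k * L * h <= phi (c x).
    have := phik (c u) (c x); rewrite ler_norml => /andP[_ p1].
    have := cL u x; rewrite distrC ger0_norm ?subr_ge0// => p2.
    have p3 : k * mdist (c u) (c x) <= k * (L * (x - u)) by rewrite ler_wpM2l.
    have p4 : k * L * (x - u) <= k * L * h by rewrite ler_wpM2l// /h lerD2r (le_trans xy).
    by rewrite /A; lra.
  have p5 : k * L * (y - x) <= k * L * h by rewrite ler_wpM2l// /h; lra.
  by lra.
have su0 : 0 <= s u.
  by have := sB 0 u (lexx _) u0; rewrite s0 subr0 => ->; apply: clen_ge0 cL _ _ u0; exact: ltW.
have sv : s v <= len g.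
  rewrite -sa -subr_ge0 sB//; last exact: le_trans uv.
  by apply: clen_ge0 cL _ _ va; exact: ltW.
have suv : s u <= s v by rewrite -subr_ge0 DE.
have /andP[_] := Ib _ _ su0 suv sv.
rewrite DE gs//; last exact: le_trans va.
rewrite -/A => IA.
have p6 : D * (A + k * D) <= D * (A + k * (L * h)).
  by rewrite ler_wpM2l// lerD2l ler_wpM2l.
have p7 : D * (k * L * h) <= L * h * (k * L * h) by rewrite ler_wpM2r.
rewrite (_ : I (s v) - v - (I (s u) - u) = I (s v) - I (s u) - h); last by rewrite /h; ring.
have -> : 3 * k * L ^+ 2 * h ^+ 2 = 3 * (L * h * (k * L * h)) by ring.
have E1 : D * (A + k * (L * h)) = D * (A - 2 * (k * L * h)) + 3 * (D * (k * L * h)) by ring.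
by lra.
Qed.

End curves.

(** * Chains of points and their limit curves *)

Section chains_of_points.
Context {R : realType} {X : completeMetricType R}.
Implicit Types (f : X -> R) (s : seq X) (x y : X).

(** The maximum makes the cost symmetric and charges a step at least the price at either endpoint;
    the barrier argument near the boundary uses whichever endpoint is expensive. *)
Definition step_cost f x y : R := mdist x y * Num.max (f x) (f y).

Fixpoint chain_cost f x s : R :=
  if s is y :: s' then step_cost f x y + chain_cost f y s' else 0.

Definition fine_chain f (e : R) x s := path (fun x y => step_cost f x y <= e) x s.

(** The chain as a step function of the cost spent: at time [t] it rests at the last point that can
    be paid for with [t]. It jumps, since no path between consecutive points is available. *)
Fixpoint walk f x s (t : R) : X :=
  if s is y :: s' then
    if t < step_cost f x y then x else walk f y s' (t - step_cost f x y)
  else x.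

Section cost_bounds.
Variables (f : X -> R) (c : R).
Hypothesis c0 : 0 < c.
Hypothesis cf : forall x, c <= f x.

Let f0 x : 0 <= f x. Proof. by rewrite (le_trans _ (cf x))// ltW. Qed.

Lemma step_cost_ge0 x y : 0 <= step_cost f x y.
Proof. by rewrite mulr_ge0 ?mdist_ge0// le_max f0. Qed.

Lemma step_cost_ge x y : mdist x y * f x <= step_cost f x y.
Proof. by rewrite ler_wpM2l ?mdist_ge0// le_max lexx. Qed.

Lemma mdist_le_step_cost x y : mdist x y <= c^-1 * step_cost f x y.
Proof.
rewrite mulrC ler_pdivlMr//; apply: le_trans (step_cost_ge x y).
by rewrite ler_wpM2l ?mdist_ge0.
Qed.

Lemma chain_cost_ge0 x s : 0 <= chain_cost f x s.
Proof. by elim: s x => //= y s ih x; rewrite addr_ge0// step_cost_ge0. Qed.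

Lemma mdist_le_chain_cost x s : mdist x (last x s) <= c^-1 * chain_cost f x s.
Proof.
elim: s x => [x|y s ih x] /=; first by rewrite mdistxx mulr0.
apply: (le_trans (metric_triangle x y _)); rewrite mulrDr.
by apply: lerD; [exact: mdist_le_step_cost|exact: ih].
Qed.

(** Points of the chain stay within [c^-1] times its cost from [x], so on the whole chain the price
    is at least [h x] minus the subtracted error. *)
Lemma chain_speed (h : X -> R) k x s : lipschitz_fun k h -> (forall z, h z <= f z) ->
  mdist x (last x s) * (h x - k * c^-1 * chain_cost f x s) <= chain_cost f x s.
Proof.
move=> [k0 hk] hf; elim: s x => [x|y s ih x] /=; first by rewrite mdistxx mul0r.
set d := step_cost f x y; set C := chain_cost f y s.
have d0 : 0 <= d := step_cost_ge0 x y.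
have C0 : 0 <= C := chain_cost_ge0 y s.
have kc : 0 <= k * c^-1 by rewrite mulr_ge0// invr_ge0 ltW.
have [A0|/ltW A0] := leP 0 (h x - k * c^-1 * (d + C)); last first.
  apply: (@le_trans _ _ 0); last exact: addr_ge0.
  by rewrite mulr_ge0_le0// mdist_ge0.
apply: (@le_trans _ _ ((mdist x y + mdist y (last y s)) * (h x - k * c^-1 * (d + C)))).
  by rewrite ler_wpM2r// metric_triangle.
rewrite mulrDl; apply: lerD.
  apply: le_trans (step_cost_ge x y).
  rewrite ler_wpM2l ?mdist_ge0//; apply: le_trans (hf x).
  by rewrite gerBl mulr_ge0// addr_ge0.
apply: le_trans (ih y); rewrite ler_wpM2l ?mdist_ge0//.
have := hk x y; rewrite ler_norml => /andP[_ h1].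
have h2 : k * mdist x y <= k * (c^-1 * d) by rewrite ler_wpM2l// mdist_le_step_cost.
by rewrite -/C; lra.
Qed.

Lemma walk0 x s : walk f x s 0 = x.
Proof.
elim: s x => //= y s ih x; case: ifPn => //; rewrite -leNgt => d0.
have dE : step_cost f x y = 0 by apply/eqP; rewrite eq_le d0 step_cost_ge0.
rewrite dE subr0 ih; apply/esym/mdist_positivity/eqP; rewrite eq_le mdist_ge0 andbT.
by have := mdist_le_step_cost x y; rewrite dE mulr0.
Qed.

Lemma walk_end x s t : chain_cost f x s <= t -> walk f x s t = last x s.
Proof.
elim: s x t => //= y s ih x t ct; rewrite ltNge (le_trans _ ct) ?lerDl ?chain_cost_ge0//=.
by apply: ih; lra.
Qed.

Lemma walk_in (W : set X) x s t : W x -> (forall z, z \in s -> W z) -> W (walk f x s t).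
Proof.
elim: s x t => //= y s ih x t Wx Ws; case: ifP => // _.
by apply: ih => [|z zs]; apply: Ws; rewrite inE ?eqxx// zs orbT.
Qed.

Lemma walk_from_start x s t : 0 <= t ->
  exists2 s', last x s' = walk f x s t & chain_cost f x s' <= t.
Proof.
elim: s x t => [|y s ih] x t t0 /=; first by exists [::].
case: ltP => dt; first by exists [::].
have [|s' ls' cs'] := ih y (t - step_cost f x y); first by rewrite subr_ge0.
by exists (y :: s') => //=; lra.
Qed.

(** The extra [e] arises because a step partly paid for at time [t] is charged in full. *)
Lemma walk_between e x s t u : 0 <= e -> fine_chain f e x s -> t <= u ->
  exists2 s', last (walk f x s t) s' = walk f x s u &
    chain_cost f (walk f x s t) s' <= u - t + e.
Proof.
move=> e0; elim: s x t u => [|y s ih] x t u.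
  by move=> _ tu; exists [::] => //=; lra.
move=> /= /andP[de ys] tu.
case: ltP => [td|dt]; last first.
  rewrite ltNge (le_trans dt tu)/=.
  have [|s' ? ?] := ih y (t - step_cost f x y) (u - step_cost f x y) ys; first lra.
  by exists s' => //; lra.
case: ltP => [ud|du]; first by exists [::] => //=; lra.
have [|s' ls' cs'] := walk_from_start y s (t := u - step_cost f x y).
  by rewrite subr_ge0.
by exists (y :: s') => //=; lra.
Qed.

End cost_bounds.
End chains_of_points.

Section chains_to_curve.
Context {R : realType} {X : completeMetricType R}.
Variables (phi : nat -> X -> R) (k : nat -> R) (c : R).
Hypothesis c0 : 0 < c.
Hypothesis cphi : forall n x, c <= phi n x.
Hypothesis phi_lip : forall n, lipschitz_fun (k n) (phi n).
Hypothesis phi_nd : forall n x, phi n x <= phi n.+1 x.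
Variables (W Z : set X) (x : X) (a : R).
Hypothesis cptW : compact W.
Hypothesis closedZ : closed Z.
Hypothesis Wx : W x.
Hypothesis a0 : 0 <= a.
Hypothesis chains : forall n, exists s, [/\ fine_chain (phi n) n.+1%:R^-1 x s,
  forall z, z \in s -> W z, Z (last x s) & chain_cost (phi n) x s <= a].

(* The chains, run at unit cost per unit time, accumulate by Tychonoff's theorem. *)
Lemma limit_of_chains : exists w : R -> X,
  [/\ w 0 = x, Z (w a), forall u, W (w u),
    forall u v, mdist (w u) (w v) <= c^-1 * `|u - v| &
    forall m u v, u <= v ->
      mdist (w u) (w v) * (phi m (w u) - k m * c^-1 * (v - u)) <= v - u].
Proof.
have phi_le m n z : (m <= n)%N -> phi m z <= phi n z.
  move=> /subnK <-; elim: (n - m)%N => // i ih.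
  by rewrite addSn (le_trans ih).
have [S SP] := choice chains.
pose PT := prod_topology (fun _ : R => X : topologicalType).
pose w n : PT := walk (phi n) x (S n).
have ww : (w @ \oo) [set f : PT | forall i, W (f i)].
  by exists 0%N => // n _ i /=; apply: walk_in => //; have [] := SP n.
have [g [gW clg]] : [set f : PT | forall i, W (f i)] `&` cluster (w @ \oo) !=set0.
  exact: (@tychonoff R (fun=> X) (fun=> W) (fun=> cptW) _ _ ww).
(* Clustering in the product topology allows only finitely many parameters to be compared at once;
   every estimate on the limit below involves at most two. *)
have near_g u v e N : 0 < e -> exists n, [/\ (N <= n)%N, mdist (g u) (w n u) < e &
    mdist (g v) (w n v) < e].
  move=> e0.
  have tailN : (w @ \oo) (w @` [set n | (N <= n)%N]).
    by exists N => // n /= Nn; exists n.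
  have nu : nbhs g [set f : PT | ball (g u) e (f u)].
    exact: (@proj_continuous R (fun=> X) u g _ (nbhsx_ballx (g u) e e0)).
  have nv : nbhs g [set f : PT | ball (g v) e (f v)].
    exact: (@proj_continuous R (fun=> X) v g _ (nbhsx_ballx (g v) e e0)).
  have [_ [[n Nn <-] []]] := clg _ _ tailN (filterI nu nv).
  by rewrite /= !mballE => ? ?; exists n.
(* The density [phi m] is kept fixed while the walk [w n] varies: as [phi m <= phi n], cheap chains
   for [phi n] satisfy the speed bound for [phi m], up to one step [n.+1%:R^-1]. *)
have wspeed m n u v : (m <= n)%N -> u <= v ->
    mdist (w n u) (w n v) * (phi m (w n u) - k m * c^-1 * (v - u + n.+1%:R^-1))
      <= v - u + n.+1%:R^-1 /\
    mdist (w n u) (w n v) <= c^-1 * (v - u + n.+1%:R^-1).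
  move=> mn uv; have [fS _ _ _] := SP n.
  have n0 : 0 <= n.+1%:R^-1 :> R by rewrite invr_ge0.
  have [s' ls' cs'] := walk_between n0 fS uv.
  have [k0 _] := phi_lip m.
  have kc : 0 <= k m * c^-1 by rewrite mulr_ge0// invr_ge0 ltW.
  rewrite /w -ls'; split.
    apply: (le_trans _ cs').
    apply: (le_trans _ (chain_speed c0 (cphi n) _ _ (phi_lip m) (fun z => phi_le m n z mn))).
    apply: ler_wpM2l; first exact: mdist_ge0.
    by rewrite lerD2l lerN2; apply: ler_wpM2l.
  apply: (le_trans (mdist_le_chain_cost c0 (cphi n) _ _)).
  by rewrite ler_wpM2l// invr_ge0 ltW.
have small (e : R) : 0 < e -> exists N, forall n, (N <= n)%N -> n.+1%:R^-1 <= e.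
  move=> e0; exists (Num.truncn e^-1) => n Nn.
  rewrite invf_ple ?posrE//; apply/ltW/(lt_le_trans (truncnS_gt _)).
  by rewrite ler_nat ltnS.
have glip u v : u <= v -> mdist (g u) (g v) <= c^-1 * (v - u).
  move=> uv; apply/ler_addgt0Pr => e e0.
  pose d := e / (2 + c^-1).
  have c1 : 0 < c^-1 by rewrite invr_gt0.
  have d0 : 0 < d by rewrite divr_gt0//; lra.
  have dE : d * (2 + c^-1) = e by rewrite divfK// gt_eqF//; lra.
  have [N NP] := small d d0; have [n [Nn gu gv]] := near_g u v d N d0.
  have [_ w2] := wspeed 0%N n u v (leq0n _) uv.
  have := metric_triangle (g u) (w n u) (g v).
  have := metric_triangle (w n u) (w n v) (g v); rewrite (metric_sym (w n v)).
  have := NP n Nn; move: w2 c1 d0 dE; set eta := n.+1%:R^-1; set ci := c^-1.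
  move=> w2 c1 d0 dE etad; have h : ci * eta <= ci * d by rewrite ler_wpM2l// ltW.
  by lra.
exists g; split.
- apply/esym/mdist_positivity/eqP; rewrite eq_le mdist_ge0 andbT.
  apply/ler_addgt0Pr => e e0; rewrite add0r.
  have [n [_ + _]] := near_g 0 0 e 0%N e0.
  by rewrite /w (walk0 c0 (cphi n)) metric_sym => /ltW.
- apply: closedZ => B /nbhs_ballP[e /= e0 eB].
  have [n [_ ge _]] := near_g a a e 0%N e0; exists (w n a); split; last first.
    by apply: eB; rewrite mballE.
  by have [_ _ Zl cl] := SP n; rewrite /w (walk_end c0 (cphi n)).
- exact: gW.
- move=> u v; have [uv|/ltW vu] := leP u v.
    by rewrite distrC ger0_norm ?subr_ge0// glip.
  by rewrite metric_sym ger0_norm ?subr_ge0// glip.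
move=> m u v uv; apply/ler_addgt0Pr => e e0.
have [k0 phik] := phi_lip m.
have c1 : 0 < c^-1 by rewrite invr_gt0.
set A := phi m (g u) - k m * c^-1 * (v - u).
set D := mdist (g u) (g v).
have D0 : 0 <= D := mdist_ge0 _ _.
have [A0|/ltW A0] := leP 0 A; last first.
  apply: (@le_trans _ _ 0); first by rewrite mulr_ge0_le0.
  by rewrite addr_ge0 ?subr_ge0// ltW.
have kc0 : 0 <= k m * c^-1 by rewrite mulr_ge0// ltW.
have kkc0 : 0 <= k m + k m * c^-1 by rewrite addr_ge0.
(* All errors below are multiples of [d], and [B] is the sum of their coefficients, as [h4]
   records. *)
pose B := 1 + (D + 2) * (k m + k m * c^-1) + 2 * A.
have B1 : 1 <= B by rewrite /B -addrA lerDl addr_ge0 ?mulr_ge0//; lra.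
have B0 : 0 < B by lra.
pose d := Num.min 1 (e / B).
have d0 : 0 < d by rewrite lt_min ltr01 divr_gt0.
have d1 : d <= 1 by rewrite ge_min lexx.
have dB : d * B <= e by rewrite -ler_pdivlMr// ge_min lexx orbT.
have [N NP] := small d d0.
have [n [Nn gu gv]] := near_g u v d (maxn m N) d0.
have [mn Nn'] : (m <= n)%N /\ (N <= n)%N by apply/andP; rewrite -geq_max.
have [w1 _] := wspeed m n u v mn uv.
have := NP n Nn'; move: w1; set eta := n.+1%:R^-1; set Dn := mdist (w n u) (w n v).
have eta0 : 0 <= eta by rewrite invr_ge0.
have Dn0 : 0 <= Dn := mdist_ge0 _ _.
move=> w1 etad.
have DDn : D <= Dn + 2 * d.
  have := metric_triangle (g u) (w n u) (g v).
  have := metric_triangle (w n u) (w n v) (g v); rewrite (metric_sym (w n v)).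
  by rewrite -/D -/Dn; lra.
have DnD : Dn <= D + 2 * d.
  have := metric_triangle (w n u) (g u) (w n v).
  have := metric_triangle (g u) (g v) (w n v); rewrite (metric_sym (w n u) (g u)).
  by rewrite -/D -/Dn; lra.
have AAn : A <= phi m (w n u) - k m * c^-1 * (v - u + eta) + (k m + k m * c^-1) * d.
  have := phik (g u) (w n u); rewrite ler_norml => /andP[_ h1].
  have h2 : k m * mdist (g u) (w n u) <= k m * d by rewrite ler_wpM2l// ltW.
  have h3 : k m * c^-1 * eta <= k m * c^-1 * d by rewrite ler_wpM2l.
  by rewrite /A; lra.
have h1 : D * A <= (Dn + 2 * d) * A by rewrite ler_wpM2r.
have h2 : Dn * A <= Dn * (phi m (w n u) - k m * c^-1 * (v - u + eta) +
   (k m + k m * c^-1) * d) by rewrite ler_wpM2l.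
have h3 : Dn * ((k m + k m * c^-1) * d) <= (D + 2) * ((k m + k m * c^-1) * d).
  by rewrite ler_wpM2r ?mulr_ge0// ?(ltW d0)//; lra.
have h4 : d * B = d + (D + 2) * ((k m + k m * c^-1) * d) + 2 * d * A by rewrite /B; ring.
by lra.
Qed.

(** The limit path is [c^-1]-Lipschitz, hence rectifiable, and runs at unit cost for every [phi m]
    simultaneously; one arc length parametrization thus serves all [m]. *)
Lemma curve_of_chains : exists g : curve, [/\ g 0 = x, Z (g (len g)), curve_in g W &
  forall m, (line_integral g (EFin \o phi m) <= a%:E)%E].
Proof.
have [w [w0 wa wW wlip wspeed]] := limit_of_chains.
have c1 : 0 < c^-1 by rewrite invr_gt0.
have [g [s [s0 sa sB gs sur]]] := arclength_reparametrization (ltW c1) wlip a0.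
exists g; split.
- by rewrite -{1}s0 gs.
- by rewrite -sa gs.
- by move=> t /andP[t0 tl]; have [u [u0 ua <-]] := sur t t0 tl; rewrite gs.
move=> m; apply: (line_integral_le_cost (L := c^-1) a0 c1 wlip s0 sa sB gs (phi_lip m)).
  by move=> z; rewrite invrK.
by move=> u v _ uv _; exact: wspeed.
Qed.

End chains_to_curve.

(** * Increments controlled by the minimum of two densities *)

Section increments.
Context {R : realType}.
Local Notation leb := (@lebesgue_measure R).

Lemma lebesgue_number (a b : R) (P : R -> R -> Prop) :
  (forall x, a <= x <= b -> exists2 e, 0 < e &
     forall s t, `|x - s| < e -> `|x - t| < e -> P s t) ->
  exists2 e, 0 < e & forall s t, a <= s <= b -> `|s - t| <= e -> P s t.
Proof.
move=> H.
have := @segment_compact R a b; rewrite compact_near_coveringP => cov.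
have [|N _ NP] := cov nat \oo (fun n x => forall t, `|x - t| <= n.+1%:R^-1 -> P x t) _.
  move=> x /=; rewrite in_itv /= => xab; have [e e0 eP] := H x xab.
  have e20 : 0 < e / 2 by lra.
  have nb := nbhsx_ballx x (e / 2) e20.
  exists (ball x (e / 2), [set n | n.+1%:R^-1 < e / 2]).
    split=> //=; exists (Num.truncn (e / 2)^-1) => // n /= Nn.
    rewrite invf_plt ?posrE//; apply: (lt_le_trans (truncnS_gt _)).
    by rewrite ler_nat ltnS.
  move=> [y n] /= [xy ne] t yt; apply: eP; first by apply: lt_trans xy _; lra.
  rewrite -(subrKA y) (le_lt_trans (ler_normD _ _))//.
  have xy' : `|x - y| < e / 2 by [].
  by have := le_lt_trans yt ne; lra.
exists N.+1%:R^-1; first by rewrite invr_gt0.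
by move=> s t sab st; apply: (NP N) => //=; rewrite in_itv.
Qed.

Lemma uniform_continuity_segment (k : R -> R) (a b e : R) : continuous k -> 0 < e ->
  exists2 d, 0 < d & forall s t, a <= s <= b -> `|s - t| <= d -> `|k s - k t| <= e.
Proof.
move=> ck e0; apply: lebesgue_number => x _.
have e20 : 0 < e / 2 by lra.
have /nbhs_ballP[d /= d0 dP] : nbhs x (k @^-1` ball (k x) (e / 2)).
  exact: ck (nbhsx_ballx _ _ e20).
exists d => // s t /dP + /dP; rewrite /ball/= => ks kt.
rewrite -(subrKA (k x)) (le_trans (ler_normD _ _))// (distrC _ (k x)).
by rewrite ltW//; move: ks kt; rewrite /ball_; lra.
Qed.

(** [a] and [b] are values of continuous approximants of [r1] and [r2] at the left end of a short
    interval, [a'] and [b'] their values at another point of it. If [a <= b], then [r1] is almost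
    the minimum on the whole interval. *)
Lemma min_oscillation (r1 r2 a b a' b' d : R) :
  `|a' - a| <= d -> `|b' - b| <= d -> a <= b ->
  r1 <= Num.min r1 r2 + (2 * `|r1 - a'| + (2 * `|r2 - b'| + 2 * d)).
Proof.
rewrite !ler_norml => /andP[h1 h2] /andP[h3 h4] ab.
have := ler_norm (r1 - a'); have := ler_norm (b' - r2).
rewrite (distrC b') => h5 h6.
have h7 := normr_ge0 (r1 - a'); have h8 := normr_ge0 (r2 - b').
by rewrite /Num.min; case: ltP; lra.
Qed.

(** Continuous L^1-approximants of [r1] and [r2] are nearly constant on short intervals, so on each
    of them a single density, the one with the smaller approximant, bounds the increment by the
    integral of [H]. [H] exceeds the minimum by at most [e] in integral. *)
Lemma increments_min_integral (r1 r2 w : R -> R) (l : R) : 0 <= l ->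
  leb.-integrable `[0, l] (EFin \o r1) -> leb.-integrable `[0, l] (EFin \o r2) ->
  (forall t, 0 <= r1 t) -> (forall t, 0 <= r2 t) ->
  (forall s t, 0 <= s -> s <= t -> t <= l ->
    (`|w t - w s|%:E <= \int[leb]_(u in `[s, t]) (r1 u)%:E)%E) ->
  (forall s t, 0 <= s -> s <= t -> t <= l ->
    (`|w t - w s|%:E <= \int[leb]_(u in `[s, t]) (r2 u)%:E)%E) ->
  (`|w l - w 0|%:E <= \int[leb]_(u in `[0%R, l]) (Num.min (r1 u) (r2 u))%:E)%E.
Proof.
move=> l0 i1 i2 r10 r20 w1 w2; apply/lee_addgt0Pr => e e0.
(* The terms [2 * E1] and [2 * E2] of [H] have integral at most [2 * d] each, and the constant
   [2 * d] contributes [2 * d * l]. *)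
pose d := e / (4 + 2 * l).
have d0 : 0 < d by rewrite divr_gt0//; lra.
have dE : 4 * d + 2 * d * l = e.
  by rewrite /d; field; rewrite gt_eqF//; lra.
have mE : measurable (`[0, l]%classic : set R) by [].
have fE : (leb `[0%R, l]%classic < +oo)%E.
  by rewrite lebesgue_measure_itv/=; case: ifP => // _; rewrite -EFinB ltry.
have approx (r : R -> R) : leb.-integrable `[0, l] (EFin \o r) -> exists k : R -> R,
    continuous k /\ (\int[leb]_(u in `[0%R, l]) `|(r u - k u)%:E| <= d%:E)%E.
  move=> ir; have [k [ck _ kc]] := approximation_continuous_integrable mE fE ir.
  have : \forall n \near \oo, (\int[leb]_(u in `[0%R, l]) `|(r u - k n u)%:E| <= d%:E)%E.
    have nd : nbhs (0%E : \bar R) [set x | (x <= d%:E)%E].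
      have : nbhs (0%E : \bar R) [set x | (x < d%:E)%E].
        by apply: open_ereal_lt'; rewrite lte_fin.
      by apply: filterS => x /= /ltW.
    exact: kc nd.
  by move=> [n _ nP]; exists (k n); split; [exact: ck|exact: (nP n (leqnn n))].
have [k1 [ck1 k1d]] := approx r1 i1.
have [k2 [ck2 k2d]] := approx r2 i2.
have mr1 : measurable_fun (`[0, l]%classic : set R) r1.
  by apply/measurable_EFinP; exact: measurable_int i1.
have mr2 : measurable_fun (`[0, l]%classic : set R) r2.
  by apply/measurable_EFinP; exact: measurable_int i2.
have mk (k : R -> R) : continuous k -> measurable_fun (`[0, l]%classic : set R) k.
  by move=> ck; apply: measurable_funTS; exact: continuous_measurable_fun.
pose E1 u := `|r1 u - k1 u|; pose E2 u := `|r2 u - k2 u|.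
pose m u := Num.min (r1 u) (r2 u).
have mE1 : measurable_fun (`[0, l]%classic : set R) E1.
  by apply: measurableT_comp => //; apply: measurable_funB => //; exact: mk.
have mE2 : measurable_fun (`[0, l]%classic : set R) E2.
  by apply: measurableT_comp => //; apply: measurable_funB => //; exact: mk.
have mm : measurable_fun (`[0, l]%classic : set R) m by exact: measurable_minr.
pose H u := m u + (2 * E1 u + (2 * E2 u + 2 * d)).
have mH : measurable_fun (`[0, l]%classic : set R) H.
  by do ! apply: measurable_funD => //; apply: measurable_funM.
have m0 u : 0 <= m u by rewrite le_min r10 r20.
have E10 u : 0 <= E1 u by exact: normr_ge0.
have E20 u : 0 <= E2 u by exact: normr_ge0.
have H0 u : 0 <= H u.
  by have := m0 u; have := E10 u; have := E20 u; rewrite /H; lra.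
have HI : (\int[leb]_(u in `[0%R, l]) (H u)%:E <=
    \int[leb]_(u in `[0%R, l]) (m u)%:E + e%:E)%E.
  under eq_integral do rewrite /H EFinD.
  rewrite ge0_integralD//; last 4 first.
  - by move=> u _; rewrite lee_fin.
  - exact/measurable_EFinP.
  - by move=> u _; rewrite lee_fin; have := E10 u; have := E20 u; lra.
  - by apply/measurable_EFinP; do ! apply: measurable_funD => //; apply: measurable_funM.
  apply: leeD => //; under eq_integral do rewrite EFinD.
  rewrite ge0_integralD//; last 4 first.
  - by move=> u _; rewrite lee_fin mulr_ge0// normr_ge0.
  - by apply/measurable_EFinP; apply: measurable_funM.
  - by move=> u _; rewrite lee_fin; have := E20 u; lra.
  - by apply/measurable_EFinP; do ! apply: measurable_funD => //; apply: measurable_funM.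
  under [X in (_ + X)%E]eq_integral do rewrite EFinD.
  rewrite ge0_integralD//; last 3 first.
  - by move=> u _; rewrite lee_fin mulr_ge0// normr_ge0.
  - by apply/measurable_EFinP; apply: measurable_funM.
  - by move=> u _; rewrite lee_fin mulr_ge0// ltW.
  rewrite itv_integral_cst// subr0 -dE.
  have half (E : R -> R) : measurable_fun (`[0, l]%classic : set R) E ->
      (forall u, 0 <= E u) -> (\int[leb]_(u in `[0%R, l]) (E u)%:E <= d%:E)%E ->
      (\int[leb]_(u in `[0%R, l]) (2 * E u)%:E <= (2 * d)%:E)%E.
    move=> mE' E0 Ed; under eq_integral do rewrite EFinM.
    rewrite ge0_integralZl_EFin//; last 2 first.
    - by move=> u _; rewrite lee_fin.
    - exact/measurable_EFinP.
    by rewrite EFinM; apply: lee_wpmul2l.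
  apply: (@le_trans _ _ ((2 * d)%:E + ((2 * d)%:E + (2 * d * l)%:E))%E); last first.
    by rewrite -!EFinD lee_fin; lra.
  apply: leeD; first by apply: half => // u; exact: normr_ge0.
  by apply: leeD => //; apply: half => // u; exact: normr_ge0.
pose G (t : R) := (\int[leb]_(u in `[0%R, t]) (H u)%:E)%E.
have [HIy|HIy] := eqVneq (\int[leb]_(u in `[0%R, l]) (m u)%:E)%E +oo%E.
  by rewrite HIy addye// leey.
have HIfin : (\int[leb]_(u in `[0%R, l]) (H u)%:E < +oo)%E.
  apply: le_lt_trans HI _; rewrite lte_add_pinfty ?ltry// ltey//.
have mHE : measurable_fun (`[0, l]%classic : set R) (EFin \o H) by exact/measurable_EFinP.
have mHs s t : 0 <= s -> t <= l -> measurable_fun (`[s, t]%classic : set R) (EFin \o H).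
  move=> s0 tl; apply: measurable_funS mHE => // u /=; rewrite !in_itv /= => /andP[su ut].
  by rewrite (le_trans s0)// (le_trans ut).
have Gfin s t : 0 <= s -> t <= l -> (\int[leb]_(u in `[s, t]) (H u)%:E)%E \is a fin_num.
  move=> s0 tl; rewrite ge0_fin_numE; last by apply: integral_ge0 => u _; rewrite lee_fin.
  apply: le_lt_trans HIfin; apply: ge0_subset_integral => //.
    by move=> u _; rewrite lee_fin.
  move=> u /=; rewrite !in_itv /= => /andP[su ut].
  by rewrite (le_trans s0)// (le_trans ut).
have d20 : 0 < d / 2 by lra.
have [d1 d10 u1] := uniform_continuity_segment 0 l ck1 d0.
have [d2 d20' u2] := uniform_continuity_segment 0 l ck2 d0.
have dd0 : 0 < Num.min d1 d2 by rewrite lt_min d10.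
have loc s t : 0 <= s -> s <= t -> t <= l -> t - s <= Num.min d1 d2 ->
    `|w t - w s| <= fine (G t) - fine (G s).
  move=> s0 st tl; rewrite le_min => /andP[ts1 ts2].
  have -> : fine (G t) - fine (G s) = fine (\int[leb]_(u in `[s, t]) (H u)%:E)%E.
    rewrite /G (@itv_integralD _ _ 0 s t)//; last 2 first.
    - exact: mHs.
    - by move=> u _; rewrite lee_fin.
    rewrite fineD; first by ring.
      by apply: Gfin => //; exact: le_trans tl.
    exact: Gfin.
  rewrite -lee_fin fineK; last exact: Gfin.
  have su1 u : s <= u <= t -> `|k1 u - k1 s| <= d.
    move=> /andP[su ut]; rewrite distrC; apply: u1; first by rewrite s0 (le_trans st).
    by rewrite distrC ger0_norm ?subr_ge0// (le_trans _ ts1)// lerD2r.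
  have su2 u : s <= u <= t -> `|k2 u - k2 s| <= d.
    move=> /andP[su ut]; rewrite distrC; apply: u2; first by rewrite s0 (le_trans st).
    by rewrite distrC ger0_norm ?subr_ge0// (le_trans _ ts2)// lerD2r.
  have Hr u : s <= u <= t -> k1 s <= k2 s -> r1 u <= H u.
    by move=> ust k12; rewrite /H /m /E1 /E2; exact: (min_oscillation (r1 u) (r2 u) (su1 u ust) (su2 u ust) k12).
  have Hr' u : s <= u <= t -> k2 s <= k1 s -> r2 u <= H u.
    move=> ust k21; have := min_oscillation (r2 u) (r1 u) (su2 u ust) (su1 u ust) k21.
    by rewrite minC -/(E1 u) -/(E2 u) -/(m u) /H [2 * E2 u + _]addrCA.
  have sub u : `[s, t]%classic u -> `[0, l]%classic u.
    rewrite /= !in_itv /= => /andP[su ut].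
    by rewrite (le_trans s0)// (le_trans ut).
  have [k12|/ltW k21] := leP (k1 s) (k2 s).
    apply: (le_trans (w1 s t s0 st tl)); apply: ge0_le_integral.
    - by [].
    - by move=> u _; rewrite lee_fin.
    - by apply/measurable_EFinP; exact: measurable_funS mr1.
    - exact: mHs.
    - by move=> u /=; rewrite in_itv /= => ust; rewrite lee_fin Hr.
  apply: (le_trans (w2 s t s0 st tl)); apply: ge0_le_integral.
  - by [].
  - by move=> u _; rewrite lee_fin.
  - by apply/measurable_EFinP; exact: measurable_funS mr2.
  - exact: mHs.
  - by move=> u /=; rewrite in_itv /= => ust; rewrite lee_fin Hr'.
have G0 : G 0 = 0%E by rewrite /G set_itv1 integral_set1.
apply: le_trans HI; rewrite -[X in (_ <= X)%E]fineK; last exact: Gfin.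
rewrite lee_fin -/(G l).
have F1 : w l - fine (G l) <= w 0 - fine (G 0).
  apply: (@quadratic_increments_le _ (fun t => w t - fine (G t)) l 0 _ l0 dd0 (lexx 0)).
  move=> s t s0 st tl /(loc s t s0 st tl); rewrite mul0r ler_norml => /andP[_ ?]; lra.
have F2 : - w l - fine (G l) <= - w 0 - fine (G 0).
  apply: (@quadratic_increments_le _ (fun t => - w t - fine (G t)) l 0 _ l0 dd0 (lexx 0)).
  move=> s t s0 st tl /(loc s t s0 st tl); rewrite mul0r ler_norml => /andP[? _]; lra.
by move: F1 F2; rewrite G0 /= ler_norml => F1 F2; apply/andP; split; lra.
Qed.

End increments.

(** * Weak upper gradients *)

Section subcurves.
Context {R : realType} {X : completeMetricType R}.
Local Notation leb := (@lebesgue_measure R).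
Implicit Types (g : @curve R X).

Lemma lebesgue_integral_shift (f : R -> \bar R) (s a b : R) :
  measurable_fun (`[s + a, s + b]%classic : set R) f ->
  (forall t, s + a <= t <= s + b -> (0 <= f t)%E) ->
  (\int[leb]_(t in `[a, b]) f (s + t)%R = \int[leb]_(t in `[(s + a)%R, (s + b)%R]) f t)%E.
Proof.
move=> mf f0.
have mshift : measurable_fun [set: R] (fun t : R => s + t).
  by apply: continuous_measurable_fun => t; apply: cvgD; [exact: cvg_cst|exact: cvg_id].
have Epre : (fun t => s + t) @^-1` `[s + a, s + b]%classic = `[a, b]%classic.
  by apply/seteqP; split=> t /=; rewrite !in_itv /= !lerD2l.
rewrite -Epre.
rewrite -[LHS](@ge0_integral_pushforward _ _ (measurableTypeR R) (measurableTypeR R) R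
  (fun t => s + t) mshift leb)//; last first.
  by move=> t; rewrite inE /= in_itv; exact: f0.
apply: eq_measure_integral => A mA _; apply/esym.
pose sh_mixin := isMeasurableFun.Build _ _ (measurableTypeR R) (measurableTypeR R) _ mshift.
pose sh : {mfun measurableTypeR R >-> measurableTypeR R} := HB.pack (fun t : R => s + t) sh_mixin.
apply: (lebesgue_measure_unique (mu := pushforward leb sh)) => //.
move=> _ [[x y] _ <-]; rewrite /= /pushforward.
have -> : (fun t => s + t) @^-1` `]x, y]%classic = `]x - s, y - s]%classic.
  by apply/seteqP; split=> t /=; rewrite !in_itv /= lerBrDl ltrBlDl.
rewrite !lebesgue_measure_itv/= !lte_fin ltrD2r.
by case: ifP => // _; rewrite -!EFinD; congr (_%:E); ring.
Qed.

Lemma curve_length_shift (c : R -> X) (s a b : R) :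
  curve_length (fun t => c (s + t)) a b = curve_length c (s + a) (s + b).
Proof.
have le (d : R -> X) (r x y : R) :
    (curve_length (fun t => d (r + t)%R) x y <= curve_length d (r + x)%R (r + y)%R)%E.
  rewrite !curve_lengthE; apply: ge_ereal_sup => _ [t xyt <-].
  apply: ereal_sup_ubound; exists (map (fun u => r + u) t); last first.
    by rewrite -(vsum_map d (fun u => r + u)).
  case: xyt => xt /eqP <-; split; last by rewrite last_map.
  by rewrite path_map; apply: sub_path xt => u v; rewrite /= ltrD2l.
apply/eqP; rewrite eq_le le/=.
have := le (fun t => c (s + t)) (- s) (s + a) (s + b); rewrite !addKr.
by under [X in curve_length X]eq_fun do rewrite addNKr.
Qed.

Definition subcurve_path g (s : R) : R -> X := fun t => g (s + t).

Lemma subcurve_arclength g s t : 0 <= s -> s <= t -> t <= len g ->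
  forall a b : R, 0 <= a -> a <= b -> b <= t - s ->
  curve_length (subcurve_path g s) a b = (b - a)%:E.
Proof.
move=> s0 st tl a b a0 ab bts; rewrite curve_length_shift path_arclength.
- by congr (_%:E); ring.
- by rewrite addr_ge0.
- by rewrite lerD2l.
- by apply: le_trans tl; lra.
Qed.

Lemma subcurve_exists g s t : 0 <= s -> s <= t -> t <= len g ->
  exists h : @curve R X, [/\ len h = t - s, h 0 = g s, h (len h) = g t &
    forall f, nonneg_borel f ->
      line_integral h f = (\int[leb]_(u in `[s, t]) f (g u))%E].
Proof.
move=> s0 st tl; have ts : 0 <= t - s by rewrite subr_ge0.
exists (Curve ts (subcurve_arclength s0 st tl)); split => //=.
- by rewrite /subcurve_path addr0.
- by rewrite /subcurve_path addrC subrK.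
move=> f [mf f0]; rewrite /line_integral /=.
have := @lebesgue_integral_shift (fun u => f (g u)) s 0 (t - s).
rewrite addr0 (addrC s (t - s)) subrK; apply.
  exact: measurable_along.
by move=> u _.
Qed.

Lemma line_integral_sub g s t f : 0 <= s -> s <= t -> t <= len g -> nonneg_borel f ->
  (\int[leb]_(u in `[s, t]) f (g u) <= line_integral g f)%E.
Proof.
move=> s0 st tl [mf f0]; apply: ge0_subset_integral => //.
  exact: measurable_along.
move=> u /=; rewrite !in_itv /= => /andP[su ut].
by rewrite (le_trans s0)// (le_trans ut).
Qed.

End subcurves.

Section weak_upper_gradients.
Context {R : realType} {X : completeMetricType R}.
Variables (mu : {measure set (borel X) -> \bar R}) (p : R).
Hypothesis p1 : 1 <= p.
Local Notation leb := (@lebesgue_measure R).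
Local Open Scope ereal_scope.
Implicit Types (f : X -> \bar R) (u : X -> R) (g : @curve R X).

Let p0 : (0 < p)%R. Proof. exact: lt_le_trans p1. Qed.
Let pn0 : p != 0%R. Proof. by rewrite gt_eqF. Qed.

Lemma poweR_le (x y : \bar R) (r : R) : (0 <= r)%R -> 0 <= x -> x <= y ->
  x `^ r <= y `^ r.
Proof.
move=> r0 x0 xy; apply: gt0_ler_poweR => //; rewrite in_itv /= leey andbT//.
exact: le_trans xy.
Qed.

Lemma Lp_integralE f : (forall x, 0 <= f x) -> Lp_integral mu p f = \int[mu]_x (f x `^ p).
Proof. by move=> f0; apply: eq_integral => x _; rewrite gee0_abs. Qed.

Lemma measurable_poweR_comp (f : X -> \bar R) (r : R) :
  measurable_fun [set: borel X] f -> measurable_fun [set: borel X] (fun x => f x `^ r).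
Proof. by move=> mf; apply: (measurableT_comp (measurable_poweR r)). Qed.

Lemma Lp_integral_le f h : nonneg_borel f -> nonneg_borel h ->
  (forall x, f x <= h x) -> Lp_integral mu p f <= Lp_integral mu p h.
Proof.
move=> [mf f0] [mh h0] fh; rewrite !Lp_integralE//; apply: ge0_le_integral => //.
- by move=> x _; exact: poweR_ge0.
- exact: measurable_poweR_comp.
- exact: measurable_poweR_comp.
- by move=> x _; apply: poweR_le => //; exact: ltW.
Qed.

Lemma nonneg_borel_min f h : nonneg_borel f -> nonneg_borel h ->
  nonneg_borel (fun x => mine (f x) (h x)).
Proof.
move=> [mf f0] [mh h0]; split; first exact: measurable_mine.
by move=> x; rewrite le_min f0 h0.
Qed.

Lemma line_integral_le g f h : nonneg_borel f -> nonneg_borel h ->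
  (forall x, f x <= h x) -> line_integral g f <= line_integral g h.
Proof.
move=> [mf f0] [mh h0] fh; apply: ge0_le_integral => //; exact: measurable_along.
Qed.

Lemma exceptional_sub (A B : set (@curve R X)) : A `<=` B ->
  exceptional mu p B -> exceptional mu p A.
Proof. by move=> AB [rho [nb rfin rB]]; exists rho; split=> // g /AB /rB. Qed.

Lemma exceptional_infinite f : nonneg_borel f -> Lp_integral mu p f < +oo ->
  exceptional mu p [set g | line_integral g f = +oo].
Proof. by move=> nf ffin; exists f. Qed.

(** The same density works: its integral over a curve is at least that over a subcurve. Thus almost
    every curve satisfies an upper gradient inequality on all of its subcurves. *)
Lemma exceptional_subcurve (A : set (@curve R X)) : exceptional mu p A ->
  exceptional mu p [set g | exists s t : R, [/\ (0 <= s)%R, (s <= t)%R, (t <= len g)%R &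
    exists h : @curve R X, [/\ A h, h 0%R = g s, h (len h) = g t &
      forall f, nonneg_borel f ->
      line_integral h f = \int[leb]_(u in `[s, t]) f (g u)]]].
Proof.
move=> [rho [nb rfin rA]]; exists rho; split=> // g [s [t [s0 st tl [h [Ah _ _ hf]]]]].
apply/eqP; rewrite -leye_eq -(rA h Ah) hf//.
exact: line_integral_sub.
Qed.

(* The densities are combined as an l^p sum with summable weights. *)
Lemma exceptional_bigcup (A : nat -> set (@curve R X)) :
  (forall n, exceptional mu p (A n)) -> exceptional mu p (\bigcup_n A n).
Proof.
move=> /choice[rho rhoP].
pose I n := fine (Lp_integral mu p (rho n)).
have IE n : Lp_integral mu p (rho n) = (I n)%:E.
  have [[_ r0] rf _] := rhoP n; rewrite /I fineK// ge0_fin_numE//.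
  by apply: integral_ge0 => x _; exact: poweR_ge0.
have I0 n : (0 <= I n)%R.
  by rewrite fine_ge0//; apply: integral_ge0 => x _; exact: poweR_ge0.
pose w n : R := ((1 / (2 ^ n.+1)%:R) / (1 + I n))%R.
have w0 n : (0 < w n)%R.
  by rewrite !divr_gt0// ?ltr0n ?expn_gt0// ltr_wpDr.
have wI n : (w n * I n <= 1 / (2 ^ n.+1)%:R)%R.
  have I1 : (0 < 1 + I n)%R by rewrite ltr_wpDr.
  rewrite /w mulrAC ler_pdivrMr//; apply: ler_wpM2l; last by rewrite lerDr.
  by rewrite divr_ge0.
pose S x := \sum_(n <oo) ((w n)%:E * (rho n x `^ p)).
have term0 n x : 0 <= (w n)%:E * (rho n x `^ p).
  by rewrite mule_ge0 ?poweR_ge0// lee_fin ltW.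
have mterm n : measurable_fun [set: borel X] (fun x => (w n)%:E * (rho n x `^ p)).
  apply: measurable_funeM; apply: measurable_poweR_comp.
  by have [[]] := rhoP n.
have mS : measurable_fun [set: borel X] S.
  by apply: ge0_emeasurable_sum => //.
have S0 x : 0 <= S x by apply: nneseries_ge0 => n _ _.
exists (fun x => S x `^ p^-1); split.
- split; last by move=> x; exact: poweR_ge0.
  exact: measurable_poweR_comp.
- rewrite Lp_integralE; last by move=> x; exact: poweR_ge0.
  under eq_integral do rewrite -poweRrM mulVf// poweRe1//.
  rewrite integral_nneseries//.
  apply: (@le_lt_trans _ _ (\sum_(n <oo) ((1 / (2 ^ n.+1)%:R)%:E))); last first.
    by apply: (le_lt_trans (epsilon_trick0 xpredT ler01)); rewrite ltry.
  apply: lee_nneseries => [n _ _|n _]; first by apply: integral_ge0.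
  have [[mr r0] rf _] := rhoP n.
  rewrite ge0_integralZl_EFin//; last 3 first.
  + by move=> x _; exact: poweR_ge0.
  + exact: measurable_poweR_comp.
  + by rewrite ltW.
  by rewrite -Lp_integralE// IE -EFinM lee_fin.
move=> g [n _ Ang]; have [[mr r0] rf rA] := rhoP n.
have wp0 : (0 < w n `^ p^-1)%R by rewrite powR_gt0.
apply/eqP; rewrite -leye_eq.
apply: (@le_trans _ _ (line_integral g (fun x => (w n `^ p^-1)%:E * rho n x))).
  rewrite /line_integral ge0_integralZl_EFin//; last 2 first.
  - exact: measurable_along.
  - by rewrite ltW.
  by have := rA g Ang; rewrite /line_integral => ->; rewrite gt0_muley.
apply: line_integral_le.
- split; first exact: measurable_funeM.
  by move=> x; rewrite mule_ge0// lee_fin ltW.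
- by split; [exact: measurable_poweR_comp|move=> x; exact: poweR_ge0].
move=> x.
have -> : (w n `^ p^-1)%:E * rho n x = ((w n)%:E * (rho n x `^ p)) `^ p^-1.
  rewrite poweRM ?poweR_ge0 ?lee_fin ?(ltW (w0 n))//.
  by rewrite -poweRrM mulfV// poweRe1// poweR_EFin.
apply: poweR_le => //; first by rewrite invr_ge0 ltW.
rewrite /S (@nneseriesD1 _ _ n)// leeDl//.
by apply: nneseries_ge0.
Qed.

Lemma exceptionalU (A B : set (@curve R X)) : exceptional mu p A ->
  exceptional mu p B -> exceptional mu p (A `|` B).
Proof.
move=> eA eB; pose C n := if n is 0%N then A else B.
apply: (@exceptional_sub _ (\bigcup_n C n)).
  by move=> g [Ag|Bg]; [exists 0%N|exists 1%N].
by apply: exceptional_bigcup => -[|n].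
Qed.

Lemma weak_upper_gradientP u f : weak_upper_gradient mu p (EFin \o u) f <->
  nonneg_borel f /\ exists2 G, exceptional mu p G &
    forall g, ~ G g -> `|u (g 0%R) - u (g (len g))|%:E <= line_integral g f.
Proof.
split=> -[nf [G eG Gf]]; split=> //; exists G => //.
  move=> g nGg; have [ng|cg] := pselect (nonconstant g).
    by have [+ _] := Gf g ng nGg; exact.
  have -> : g (len g) = g 0%R.
    apply: contrapT => ne; apply: cg; exists (len g), 0%R.
    by rewrite !lexx (len_ge0 g).
  rewrite subrr normr0; apply: integral_ge0 => t _.
  by have [_ ->] := nf.
by move=> g _ nGg; split=> // _; exact: Gf.
Qed.

(** Off an exceptional family, both densities are integrable along the curve and bound the
    increments of [u] on every subinterval, so [increments_min_integral] applies. *)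
Lemma weak_upper_gradient_min u f1 f2 : weak_upper_gradient mu p (EFin \o u) f1 ->
  weak_upper_gradient mu p (EFin \o u) f2 ->
  Lp_integral mu p f1 < +oo -> Lp_integral mu p f2 < +oo ->
  weak_upper_gradient mu p (EFin \o u) (fun x => mine (f1 x) (f2 x)).
Proof.
move=> /weak_upper_gradientP[nf1 [G1 eG1 G1f]] /weak_upper_gradientP[nf2 [G2 eG2 G2f]].
move=> f1fin f2fin; apply/weak_upper_gradientP; split; first exact: nonneg_borel_min.
have eF1 := exceptional_infinite nf1 f1fin.
have eF2 := exceptional_infinite nf2 f2fin.
have e1 := exceptional_subcurve eG1; have e2 := exceptional_subcurve eG2.
eexists; first exact: (exceptionalU (exceptionalU e1 e2) (exceptionalU eF1 eF2)).
move=> g; rewrite /= !not_orE => -[[n1 n2] [i1 i2]].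
have l0 := len_ge0 g.
have incr f (G : set (@curve R X)) : nonneg_borel f ->
    (forall h, ~ G h -> `|u (h 0%R) - u (h (len h))|%:E <= line_integral h f) ->
    ~ (exists s t : R, [/\ (0 <= s)%R, (s <= t)%R, (t <= len g)%R &
      exists h : @curve R X, [/\ G h, h 0%R = g s, h (len h) = g t &
      forall f, nonneg_borel f ->
      line_integral h f = \int[leb]_(u in `[s, t]) f (g u)]]) ->
    forall s t : R, (0 <= s)%R -> (s <= t)%R -> (t <= len g)%R ->
    `|u (g t) - u (g s)|%:E <= \int[leb]_(x in `[s, t]) f (g x).
  move=> nf Gf nsub s t s0 st tl.
  have [h [lh h0 hl hf]] := subcurve_exists s0 st tl.
  rewrite -hf// distrC -h0 -hl; apply: Gf => Gh; apply: nsub.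
  by exists s, t; split=> //; exists h.
have intg f : nonneg_borel f -> line_integral g f <> +oo ->
    leb.-integrable `[0%R, len g] (fun t => f (g t)).
  move=> [mf f0] fin; apply/integrableP; split; first exact: measurable_along.
  under eq_integral do rewrite gee0_abs//.
  by rewrite ltey; apply/eqP.
have ig1 := intg f1 nf1 i1; have ig2 := intg f2 nf2 i2.
(* [f] may be infinite on a null set of parameters, whereas [increments_min_integral] takes
   real-valued densities. *)
have fin_int f s t : nonneg_borel f -> leb.-integrable `[0%R, len g] (fun t => f (g t)) ->
    (0 <= s)%R -> (t <= len g)%R ->
    \int[leb]_(x in `[s, t]) f (g x) = \int[leb]_(x in `[s, t]) (fine (f (g x)))%:E.
  move=> [mf f0] ig s0 tl; have mfg := measurable_along s0 tl mf.
  apply: ae_eq_integral => //.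
    by apply/measurable_EFinP; apply: (measurableT_comp _ mfg).
  have mE : measurable (`[0%R, len g]%classic : set R) by [].
  have [N [mN N0 subN]] := @integrable_ae _ _ _ leb _ mE _ ig.
  exists N; split => // x h; apply: subN => h'; apply: h => xst; rewrite fineK//.
  apply: h'; move: xst; rewrite /= !in_itv /= => /andP[su ut].
  by rewrite (le_trans s0)// (le_trans ut).
have ifine f : nonneg_borel f -> leb.-integrable `[0%R, len g] (fun t => f (g t)) ->
    leb.-integrable `[0%R, len g] (EFin \o (fun t => fine (f (g t)))).
  move=> [mf f0] ig; have mfg := measurable_along (lexx 0%R) (lexx (len g)) mf.
  apply: le_integrable ig => //.
    by apply/measurable_EFinP; apply: (measurableT_comp _ mfg).
  by move=> x _ /=; case: (f (g x)) => [r| |] /=; rewrite ?lexx ?leey.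
rewrite distrC.
apply: (le_trans (increments_min_integral (w := fun t => u (g t)) l0 (ifine _ nf1 ig1)
   (ifine _ nf2 ig2) _ _ _ _)).
- by move=> t; rewrite fine_ge0//; have [_ ->] := nf1.
- by move=> t; rewrite fine_ge0//; have [_ ->] := nf2.
- move=> s t s0 st tl; rewrite -(fin_int f1 s t nf1 ig1 s0 tl).
  exact: (incr f1 G1).
- move=> s t s0 st tl; rewrite -(fin_int f2 s t nf2 ig2 s0 tl).
  exact: (incr f2 G2).
have [[mf1 f10] [mf2 f20]] := (nf1, nf2).
apply: ge0_le_integral => //.
- by move=> t _; rewrite lee_fin le_min !fine_ge0.
- by apply/measurable_EFinP; apply: measurable_minr;
    apply: (measurableT_comp _ (measurable_along _ _ _)).
- by apply: measurable_mine; exact: measurable_along.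
move=> t _; rewrite /mine; case: ltP => _.
  case: (f1 _) (f10 (g t)) => //= [r _|_]; rewrite ?leey// lee_fin ge_min lexx//.
case: (f2 _) (f20 (g t)) => //= [r _|_]; rewrite ?leey// lee_fin ge_min lexx orbT//.
Qed.

End weak_upper_gradients.

Section minimal_weak_upper_gradients.
Context {R : realType} {X : completeMetricType R}.
Variables (mu : {measure set (borel X) -> \bar R}) (p : R).
Hypothesis p1 : 1 <= p.
Local Notation leb := (@lebesgue_measure R).
Local Open Scope ereal_scope.
Implicit Types (f : X -> \bar R) (u : X -> R) (g : @curve R X).

Let p0 : (0 < p)%R. Proof. exact: lt_le_trans p1. Qed.

(** Almost every curve has a finite integral of [f 0], which dominates the sequence along the
    curve. *)
Lemma weak_upper_gradient_inf u (f : nat -> X -> \bar R) :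
  (forall n, weak_upper_gradient mu p (EFin \o u) (f n)) ->
  Lp_integral mu p (f 0%N) < +oo ->
  (forall n x, f n.+1 x <= f n x) ->
  weak_upper_gradient mu p (EFin \o u) (fun x => ereal_inf (range (f ^~ x))).
Proof.
move=> wf fin df; set F := fun x => _.
have nf n : nonneg_borel (f n) by have [] := wf n.
have ni x : nonincreasing_seq (f ^~ x) by apply/nonincreasing_seqP => n; exact: df.
have cF x : f ^~ x @ \oo --> F x := ereal_nonincreasing_cvgn (ni x).
have F0 x : 0 <= F x.
  by apply: le_ereal_inf_tmp => _ [n _ <-]; have [_ ->] := nf n.
have nF : nonneg_borel F.
  split=> //; apply: (@emeasurable_fun_cvg _ (borel X) R setT f F) => //.
  by move=> n; have [] := nf n.
apply/weak_upper_gradientP; split=> //.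
have /choice[G GP] : forall n, exists G, exceptional mu p G /\
    forall g, ~ G g -> `|u (g 0%R) - u (g (len g))|%:E <= line_integral g (f n).
  by move=> n; have /weak_upper_gradientP[_ [G eG Gf]] := wf n; exists G.
exists (\bigcup_n G n `|` [set g | line_integral g (f 0%N) = +oo]).
  apply: exceptionalU => //; last exact: exceptional_infinite.
  by apply: exceptional_bigcup => // n; have [] := GP n.
move=> g; rewrite not_orE => -[nG i0].
have l0 := len_ge0 g.
have mfg h : nonneg_borel h -> measurable_fun (`[0%R, len g]%classic : set R) (fun t => h (g t)).
  by move=> [mh _]; exact: measurable_along.
have i0' : leb.-integrable `[0%R, len g] (fun t => f 0%N (g t)).
  apply/integrableP; split; first exact: mfg.
  under eq_integral do rewrite gee0_abs ?(nf 0%N).2//.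
  by rewrite ltey; apply/eqP.
have mE : measurable (`[0%R, len g]%classic : set R) by [].
have [||_ _ cI] := @dominated_convergence _ _ _ leb _ mE (fun n t => f n (g t))
  (fun t => F (g t)) (fun t => f 0%N (g t)) (fun n => mfg _ (nf n)) (mfg _ nF) _ i0' _.
- by apply: aeW => t _; exact: cF.
- by apply: aeW => t n _; rewrite gee0_abs ?(nf n).2//; exact: ni.
rewrite /line_integral -(cvg_lim _ cI)//; apply: lime_ge.
  by apply/cvg_ex; eexists; exact: cI.
apply: nearW => n.
have [_ Gf] := GP n; apply: Gf => Gg; apply: nG; by exists n.
Qed.

Lemma ae_ge_of_integral_le (a b : X -> \bar R) : nonneg_borel a -> nonneg_borel b ->
  (forall x, a x <= b x) -> \int[mu]_x b x <= \int[mu]_x a x -> \int[mu]_x a x < +oo ->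
  {ae mu, forall x, b x <= a x}.
Proof.
move=> [ma a0] [mb b0] ab ba afin.
(* Where both functions are [+oo] the difference is [-oo] by convention; the maximum replaces it by
   0. *)
pose d x := maxe (b x - a x) 0.
have md : measurable_fun [set: borel X] d.
  by apply: measurable_maxe => //; exact: emeasurable_funB.
have d0 x : 0 <= d x by rewrite le_max lexx orbT.
have bE x : b x = a x + d x.
  rewrite /d; have := ab x; have := a0 x; have := b0 x.
  case: (a x) => [r| |] //; case: (b x) => [s| |] //= s0 r0 rs.
    rewrite max_l; first by rewrite -EFinB -EFinD subrKC.
    by rewrite -EFinB lee_fin subr_ge0 -lee_fin.
  by rewrite addye// gt_eqF// (lt_le_trans (ltNyr 0))// le_max lexx orbT.
have id0 : \int[mu]_x d x = 0.
  have : \int[mu]_x b x = \int[mu]_x a x + \int[mu]_x d x.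
    under eq_integral do rewrite bE.
    by rewrite ge0_integralD.
  move=> bad; move: ba; rewrite bad.
  have afn : \int[mu]_x a x \is a fin_num by rewrite ge0_fin_numE//; exact: integral_ge0.
  rewrite -[X in _ <= X]adde0 leeD2lE// => di.
  by apply/eqP; rewrite eq_le di; apply: integral_ge0.
have : \int[mu]_x `|d x| = 0 by under eq_integral do rewrite gee0_abs//.
move=> /(ae_eq_integral_abs mu measurableT md)[N [mN N0 subN]].
exists N; split=> // x nba; apply: subN => /= h; apply: nba.
by rewrite /= bE h// adde0.
Qed.

Lemma poweR_lt (x y : \bar R) : 0 <= x -> x < y -> x `^ p < y `^ p.
Proof.
move=> x0 xy; rewrite lt_neqAle poweR_le ?andbT ?(ltW xy) ?(ltW p0)//.
apply/eqP => E; have y0 := le_trans x0 (ltW xy).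
move: xy; rewrite -(poweRe1 x0) -(poweRe1 y0).
by rewrite -(mulfV (lt0r_neq0 p0)) !poweRrM E ltxx.
Qed.

(** Running minima turn a minimizing sequence into a decreasing one, whose limit [gu] attains the
    least energy. For a competitor [k], the minimum of [gu] and [k] has no smaller energy than [gu],
    so it equals [gu] almost everywhere. *)
Lemma minimal_weak_upper_gradient_exists u :
  (exists2 f, weak_upper_gradient mu p (EFin \o u) f & Lp_integral mu p f < +oo) ->
  exists gu, minimal_weak_upper_gradient mu p (EFin \o u) gu.
Proof.
move=> [f0 wf0 ff0].
pose S := [set f | weak_upper_gradient mu p (EFin \o u) f /\ Lp_integral mu p f < +oo].
pose m := ereal_inf [set Lp_integral mu p f | f in S].
have nbS f : S f -> nonneg_borel f by move=> [[]].
have Sm f : S f -> m <= Lp_integral mu p f.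
  by move=> Sf; apply: ereal_inf_lbound; exists f.
have Lp0 f : 0 <= Lp_integral mu p f by apply: integral_ge0 => x _; exact: poweR_ge0.
have m0 : 0 <= m by apply: le_ereal_inf_tmp => _ [f _ <-].
have mfin : m \is a fin_num.
  by rewrite ge0_fin_numE//; exact: (le_lt_trans (Sm f0 (conj wf0 ff0)) ff0).
have /choice[f fP] : forall n : nat, exists f, S f /\
    Lp_integral mu p f <= m + (n.+1%:R^-1)%:E.
  move=> n; have n0 : (0 < n.+1%:R^-1 :> R)%R by rewrite invr_gt0.
  have [_ [f Sf <-] fm] := lb_ereal_inf_adherent n0 mfin.
  by exists f; split=> //; exact: ltW.
have Smin f1 f2 : S f1 -> S f2 -> S (fun x => mine (f1 x) (f2 x)).
  move=> S1 S2; have [w1 l1] := S1; have [w2 l2] := S2.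
  split; first exact: weak_upper_gradient_min.
  apply: le_lt_trans l1; apply: Lp_integral_le => //.
  - by apply: nonneg_borel_min; exact: nbS.
  - exact: nbS.
  - by move=> x; rewrite ge_min lexx.
pose h := fix h n := if n is n'.+1 then (fun x => mine (h n' x) (f n x)) else f 0%N.
have Sh n : S (h n) by elim: n => [|n ih] /=; [have [] := fP 0%N|apply: Smin => //; have [] := fP n.+1].
have hf n x : h n x <= f n x by case: n => [|n] //=; rewrite ge_min lexx orbT.
have hd n x : h n.+1 x <= h n x by rewrite /= ge_min lexx.
pose gu x := ereal_inf (range (h ^~ x)).
have wgu : weak_upper_gradient mu p (EFin \o u) gu.
  apply: weak_upper_gradient_inf => //.
  - by move=> n; have [] := Sh n.
  - by have [] := Sh 0%N.
have ngu : nonneg_borel gu by have [] := wgu.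
have guh n x : gu x <= h n x by apply: ereal_inf_lbound; exists n.
have gum : Lp_integral mu p gu <= m.
  apply/lee_addgt0Pr => e e0.
  have ne : (0 < (Num.truncn e^-1).+1%:R :> R)%R by rewrite ltr0n.
  have [_ fm] := fP (Num.truncn e^-1).
  apply: (@le_trans _ _ (Lp_integral mu p (f (Num.truncn e^-1)))).
    apply: Lp_integral_le => //; first by apply: nbS; have [] := fP (Num.truncn e^-1).
    by move=> x; exact: le_trans (guh _ x) (hf _ x).
  apply: (le_trans fm); rewrite leeD2l// lee_fin invf_ple ?posrE//.
  exact/ltW/truncnS_gt.
have gufin : Lp_integral mu p gu < +oo by apply: (le_lt_trans gum); rewrite ltey_eq mfin.
have Sgu : S gu by [].
exists gu; split=> // k wk kfin.
have Smk := Smin _ _ Sgu (conj wk kfin).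
have nk : nonneg_borel k by have [] := wk.
have nm : nonneg_borel (fun x => mine (gu x) (k x)) by exact: nonneg_borel_min.
have npow (l : X -> \bar R) : nonneg_borel l -> nonneg_borel (fun x => l x `^ p).
  by move=> [ml l0]; split; [exact: measurable_poweR_comp|move=> x; exact: poweR_ge0].
have [|||N [mN N0 subN]] := @ae_ge_of_integral_le (fun x => (mine (gu x) (k x)) `^ p)
  (fun x => gu x `^ p) (npow _ nm) (npow _ ngu) _ _ _.
- move=> x; apply: poweR_le; [exact: ltW|by have [_ ->] := nm|by rewrite ge_min lexx].
- rewrite -!Lp_integralE; [|by have [] := nm|by have [] := ngu].
  exact: le_trans gum (Sm _ Smk).
- by rewrite -Lp_integralE; [have [] := Smk|have [] := nm].
exists N; split=> // x nx; apply: subN => h'; apply: nx.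
rewrite /= leNgt; apply/negP => kg; move: h'; rewrite /= /mine ltNge (ltW kg)/=.
by rewrite leNgt poweR_lt//; have [_ ->] := nk.
Qed.

End minimal_weak_upper_gradients.

(** * Consequences of the Poincare inequality *)

Section poincare_for_upper_gradients.
Context {R : realType} {X : completeMetricType R}.
Variables (mu : {measure set (borel X) -> \bar R}) (p : R).
Hypothesis p1 : 1 <= p.
Hypothesis mu_balls : balls_pos_finite mu.
Implicit Types (x y : X) (r s : R).

Let p0 : 0 < p. Proof. exact: lt_le_trans p1. Qed.

Definition ball_mean (v : X -> R) x r : R :=
  (fine (mu (ball x r)))^-1 * \int[mu]_(y in ball x r) v y.

Section bounded_function.
Variable v : X -> R.
Hypothesis mv : measurable_fun [set: borel X] (EFin \o v).
Hypothesis v01 : forall x, 0 <= v x <= 1.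

Lemma integrable_ball_dist (a : R) x r : 0 < r ->
  mu.-integrable (ball x r) (EFin \o (fun y => v y - a)).
Proof.
move=> r0; apply: (@measurable_bounded_integrable _ (borel X)).
- exact: measurable_mball.
- by have /andP[] := mu_balls x r0.
- apply: measurable_funB => //; apply: measurable_funTS.
  exact/measurable_EFinP.
exists (1 + `|a|); split; first by rewrite num_real.
move=> M aM y _ /=; apply: le_trans (ltW aM); apply: (le_trans (ler_normB _ _)).
by have /andP[v0 v1] := v01 y; rewrite lerD2r ger0_norm.
Qed.

Lemma integrable_ball x r : 0 < r -> mu.-integrable (ball x r) (EFin \o v).
Proof.
by move=> r0; have := integrable_ball_dist 0 x r0; under eq_fun do rewrite subr0.
Qed.

Lemma averageE x r : 0 < r -> average mu (ball x r) (EFin \o v) = (ball_mean v x r)%:E.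
Proof.
move=> r0; rewrite /average /ball_mean EFinM /Rintegral fineK//.
by apply: integrable_fin_num; [exact: measurable_mball|exact: integrable_ball].
Qed.

Lemma ball_mean_sub_le a x r : 0 < r ->
  `|ball_mean v x r - a| <=
  (fine (mu (ball x r)))^-1 * \int[mu]_(y in ball x r) `|v y - a|.
Proof.
move=> r0; have m0 := fine_mu_ball_gt0 mu_balls x r0.
have mB : measurable (ball x r : set (borel X)) by exact: measurable_mball.
have -> : ball_mean v x r - a =
    (fine (mu (ball x r)))^-1 * \int[mu]_(y in ball x r) (v y - a).
  rewrite RintegralB//; last 2 first.
  - exact: integrable_ball.
  - apply: (@measurable_bounded_integrable _ (borel X)) => //.
      by have /andP[] := mu_balls x r0.
    exists `|a|; split; first by rewrite num_real.
    by move=> M aM y _ /=; exact: ltW.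
  rewrite Rintegral_cst//= mulrBr /ball_mean; congr (_ - _).
  by rewrite mulrCA mulVf ?mulr1// gt_eqF.
rewrite normrM ger0_norm ?invr_ge0 ?(ltW m0)// ler_wpM2l ?invr_ge0 ?(ltW m0)//.
by apply: le_normr_Rintegral => //; exact: integrable_ball_dist.
Qed.

Lemma ball_mean_comparison (D : R) x y r s : 0 < r -> 0 < s ->
  ball y s `<=` ball x r -> 0 <= D ->
  fine (mu (ball x r)) <= D * fine (mu (ball y s)) ->
  (`|ball_mean v y s - ball_mean v x r|%:E <= D%:E *
    average mu (ball x r) (fun z => `|(v z)%:E - average mu (ball x r) (EFin \o v)|))%E.
Proof.
move=> r0 s0 sub D0 muD; rewrite averageE//; set a := ball_mean v x r.
have m0 := fine_mu_ball_gt0 mu_balls x r0.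
have m1 := fine_mu_ball_gt0 mu_balls y s0.
have mB : measurable (ball x r : set (borel X)) by exact: measurable_mball.
have mB' : measurable (ball y s : set (borel X)) by exact: measurable_mball.
have int (z : X) (t : R) : 0 < t ->
    (\int[mu]_(u in ball z t) `|v u - a|%:E)%E \is a fin_num.
  move=> t0; apply: integrable_fin_num; first exact: measurable_mball.
  exact: (integrable_abse (integrable_ball_dist a z t0)).
rewrite /average.
have -> : (\int[mu]_(z in ball x r) `|(v z)%:E - a%:E| =
    (\int[mu]_(z in ball x r) `|v z - a|)%:E)%E.
  by rewrite /Rintegral fineK// int.
rewrite -!EFinM lee_fin; apply: (le_trans (ball_mean_sub_le a y s0)).
apply: (@le_trans _ _ ((fine (mu (ball y s)))^-1 * \int[mu]_(z in ball x r) `|v z - a|)).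
  rewrite ler_wpM2l ?invr_ge0 ?(ltW m1)//.
  apply: fine_le; [exact: int|exact: int|].
  apply: ge0_subset_integral => //.
  apply/measurable_EFinP; apply: measurableT_comp => //.
  by apply: measurable_funB => //; apply: measurable_funTS; exact/measurable_EFinP.
rewrite mulrA ler_wpM2r//; first by apply: Rintegral_ge0.
by rewrite ler_pdivlMr// mulrC ler_pdivrMr.
Qed.

End bounded_function.

Lemma diam_ball_le x r : 0 <= r -> (diam (ball x r) <= (2 * r)%:E)%E.
Proof.
move=> r0; apply: ge_ereal_sup => _ [y xy [z xz <-]].
move: xy xz; rewrite !mballE lee_fin => xy xz.
by apply: (le_trans (mdist_triangle_sym y z x)); lra.
Qed.

(** The Poincare inequality in contrapositive form: if the means over a ball and a comparable
    smaller ball differ by more than [C * D * r * tau], then [f] has p-mean at least [tau] on the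
    dilated ball. Values in [0, 1] and bounded support are there to put [v] in the Newtonian
    space. *)
Definition oscillation_energy_bound (C lambda : R) :=
  forall (v : X -> R) (f : X -> \bar R) (z0 : X) (r0 : R),
    measurable_fun [set: borel X] (EFin \o v) ->
    (forall x, 0 <= v x <= 1) -> 0 < r0 -> (forall x, ~ ball z0 r0 x -> v x = 0) ->
    upper_gradient (EFin \o v) f -> (Lp_integral mu p f < +oo)%E ->
    forall (x y : X) (r s D tau : R), 0 < r -> 0 < s -> ball y s `<=` ball x r ->
      0 < D -> fine (mu (ball x r)) <= D * fine (mu (ball y s)) -> 0 <= tau ->
      C * D * r * tau < `|ball_mean v y s - ball_mean v x r| ->
      ((tau `^ p)%:E * mu (ball x (lambda * r)) <=
        \int[mu]_(w in ball x (lambda * r)) (f w `^ p))%E.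

(* The minimal weak upper gradient of v is below f, so the Poincare inequality
   holds with f in its place.  Lower bounds for the oscillation of v thus become
   lower bounds for the p-energy of f. *)
Lemma poincare_oscillation : poincare mu p -> exists C lambda : R,
  [/\ 0 < C, 1 <= lambda & oscillation_energy_bound C lambda].
Proof.
(* The factor 2 pays for [diam_ball_le]. *)
move=> [C [lambda [C0 l1 PI]]]; exists (2 * C), lambda; split=> //; first lra.
move=> v f z0 r0 mv v01 r00 vsupp uf ffin x y r s D tau rp sp sub D0 muD tau0 osc.
have nf : nonneg_borel f by case: uf.
have wf : weak_upper_gradient mu p (EFin \o v) f.
  apply/weak_upper_gradientP; split=> //; exists set0.
    exists (fun=> 0%E); split.
    - by split=> //; exact: measurable_cst.
    - rewrite Lp_integralE//; under eq_integral do rewrite poweR0r ?gt_eqF//.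
      by rewrite integral0.
    - by [].
  move=> g _; have [ng|cg] := pselect (nonconstant g).
    have [_ /(_ g ng)[+ _]] := uf; exact.
  have -> : g (len g) = g 0.
    apply: contrapT => ne; apply: cg; exists (len g), 0.
    by rewrite !lexx (len_ge0 g).
  rewrite subrr normr0; apply: integral_ge0 => t _.
  by have [_ ->] := nf.
have [gu mgu] : exists gu, minimal_weak_upper_gradient mu p (EFin \o v) gu.
  by apply: minimal_weak_upper_gradient_exists => //; exists f.
have [[ngu _] gufin gumin] := mgu.
have guf := gumin f wf ffin.
have newt : newtonian mu p (EFin \o v).
  split; first by exists (EFin \o v) => //; apply: aeW.
  apply: lte_add_pinfty; last first.
    by apply: le_lt_trans ffin; apply: ereal_inf_lbound; exists f.
  rewrite Lp_integralE; last by move=> w; rewrite lee_fin; case/andP: (v01 w).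
  apply: (@le_lt_trans _ _ (\int[mu]_(w in ball z0 r0) 1)%E); last first.
    rewrite integral_cst/=; last exact: measurable_mball.
    by rewrite mul1e; have /andP[] := mu_balls z0 r00.
  rewrite [leRHS]integral_mkcond; apply: ge0_le_integral => //.
  - by move=> w _; exact: poweR_ge0.
  - exact: measurable_poweR_comp.
  - apply/(measurable_restrictT _ _).1; first exact: measurable_mball.
    exact: measurable_cst.
  move=> w _; rewrite patchE; case: ifPn => [_|].
    rewrite /= lee_fin.
    have /andP[v0 v1] := v01 w.
    by have := @ge0_ler_powR R p (ltW p0) (v w) 1; rewrite powR1; apply; rewrite ?nnegrE.
  by rewrite notin_setE => /vsupp /= ->; rewrite powR0 ?gt_eqF.
have lr0 : 0 < lambda * r by rewrite mulr_gt0//; lra.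
have mlB : measurable (ball x (lambda * r) : set (borel X)) by exact: measurable_mball.
have Mfin := mu_ball_fin mu_balls x lr0.
have M0 := fine_mu_ball_gt0 mu_balls x lr0.
have mfp : measurable_fun [set: borel X] (fun w => f w `^ p)%E.
  by apply: measurable_poweR_comp; have [] := nf.
have mgp : measurable_fun [set: borel X] (fun w => gu w `^ p)%E.
  by apply: measurable_poweR_comp; have [] := ngu.
have guleF : (\int[mu]_(w in ball x (lambda * r)) (gu w `^ p) <=
    \int[mu]_(w in ball x (lambda * r)) (f w `^ p))%E.
  apply: ae_ge0_le_integral => //.
  - by move=> w _; exact: poweR_ge0.
  - exact: measurable_funTS.
  - by move=> w _; exact: poweR_ge0.
  - exact: measurable_funTS.
  have [N [mN N0 subN]] := guf; exists N; split=> // w h; apply: subN => /= h'.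
  by apply: h => _; apply: poweR_le => //; [exact: ltW|have [_ ->] := ngu].
apply: le_trans guleF.
set A := (\int[mu]_(w in _) _)%E.
have A0 : (0 <= A)%E by apply: integral_ge0 => w _; exact: poweR_ge0.
pose a := average mu (ball x (lambda * r)) (fun w => gu w `^ p)%E.
have aE : a = ((fine (mu (ball x (lambda * r))))^-1%:E * A)%E by [].
suff ta : ((tau `^ p)%:E <= a)%E.
  have Me : (0 <= (fine (mu (ball x (lambda * r))))%:E)%E by rewrite lee_fin ltW.
  have := lee_wpmul2r Me ta.
  rewrite aE [X in (_ <= X)%E]muleAC -[X in (_ <= X * _)%E]EFinM mulVf ?gt_eqF//.
  by rewrite mul1e fineK.
rewrite leNgt; apply/negP => at'.
have a0 : (0 <= a)%E by rewrite aE mule_ge0// lee_fin invr_ge0 ltW.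
have apt : (a `^ p^-1 <= tau%:E)%E.
  have -> : tau%:E = ((tau `^ p)%:E `^ p^-1)%E.
    by rewrite poweR_EFin -powRrM mulfV ?gt_eqF// powRr1.
  by apply: poweR_le => //; [rewrite invr_ge0 ltW|exact: ltW].
have main := ball_mean_comparison mv v01 rp sp sub (ltW D0) muD.
have De : (0 <= D%:E)%E by rewrite lee_fin ltW.
have := le_trans main (lee_wpmul2l De (PI x r (EFin \o v) gu rp newt mgu)).
apply/negP; rewrite -ltNge.
apply: (@le_lt_trans _ _ (D%:E * (C%:E * (2 * r)%:E * tau%:E))%E).
  apply: lee_wpmul2l; first by rewrite lee_fin ltW.
  apply: lee_pmul => //.
  - apply: mule_ge0; first by rewrite lee_fin ltW.
    apply: (@le_trans _ _ (mdist x x)%:E); first by rewrite lee_fin mdist_ge0.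
    by apply: ereal_sup_ubound; exists x; [exact: mball_center|exists x; [exact: mball_center|]].
  - exact: poweR_ge0.
  - apply: lee_wpmul2l; first by rewrite lee_fin ltW.
    by apply: diam_ball_le; exact: ltW.
rewrite -!EFinM lte_fin; apply: le_lt_trans osc.
by rewrite le_eqVlt; apply/orP; left; apply/eqP; ring.
Qed.

End poincare_for_upper_gradients.

(** * Lipschitz majorants of Borel densities *)

Section outer_regularity.
Context {R : realType} {X : completeMetricType R}.
Variable nu : {measure set (borel X) -> \bar R}.
Hypothesis nu_fin : (nu setT < +oo)%E.
Local Open Scope ereal_scope.

(** Approximation from inside and outside at once, so that the class is stable under complements and
    is a sigma-algebra. *)
Let sandwich (A : set X) := forall e : R, (0 < e)%R -> exists C O : set X,
  [/\ closed C, open O, C `<=` A, A `<=` O & nu (O `\` C) < e%:E].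

Let finite (A : set X) : measurable (A : set (borel X)) -> nu A < +oo.
Proof.
move=> mA; apply: le_lt_trans nu_fin; apply: le_measure; rewrite ?inE//.
Qed.

Let mOC (O C : set X) : open O -> closed C -> measurable (O `\` C : set (borel X)).
Proof.
move=> oO cC; apply: (@measurableD _ (borel X)).
  exact: measurable_open.
exact: measurable_closed.
Qed.

Let cvg0_lt (F : nat -> set X) (e : R) : (0 < e)%R ->
  (forall n, measurable (F n : set (borel X))) -> (forall n, F n.+1 `<=` F n) ->
  nu (\bigcap_n F n) < e%:E -> exists n, nu (F n) < e%:E.
Proof.
move=> e0 mF dF Fe; have ni : nonincreasing_seq F.
  by apply/nonincreasing_seqP => n; apply/subsetPset; exact: dF.
have mI : measurable (\bigcap_n F n : set (borel X)).
  by apply: (@bigcapT_measurable _ (borel X)).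
have := @nonincreasing_cvg_mu _ (borel X) R nu F (finite (mF 0%N)) mF mI ni.
have nb : nbhs (nu (\bigcap_n F n)) [set x | x < e%:E] by exact: open_ereal_lt'.
by move=> /(_ _ nb)[n _ nP]; exists n; apply: (nP n (leqnn n)).
Qed.

Let sandwich_open (U : set X) : open U -> sandwich U.
Proof.
move=> oU e e0.
pose C n := [set x : X | (n.+1%:R^-1 <= dist1 (~` U) x)%R].
have cC n : closed (C n).
  have : continuous (dist1 (~` U)) := lipschitz_fun_continuous (dist1_lipschitz _).
  by move=> /continuous_closedP/(_ _ (@closed_ge R n.+1%:R^-1)).
have CU n : C n `<=` U.
  move=> x Cx; apply: contrapT => nUx; move: Cx; rewrite /C /= dist1_eq0//.
  by rewrite leNgt invr_gt0 ltr0n.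
have [n nP] : exists n, nu (U `\` C n) < e%:E.
  apply: cvg0_lt => //; first by move=> n; exact: mOC.
    move=> n x [Ux nCx]; split=> // Cx; apply: nCx; apply: le_trans Cx.
    by rewrite lef_pV2 ?posrE// ler_nat.
  suff -> : \bigcap_n (U `\` C n) = set0 by rewrite measure0 lte_fin.
  apply/seteqP; split=> // x h; have [Ux _] := h 0%N I.
  have d0 : (0 < dist1 (~` U) x)%R.
    by apply: dist1_gt0; [exact: open_closedC|].
  have [_] := h (Num.truncn (dist1 (~` U) x)^-1) I; apply; rewrite /C /=.
  by rewrite invf_ple ?posrE// ltW// truncnS_gt.
by exists (C n), U; split.
Qed.

Let sandwichC (A : set X) : sandwich A -> sandwich (setT `\` A).
Proof.
move=> sA e e0; have [C [ O [clC oO CA AO OC]]] := sA e e0.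
exists (~` O), (~` C); split.
- exact: open_closedC.
- exact: closed_openC.
- by move=> x nOx; split=> // Ax; apply: nOx; exact: AO.
- by move=> x [_ nAx] Cx; apply: nAx; exact: CA.
- by rewrite (_ : ~` C `\` ~` O = O `\` C)//; rewrite setDE setCK setIC.
Qed.

Let sandwich_bigcup (A : nat -> set X) : (forall n, sandwich (A n)) ->
  sandwich (\bigcup_n A n).
Proof.
move=> sA e e0; have e20 : (0 < e / 2)%R by lra.
have en0 n : (0 < e / 2 / (2 ^ n.+1)%:R)%R by rewrite divr_gt0// ltr0n expn_gt0.
have /choice[f fP] : forall n, exists CO : set X * set X, [/\ closed CO.1, open CO.2,
    CO.1 `<=` A n, A n `<=` CO.2 & nu (CO.2 `\` CO.1) < (e / 2 / (2 ^ n.+1)%:R)%:E].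
  by move=> n; have [C [ O H]] := sA n _ (en0 n); exists (C, O).
pose O := \bigcup_n (f n).2.
have oO : open O by apply: bigcup_open => n _; have [] := fP n.
(* The union of all closed sets need not be closed; finitely many suffice up to small measure, by
   continuity from above. *)
pose D n := \big[setU/set0]_(i < n) (f i).1.
have cD n : closed (D n).
  rewrite /D; elim/big_ind: _ => //; first exact: closed0.
    by move=> P Q; exact: closedU.
  by move=> i _; have [] := fP i.
have [n nP] : exists n, nu (O `\` D n) < e%:E.
  apply: cvg0_lt => //; first by move=> n; exact: mOC.
    by move=> n x [Ox nDx]; split=> // Dx; apply: nDx; rewrite /D big_ord_recr; left.
  apply: (@le_lt_trans _ _ (e / 2)%:E); last by rewrite lte_fin; lra.
  apply: le_trans (epsilon_trick0 xpredT (ltW e20)).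
  apply: (@le_trans _ _ (\sum_(n <oo) nu ((f n).2 `\` (f n).1))); last first.
    apply: lee_nneseries => [n _ _|n _]; first exact: measure_ge0.
    by have [_ _ _ _ /ltW] := fP n.
  apply: (@measure_sigma_subadditive _ _ (borel X)).
  - by move=> n; have [? ? _ _ _] := fP n; exact: mOC.
  - by apply: (@bigcapT_measurable _ (borel X)) => n; exact: mOC.
  - move=> x h; have [[n _ Onx] _] := h 0%N I; exists n => //; split=> // Cnx.
    by have [_] := h n.+1 I; apply; rewrite /D big_ord_recr; right.
exists (D n), O; split=> //.
- rewrite /D; elim: n {nP} => [|n ih]; first by rewrite big_ord0.
  rewrite big_ord_recr /= => x [/ih//|fx]; exists n => //.
  by have [_ _ + _ _] := fP n; apply.
- by move=> x [n' _ Ax]; exists n' => //; have [_ _ _ + _] := fP n'; apply.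
Qed.

Lemma outer_regular (A : set X) (e : R) : measurable (A : set (borel X)) -> (0 < e)%R ->
  exists O : set X, [/\ open O, A `<=` O & nu O <= nu A + e%:E].
Proof.
move=> mA e0.
have sA : sandwich A.
  have : <<s @open X >> `<=` sandwich; last by apply.
  apply: smallest_sub; last by move=> U; exact: sandwich_open.
  split; [|exact: sandwichC|exact: sandwich_bigcup].
  by apply: sandwich_open; exact: open0.
have [C [ O [cC oO CA AO OC]]] := sA e e0; exists O; split=> //.
have OE : O = A `|` (O `\` A) by rewrite setDUK.
have mO : measurable (O : set (borel X)) by exact: measurable_open.
have mOA : measurable (O `\` A : set (borel X)) by exact: (@measurableD _ (borel X)).
rewrite {1}OE measureU//; last by rewrite setDIK.
apply: leeD => //; apply/ltW; apply: le_lt_trans OC; apply: le_measure.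
- by rewrite inE.
- by rewrite inE; exact: mOC.
- by move=> x [Ox nA]; split=> // /CA.
Qed.

End outer_regularity.

Section layer_maximum.
Context {R : realType}.
Implicit Types (c y : R) (t : nat -> R).

Fixpoint layer_max c t n : R :=
  if n is m.+1 then Num.max (layer_max c t m) (t m) else c.

Lemma layer_max_ge c t n : c <= layer_max c t n.
Proof. by elim: n => //= n ih; rewrite le_max ih. Qed.

Lemma layer_max_ge_term c t n k : (k < n)%N -> t k <= layer_max c t n.
Proof.
elim: n => //= n ih; rewrite ltnS leq_eqVlt le_max => /predU1P[->|/ih ->//].
by rewrite lexx orbT.
Qed.

Lemma layer_max_le c t n y : c <= y -> (forall k, (k < n)%N -> t k <= y) ->
  layer_max c t n <= y.
Proof.
move=> cy; elim: n => //= n ih ty; rewrite ge_max ty// ih// => k kn.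
by apply: ty; exact: ltnW.
Qed.

End layer_maximum.

Section lipschitz_majorant.
Context {R : realType} {X : completeMetricType R}.
Variables (mu : {measure set (borel X) -> \bar R}) (p : R).
Hypothesis p1 : 1 <= p.
Variable Omega : set X.
Hypothesis oOmega : open Omega.
Hypothesis Omega_fin : (mu Omega < +oo)%E.
Variables (rho : X -> \bar R) (c : R).
Hypothesis nrho : nonneg_borel rho.
Hypothesis c0 : 0 < c.

Let p0 : 0 < p. Proof. exact: lt_le_trans p1. Qed.
Let level k : R := c * 2 ^+ k.
Let level_gt0 k : 0 < level k. Proof. by rewrite mulr_gt0// exprn_gt0. Qed.
Let levelS k : level k.+1 = 2 * level k.
Proof. by rewrite /level exprS mulrCA. Qed.
Let level_le k l : (k <= l)%N -> level k <= level l.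
Proof. by move=> kl; rewrite ler_wpM2l ?(ltW c0)// ler_weXn2l// ler1n. Qed.

Lemma level_between (s : R) : c <= s -> exists k, level k <= s < level k.+1.
Proof.
move=> cs.
have ex : exists k, s < level k.+1.
  exists (Num.truncn (s / c)); rewrite -ltr_pdivrMl// mulrC.
  apply: (lt_trans (truncnS_gt _)); rewrite -natrX ltr_nat.
  exact: ltn_expl.
have [k sk kmin] := ex_minnP ex; exists k; rewrite sk andbT.
case: k sk kmin => [|k] _ kmin; first by rewrite /level expr0 mulr1.
by rewrite leNgt; apply/negP => /kmin; rewrite ltnn.
Qed.

Let A k := [set x | ((level k)%:E < rho x)%E].

Let mA k : measurable (A k : set (borel X)).
Proof.
have [mr _] := nrho; rewrite -[A k]setTI; apply: emeasurable_fun_o_infty => //.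
Qed.

(* A dyadic layer-cake estimate: only the topmost layer below rho x matters. *)
Lemma layer_cake_le x :
  (\sum_(k <oo) ((level k.+1 `^ p)%:E * (\1_(A k) x)%:E) <=
   (2 * 2 `^ p)%:E * rho x `^ p)%E.
Proof.
have [_ r0] := nrho; have := r0 x.
case rx : (rho x) => [r| |] // r0x; last first.
  rewrite poweRyr ?gt_eqF// gt0_muley ?leey// lte_fin mulr_gt0// powR_gt0//.
(* As [p >= 1], consecutive terms grow at least by the factor 2, so a partial sum is at most twice
   its last nonzero term; the minimum with [2 * r] records where the terms stop. *)
have partial n : \sum_(0 <= k < n) (level k.+1 `^ p * \1_(A k) x) <=
    2 * (Num.min (level n) (2 * r)) `^ p.
  have rr0 : 0 <= r by rewrite -lee_fin.
  elim: n => [|n ih]; first by rewrite big_nil mulr_ge0// powR_ge0.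
  rewrite big_nat_recr//=.
  have mono (a b : R) : 0 <= a -> a <= b -> a `^ p <= b `^ p.
    move=> a0 ab; apply: ge0_ler_powR => //; rewrite ?nnegrE ?(ltW p0)//.
    exact: le_trans ab.
  rewrite indicE; case: (boolP (x \in A n)) => [xA|xA]; last first.
    rewrite mulr0 addr0 (le_trans ih)// ler_wpM2l//; apply: mono.
      by rewrite le_min (ltW (level_gt0 n)) mulr_ge0.
    by rewrite le_min !ge_min lexx orbT level_le.
  have nr : level n < r by move: xA; rewrite inE /A /= rx lte_fin.
  have -> : Num.min (level n.+1) (2 * r) = level n.+1.
    by rewrite min_l// levelS ler_wpM2l// ltW.
  rewrite mulr1 mulr_natl mulr2n lerD2r.
  apply: (le_trans ih); apply: (@le_trans _ _ (2 * level n `^ p)).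
    rewrite ler_wpM2l//; apply: mono; last by rewrite ge_min lexx.
    by rewrite le_min (ltW (level_gt0 n)) mulr_ge0.
  rewrite levelS powRM ?(ltW (level_gt0 n))//.
  by rewrite ler_wpM2r ?powR_ge0// le1r_powR// ler1n.
apply: lime_le.
  apply: is_cvg_nneseries => k _ _; rewrite mule_ge0// lee_fin// powR_ge0.
  by [].
apply: nearW => n.
under eq_bigr do rewrite -EFinM.
rewrite sumEFin poweR_EFin -EFinM lee_fin; apply: (le_trans (partial n)).
have rr0 : 0 <= r by rewrite -lee_fin.
rewrite -mulrA ler_wpM2l// -powRM//; apply: ge0_ler_powR => //.
- exact: ltW.
- by rewrite nnegrE le_min (ltW (level_gt0 n)) mulr_ge0.
- by rewrite nnegrE mulr_ge0.
- by rewrite ge_min lexx orbT.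
Qed.

(** The level set [A k] is enlarged to an open set [V k] of almost the same measure in [Omega], and
    [t n x k] increases with [n] to [level k.+1] times the indicator of [V k]. The floor [c] keeps
    the density away from 0, so that chains of bounded cost have bounded length. *)
Lemma lipschitz_majorant (e : R) : 0 < e ->
  exists (g : nat -> X -> R) (k b : nat -> R),
  let F x := ereal_sup (range (fun n => (g n x)%:E)) in
  [/\ forall n, lipschitz_fun (k n) (g n), forall n x, c <= g n x <= b n,
      forall n x, g n x <= g n.+1 x, (forall x, Omega x -> (rho x <= F x)%E) &
      nonneg_borel F /\
      (\int[mu]_(x in Omega) (F x `^ p) <=
        (c `^ p)%:E * mu Omega + (2 * 2 `^ p)%:E * Lp_integral mu p rho + e%:E)%E].
Proof.
move=> e0; have [mr r0] := nrho.
have mOmega : measurable (Omega : set (borel X)) by exact: measurable_open.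
(* Restriction to [Omega] makes the measure finite, as [outer_regular] requires. *)
pose nu := mrestr mu mOmega.
have nu_fin : (nu setT < +oo)%E by rewrite /nu /mrestr setTI.
have lp0 k : 0 < level k.+1 `^ p by rewrite powR_gt0.
have ek0 k : 0 < e / (2 ^ k.+1)%:R / level k.+1 `^ p.
  by rewrite !divr_gt0// ltr0n expn_gt0.
have /choice[V VP] : forall k, exists V : set X, [/\ open V, A k `<=` V &
    (nu V <= nu (A k) + (e / (2 ^ k.+1)%:R / level k.+1 `^ p)%:E)%E].
  by move=> k; apply: outer_regular.
pose t n x k := level k.+1 * Num.min 1 (n%:R * dist1 (~` V k) x).
pose g n x := layer_max c (t n x) n.
have t_lip n k : (k < n)%N -> lipschitz_fun (level n * n%:R) (fun x => t n x k).
  move=> kn; apply: (@lipschitz_funW _ _ (level k.+1 * (n%:R * 1))).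
    by rewrite mulr1 ler_wpM2r// level_le.
  apply: lipschitz_funZ; first exact: ltW.
  apply: lipschitz_fun_min.
    by apply: (@lipschitz_funW _ _ 0); [rewrite mulr1|exact: lipschitz_fun_cst].
  by apply: lipschitz_funZ => //; exact: dist1_lipschitz.
have g_lip n : lipschitz_fun (level n * n%:R) (g n).
  suff aux m : (m <= n)%N -> lipschitz_fun (level n * n%:R) (fun x => layer_max c (t n x) m).
    exact: aux.
  elim: m => [_|m ih mn] /=.
    apply: (@lipschitz_funW _ _ 0); last exact: lipschitz_fun_cst.
    by rewrite mulr_ge0// ltW.
  by apply: lipschitz_fun_max; [apply: ih; exact: ltnW|exact: t_lip].
have g_ge n x : c <= g n x by exact: layer_max_ge.
have t0 n x k : 0 <= t n x k.
  by rewrite mulr_ge0 ?(ltW (level_gt0 _))// le_min ler01 mulr_ge0// dist1_ge0.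
have t_nd n x k : t n x k <= t n.+1 x k.
  rewrite ler_wpM2l ?(ltW (level_gt0 _))// le_min !ge_min lexx/=.
  by rewrite ler_wpM2r ?orbT ?dist1_ge0// ler_nat.
have g_nd n x : g n x <= g n.+1 x.
  apply: layer_max_le => // k kn; apply: (le_trans (t_nd n x k)).
  by apply: layer_max_ge_term; exact: ltnW.
exists g, (fun n => level n * n%:R), level => F.
have F_ge n x : ((g n x)%:E <= F x)%E by apply: ereal_sup_ubound; exists n.
have F0 x : (0 <= F x)%E.
  by apply: le_trans (F_ge 0%N x); rewrite lee_fin (le_trans _ (g_ge 0%N x))// ltW.
have mg n : measurable_fun [set: borel X] (EFin \o g n).
  exact: lipschitz_borel (g_lip n).
have nF : nonneg_borel F.
  split=> //; have -> : F = (fun x => esups (fun n => (g n x)%:E) 0%N).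
    apply/funext => x; rewrite /F /esups /sdrop; congr ereal_sup.
    by apply/seteqP; split=> _ [n _ <-]; exists n.
  exact: (@measurable_fun_esups _ (borel X) R setT (fun n x => (g n x)%:E)).
have g_le n x : g n x <= level n.
  apply: layer_max_le => [|k kn]; first by rewrite ler_peMr ?(ltW c0)// exprn_ege1// ler1n.
  rewrite /t -[leRHS]mulr1; apply: ler_pM => //; first exact: ltW.
  - by rewrite le_min ler01 mulr_ge0// dist1_ge0.
  - exact: level_le.
  - by rewrite ge_min lexx.
split=> //; [by move=> n x; rewrite g_ge g_le| |split=> //].
  move=> x Ox; have F_layer k : ((level k)%:E < rho x)%E -> ((level k.+1)%:E <= F x)%E.
    move=> kx; have [oV AV _] := VP k.
    have Vx : V k x by exact: AV.
    have d0 : 0 < dist1 (~` V k) x by apply: dist1_gt0; [exact: open_closedC|].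
    pose n := maxn k.+1 (Num.truncn (dist1 (~` V k) x)^-1).+1.
    apply: le_trans (F_ge n x); rewrite lee_fin.
    apply: le_trans (layer_max_ge_term c (t n x) (_ : (k < n)%N)); last exact: leq_maxl.
    rewrite /t min_l ?mulr1// -ler_pdivrMr// mul1r.
    apply/ltW/(lt_le_trans (truncnS_gt _)); rewrite ler_nat; exact: leq_maxr.
  (* If [F x < rho x] and [F x] lies between [level k] and [level k.+1], then [x] is in [A k], and
     [F_layer] lifts [F x] to [level k.+1]. *)
  rewrite leNgt; apply/negP => Fr.
  have Fc : (c%:E <= F x)%E by apply: le_trans (F_ge 0%N x); rewrite lee_fin.
  move: Fr Fc F_layer; case: (F x) => [s| |] //; rewrite ?ltNge ?leey//.
  rewrite -ltNge lee_fin => sr cs Fl.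
  have [k /andP[ks sk]] := level_between cs.
  have := Fl k (le_lt_trans _ sr); rewrite !lee_fin => /(_ ks).
  by rewrite leNgt sk.
pose T x := ((c `^ p)%:E + \sum_(k <oo) ((level k.+1 `^ p)%:E * (\1_(V k) x)%:E))%E.
have term0 k x : (0 <= (level k.+1 `^ p)%:E * (\1_(V k) x)%:E)%E.
  by rewrite mule_ge0// lee_fin// ltW.
have T0 x : (0 <= T x)%E.
  by rewrite adde_ge0 ?lee_fin ?powR_ge0//; apply: nneseries_ge0.
have mono (a b : R) : 0 <= a -> a <= b -> a `^ p <= b `^ p.
  move=> a0 ab; apply: ge0_ler_powR => //; rewrite ?nnegrE ?(ltW p0)//.
  exact: le_trans ab.
have gT n x : (((g n x) `^ p)%:E <= T x)%E.
  suff aux m : ((layer_max c (t n x) m `^ p)%:E <= T x)%E by exact: aux.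
  elim: m => [|m ih] /=.
    by rewrite /T leeDl//; apply: nneseries_ge0.
  rewrite /Num.max; case: ltP => // _.
  have [xV|xV] := boolP (x \in V m); last first.
    have -> : t n x m = 0.
      rewrite /t dist1_eq0; first by rewrite mulr0 min_r// mulr0.
      by move: xV; rewrite notin_setE.
    by rewrite powR0 ?gt_eqF.
  have : ((t n x m `^ p)%:E <= (level m.+1 `^ p)%:E * (\1_(V m) x)%:E)%E.
    rewrite indicE xV mule1 lee_fin; apply: mono => //.
    by rewrite ler_piMr ?(ltW (level_gt0 _))// ge_min lexx.
  move=> /le_trans; apply; rewrite /T (@nneseriesD1 _ _ m)// addeCA leeDl//.
  by rewrite adde_ge0 ?lee_fin ?powR_ge0//; apply: nneseries_ge0.
have FT x : (F x `^ p <= T x)%E.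
  have : (F x <= T x `^ p^-1)%E.
    apply: ge_ereal_sup => _ [n _ <-].
    have gn0 : 0 <= g n x by rewrite (le_trans _ (g_ge n x))// ltW.
    rewrite -(poweRe1 (_ : 0 <= (g n x)%:E)%E)// -(mulfV (lt0r_neq0 p0)) poweRrM.
    apply: poweR_le; rewrite ?poweR_ge0//; first by rewrite invr_ge0 ltW.
    by rewrite poweR_EFin gT.
  move=> /(poweR_le (ltW p0) (F0 x)) /le_trans; apply.
  by rewrite -poweRrM mulVf ?gt_eqF// poweRe1.
have mterm (W : nat -> set X) k : measurable (W k : set (borel X)) ->
    measurable_fun (Omega : set (borel X)) (fun x => (level k.+1 `^ p)%:E * (\1_(W k) x)%:E)%E.
  move=> mW; apply: measurable_funeM; apply/measurable_EFinP.
  by apply: measurable_funTS; exact: measurable_indic.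
have mV k : measurable (V k : set (borel X)) by apply: measurable_open; have [] := VP k.
have mF : measurable_fun (Omega : set (borel X)) (fun x => F x `^ p)%E.
  by apply: measurable_funTS; apply: measurable_poweR_comp; have [] := nF.
have int_series (W : nat -> set X) : (forall k, measurable (W k : set (borel X))) ->
    (\int[mu]_(x in Omega) (\sum_(k <oo) ((level k.+1 `^ p)%:E * (\1_(W k) x)%:E)) =
     \sum_(k <oo) ((level k.+1 `^ p)%:E * nu (W k)))%E.
  move=> mW; rewrite integral_nneseries//; last 2 first.
  - by move=> k; exact: mterm.
  - by move=> k x _; rewrite mule_ge0// lee_fin// ltW.
  apply: eq_eseriesr => k _; rewrite ge0_integralZl_EFin//; last 2 first.
  - by apply/measurable_EFinP; apply: measurable_funTS; exact: measurable_indic.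
  - by rewrite ltW.
  by rewrite integral_indic.
apply: (@le_trans _ _ (\int[mu]_(x in Omega) T x)%E).
  apply: ge0_le_integral => //.
  - by move=> x _; exact: poweR_ge0.
  - apply: emeasurable_funD; first exact: measurable_cst.
    by apply: ge0_emeasurable_sum => // k _; exact: mterm.
rewrite /T ge0_integralD//; last 3 first.
- by move=> x _; rewrite lee_fin powR_ge0.
- by move=> x _; apply: nneseries_ge0.
- by apply: ge0_emeasurable_sum => // k _; exact: mterm.
rewrite integral_cst// -addeA leeD2l// int_series//.
apply: (@le_trans _ _ (\sum_(k <oo) ((level k.+1 `^ p)%:E * nu (A k) +
   (e / (2 ^ k.+1)%:R)%:E))%E).
  apply: lee_nneseries => [k _ _|k _].
    by rewrite mule_ge0 ?measure_ge0// lee_fin ltW.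
  have [_ _ nuV] := VP k.
  apply: (le_trans (lee_wpmul2l (_ : 0 <= (level k.+1 `^ p)%:E)%E nuV)).
    by rewrite lee_fin ltW.
  rewrite ge0_muleDr ?measure_ge0//; last by rewrite lee_fin ltW.
  by rewrite leeD2l// -EFinM mulrCA mulfV ?mulr1// gt_eqF.
apply: (le_trans (epsilon_trick _ _ _)).
- by move=> k; rewrite mule_ge0 ?measure_ge0// lee_fin ltW.
- exact: ltW.
rewrite leeD2r// -int_series// Lp_integralE//.
have rp0 x : (0 <= rho x `^ p)%E by exact: poweR_ge0.
rewrite -ge0_integralZl_EFin//; last exact: measurable_poweR_comp.
have mK : measurable_fun [set: borel X] (fun x => (2 * 2 `^ p)%:E * rho x `^ p)%E.
  by apply: measurable_funeM; exact: measurable_poweR_comp.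
have K0 x : (0 <= (2 * 2 `^ p)%:E * rho x `^ p)%E.
  by rewrite mule_ge0// lee_fin mulr_ge0// powR_ge0.
apply: (@le_trans _ _ (\int[mu]_(x in Omega) ((2 * 2 `^ p)%:E * rho x `^ p))%E); last first.
  by apply: ge0_subset_integral.
apply: ge0_le_integral => //.
- by move=> x _; apply: nneseries_ge0 => k _ _; rewrite mule_ge0// lee_fin// ltW.
- apply: ge0_emeasurable_sum => [k x _ _|k _]; last exact: mterm.
  by rewrite mule_ge0// lee_fin// ltW.
- exact: measurable_funTS.
- by move=> x _; exact: layer_cake_le.
Qed.

End lipschitz_majorant.

(** * Capacitary test functions *)

Section capacitary_test_function.
Context {R : realType} {X : completeMetricType R}.
Implicit Types (x y z : X).

Lemma continuous_borel (v : X -> R) : continuous v ->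
  measurable_fun [set: borel X] (EFin \o v).
Proof.
move=> cv; apply/measurable_EFinP; apply: (measurability _ (RGenOpens.measurableE R)).
move=> _ [_ [a [b ->] <-]]; rewrite setTI; apply: measurable_open.
by move/continuousP : cv; apply; exact: interval_open.
Qed.

Section chain_distance.
Variables (phi : X -> R) (c b : R) (Z : set X) (e : R).
Hypothesis c0 : 0 < c.
Hypothesis phi_bounds : forall x, c <= phi x <= b.
Hypothesis e0 : 0 < e.

Let phi_ge x : c <= phi x. Proof. by case/andP: (phi_bounds x). Qed.
Let phi_le x : phi x <= b. Proof. by case/andP: (phi_bounds x). Qed.

Let costs x : set R := [set 1] `|`
  [set r | exists s, [/\ fine_chain phi e x s, Z (last x s) & r = chain_cost phi x s]].

(* The least cost of a fine chain from x to Z, truncated at 1. *)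
Definition chain_dist x : R := inf (costs x).

Let costs_lb x : lbound (costs x) 0.
Proof. by move=> _ [-> //|[s [_ _ ->]]]; exact: chain_cost_ge0 c0 phi_ge _ _. Qed.

Let costs_inf x : has_inf (costs x).
Proof. by split; [exists 1; left|exists 0; exact: costs_lb]. Qed.

Lemma chain_dist_ge0 x : 0 <= chain_dist x.
Proof. by apply: lb_le_inf; [exists 1; left|exact: costs_lb]. Qed.

Lemma chain_dist_le1 x : chain_dist x <= 1.
Proof. by apply: ge_inf; [exact: (costs_inf x).2|left]. Qed.

Lemma chain_dist_le_cost x s : fine_chain phi e x s -> Z (last x s) ->
  chain_dist x <= chain_cost phi x s.
Proof. by move=> fs Zs; apply: ge_inf; [exact: (costs_inf x).2|right; exists s]. Qed.

Lemma chain_dist_ge x r : r <= 1 ->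
  (forall s, fine_chain phi e x s -> Z (last x s) -> r <= chain_cost phi x s) ->
  r <= chain_dist x.
Proof.
move=> r1 H; apply: lb_le_inf; first by exists 1; left.
by move=> _ [-> //|[s [fs Zs ->]]]; exact: H.
Qed.

Lemma chain_dist_eq0 x : Z x -> chain_dist x = 0.
Proof.
move=> Zx; apply/eqP; rewrite eq_le chain_dist_ge0 andbT.
exact: (@chain_dist_le_cost x [::]).
Qed.

Lemma chain_dist_lt x r : chain_dist x < r -> r <= 1 ->
  exists s, [/\ fine_chain phi e x s, Z (last x s) & chain_cost phi x s < r].
Proof.
move=> xr r1; apply: contrapT => /forallNP H.
move: xr; rewrite ltNge => /negP; apply; apply: chain_dist_ge => // s fs Zs.
by rewrite leNgt; apply/negP => sr; apply: (H s).
Qed.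

Lemma chain_dist_step x y : step_cost phi x y <= e ->
  `|chain_dist x - chain_dist y| <= step_cost phi x y.
Proof.
have half u v : step_cost phi u v <= e -> chain_dist u <= chain_dist v + step_cost phi u v.
  move=> uve; rewrite -lerBlDr; apply: chain_dist_ge => [|s fs Zs].
    by rewrite lerBlDr (le_trans (chain_dist_le1 u))// lerDl (step_cost_ge0 c0 phi_ge).
  rewrite lerBlDr addrC; have := @chain_dist_le_cost u (v :: s); apply => //.
  by rewrite /fine_chain /= uve.
have sym : step_cost phi y x = step_cost phi x y.
  by rewrite /step_cost metric_sym maxC.
move=> xye; have := half x y xye; have := half y x; rewrite sym => /(_ xye).
by rewrite ler_norml => ? ?; apply/andP; split; lra.
Qed.

Let b0 : 0 < b.
Proof. by rewrite (lt_le_trans c0)// (le_trans (phi_ge point)). Qed.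

Lemma chain_dist_slope x y : mdist x y <= e / b ->
  `|chain_dist x - chain_dist y| <= mdist x y * Num.max (phi x) (phi y).
Proof.
move=> xye; apply: chain_dist_step.
apply: (@le_trans _ _ (mdist x y * b)).
  by rewrite ler_wpM2l ?mdist_ge0// ge_max !phi_le.
by rewrite -ler_pdivlMr.
Qed.

Lemma chain_dist_continuous : continuous chain_dist.
Proof.
move=> x; apply/cvgrPdist_le => d d0.
have m0 : 0 < Num.min (e / b) (d / b) by rewrite lt_min !divr_gt0.
apply: filterS (nbhsx_ballx x _ m0) => y.
rewrite mballE lt_min => /andP[/ltW h1 /ltW h2].
apply: (le_trans (chain_dist_slope h1)).
apply: (@le_trans _ _ (mdist x y * b)).
  by rewrite ler_wpM2l ?mdist_ge0// ge_max !phi_le.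
by rewrite -ler_pdivlMr.
Qed.

(* h is a potential: it varies along each step by at most the cost of the step. *)
Lemma chain_cost_potential (h : X -> R) x s :
  (forall y z, `|h y - h z| <= step_cost phi y z) ->
  h (last x s) - h x <= chain_cost phi x s.
Proof.
move=> hs; elim: s x => [|y s ih] x /=; first by rewrite subrr.
have := ih y; have := hs y x; have -> : step_cost phi y x = step_cost phi x y.
  by rewrite /step_cost metric_sym maxC.
by rewrite ler_norml => /andP[_ ?] ?; lra.
Qed.

End chain_distance.

Lemma chain_cost_cat (phi : X -> R) x s t :
  chain_cost phi x (s ++ t) = chain_cost phi x s + chain_cost phi (last x s) t.
Proof. by elim: s x => [|y s ih] x /=; rewrite ?add0r// ih addrA. Qed.

Section at_a_point.
Hypothesis proper : forall A : set X, closed A -> mbounded A -> compact A.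
Variables (mu : {measure set (borel X) -> \bar R}) (p : R).
Hypothesis p1 : 1 <= p.
Variable Omega : set X.
Hypothesis oOmega : open Omega.
Hypothesis bOmega : mbounded Omega.
Hypothesis Omega_fin : (mu Omega < +oo)%E.
Variables (rho : X -> \bar R) (c : R) (g : nat -> X -> R) (k b : nat -> R).
Let F x := ereal_sup (range (fun n => (g n x)%:E)).
Hypothesis nrho : nonneg_borel rho.
Hypothesis c0 : 0 < c.
Hypothesis g_lip : forall n, lipschitz_fun (k n) (g n).
Hypothesis g_bounds : forall n x, c <= g n x <= b n.
Hypothesis g_nd : forall n x, g n x <= g n.+1 x.
Hypothesis rhoF : forall x, Omega x -> (rho x <= F x)%E.
Variables (Z : set X) (x : X) (d : R).
Hypothesis closedZ : closed Z.
Hypothesis d0 : 0 < d.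
Hypothesis Zx : ~ Z x.
Let delta := dist1 (~` Omega).
Hypothesis Zd : forall z, Z z -> 2 * d <= delta z.
Hypothesis xd : 2 * d <= delta x.
Hypothesis rho_adm : forall h : curve, joining_curves [set x] Z Omega h ->
  (1 <= line_integral h rho)%E.

Let p0 : 0 < p. Proof. exact: lt_le_trans p1. Qed.
Let d2d : d <= 2 * d. Proof. by rewrite mulr_natl mulr2n lerDl ltW. Qed.
Variable M : R.
Hypothesis M0 : 0 < M.
Hypothesis Md : M * d = 2.

(* A penalty that makes leaving {delta > d} cost at least 1. *)
Let pen y := M * Num.max 0 (Num.min 1 (2 + (- d^-1) * delta y)).
Let phi n y := Num.max (g n y) (pen y).

Let delta_lip : lipschitz_fun 1 delta := dist1_lipschitz _.

Let pen_lip : lipschitz_fun (M * d^-1) pen.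
Proof.
have di : 0 <= d^-1 by rewrite invr_ge0 ltW.
apply: lipschitz_funZ; first exact: ltW.
apply: lipschitz_fun_max.
  by apply: (@lipschitz_funW _ _ 0) => //; exact: lipschitz_fun_cst.
apply: lipschitz_fun_min.
  by apply: (@lipschitz_funW _ _ 0) => //; exact: lipschitz_fun_cst.
split=> // y z; rewrite (_ : _ - _ = d^-1 * (delta z - delta y)); last by ring.
rewrite normrM ger0_norm// ler_wpM2l//.
by have [_ /(_ z y)] := delta_lip; rewrite mul1r metric_sym.
Qed.

Let pen_le y : pen y <= M.
Proof.
rewrite /pen -[leRHS]mulr1 ler_wpM2l ?(ltW M0)//.
by rewrite ge_max ler01 ge_min lexx.
Qed.

Let pen_near y : delta y <= d -> pen y = M.
Proof.
move=> yd; rewrite /pen min_l ?max_r ?mulr1//.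
have : d^-1 * delta y <= 1 by rewrite mulrC ler_pdivrMr// mul1r.
by lra.
Qed.

Let pen_far y : 2 * d <= delta y -> pen y = 0.
Proof.
move=> yd; rewrite /pen max_l ?mulr0// ge_min; apply/orP; right.
have : 2 <= d^-1 * delta y by rewrite mulrC ler_pdivlMr.
by lra.
Qed.

Let kk n := Num.max (k n) (M * d^-1).
Let phi_lip n : lipschitz_fun (kk n) (phi n).
Proof.
apply: lipschitz_fun_max.
  by apply: lipschitz_funW (g_lip n); rewrite le_max lexx.
by apply: lipschitz_funW pen_lip; rewrite le_max lexx orbT.
Qed.

Let bb n := Num.max (b n) M.
Let phi_bounds n y : c <= phi n y <= bb n.
Proof.
have /andP[g1 g2] := g_bounds n y.
by rewrite /phi /bb le_max g1 ge_max !le_max g2 pen_le orbT.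
Qed.
Let phi_ge n y : c <= phi n y. Proof. by case/andP: (phi_bounds n y). Qed.

Let phi_nd n y : phi n y <= phi n.+1 y.
Proof. by rewrite /phi ge_max !le_max g_nd lexx orbT. Qed.

(** A potential for the penalized cost: it varies only where [delta < d], and there the penalty
    equals its slope [M]. It is at most [M * d / 2 = 1] where [delta <= d / 2] and equals
    [M * d = 2] on [Z], so every chain between these sets costs at least 1. *)
Let barrier y := M * Num.min (delta y) d.

Let barrier_step n y z : `|barrier y - barrier z| <= step_cost (phi n) y z.
Proof.
wlog yz : y z / delta y <= delta z.
  move=> H; have [/H//|/ltW/H] := leP (delta y) (delta z).
  by rewrite distrC /step_cost metric_sym maxC.
have s0 : 0 <= step_cost (phi n) y z by exact: step_cost_ge0 c0 (phi_ge n) _ _.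
have [dy|yd] := leP d (delta y).
  by rewrite /barrier !min_r// ?subrr ?normr0// (le_trans dy).
have My : M <= phi n y by rewrite /phi le_max pen_near ?lexx ?orbT// ltW.
apply: (@le_trans _ _ (mdist y z * M)); last first.
  by rewrite ler_wpM2l ?mdist_ge0// le_max My.
rewrite /barrier -mulrBr normrM ger0_norm ?(ltW M0)// mulrC ler_wpM2r ?(ltW M0)//.
have [_ /(_ y z)] := delta_lip; rewrite mul1r !ler_norml => /andP[h1 h2].
by rewrite /Num.min; case: ltP => ?; case: ltP => ?; apply/andP; split; lra.
Qed.

Let cost_from_boundary n y s : delta y <= d / 2 -> Z (last y s) ->
  1 <= chain_cost (phi n) y s.
Proof.
move=> yd Zl; apply: le_trans (chain_cost_potential _ _ (barrier_step n)).
rewrite /barrier (min_r (_ : d <= delta (last y s))); last first.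
  exact: le_trans d2d (Zd Zl).
have dd : d / 2 <= d by have := d0; lra.
rewrite min_l; last exact: (le_trans yd dd).
have : M * delta y <= M * (d / 2) by rewrite ler_wpM2l// ltW.
by rewrite Md mulrA Md; move: (M * delta y) => q; lra.
Qed.

Let V n := chain_dist (phi n) Z n.+1%:R^-1.
Let e0 n : 0 < n.+1%:R^-1 :> R. Proof. by rewrite invr_gt0. Qed.

Let V_boundary n y : delta y <= d / 2 -> V n y = 1.
Proof.
move=> yd; apply/eqP; rewrite eq_le (chain_dist_le1 _ _ c0 (phi_bounds n)).
by apply: chain_dist_ge => // s _ Zl; exact: cost_from_boundary.
Qed.

Let V_large : exists n, 1 / 2 <= V n x.
Proof.
apply: contrapT => /forallNP H.
have xlt n : V n x < 1 / 2 by rewrite ltNge; apply/negP => /H.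
pose W := [set y | d / 2 <= delta y].
have cW : closed W.
  have : continuous delta := lipschitz_fun_continuous delta_lip.
  by move=> /continuous_closedP/(_ _ (@closed_ge R (d / 2))).
have WO : W `<=` Omega.
  move=> y Wy; apply: contrapT => nOy; move: Wy; rewrite /W /= /delta dist1_eq0//.
  by rewrite leNgt divr_gt0.
have cptW : compact W.
  by apply: proper => //; have [z [r Or]] := bOmega; exists z, r; exact: subset_trans Or.
have Wx : W x by rewrite /W /=; apply: le_trans xd; have := d0; lra.
have [h [h0 hZ hW hphi]] : exists h : curve, [/\ h 0 = x, Z (h (len h)), curve_in h W &
    forall m, (line_integral h (EFin \o phi m) <= (1 / 2 : R)%:E)%E].
  apply: (curve_of_chains c0 phi_ge phi_lip phi_nd cptW closedZ Wx) => //.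
  move=> n; have [|s [fs Zs cs]] := chain_dist_lt (xlt n); first lra.
  exists s; split=> //; last exact: ltW.
  (* A chain leaving [W] at [z] would still have to pay at least 1 from [z] to [Z], but its total
     cost is below 1/2. *)
  move=> z zs; rewrite /W /= leNgt; apply/negP => zd.
  have [s1 [s2 sE]] : exists s1 s2, s = rcons s1 z ++ s2.
    by case/splitPr: zs => s1 s2; exists s1, s2; rewrite cat_rcons.
  move: Zs cs; rewrite sE last_cat last_rcons chain_cost_cat last_rcons => Zs cs.
  have := cost_from_boundary n (ltW zd) Zs.
  by have := chain_cost_ge0 c0 (phi_ge n) x (rcons s1 z); lra.
have hO : curve_in h Omega by move=> t /hW /WO.
have hj : joining_curves [set x] Z Omega h.
  split=> //; exists 0, (len h); rewrite !lexx (len_ge0 h); split=> // hE.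
  by apply: Zx; rewrite -h0 hE.
have := rho_adm hj; apply/negP; rewrite -ltNge.
apply: (@le_lt_trans _ _ (1 / 2 : R)%:E); last by rewrite lte_fin; lra.
have [mr r0] := nrho.
pose G y := limn (fun n => (phi n y)%:E).
have ndphi y : nondecreasing_seq (fun n => (phi n y)%:E).
  by apply/nondecreasing_seqP => n; rewrite lee_fin.
have mphi n : measurable_fun [set: borel X] (EFin \o phi n).
  exact: lipschitz_borel (phi_lip n).
have GE y : G y = ereal_sup (range (fun n => (phi n y)%:E)).
  by apply: cvg_lim => //; exact: ereal_nondecreasing_cvgn.
have rhoG y : Omega y -> (rho y <= G y)%E.
  move=> /rhoF /le_trans; apply; rewrite GE; apply: ge_ereal_sup => _ [n _ <-].
  apply: (@le_trans _ _ (phi n y)%:E); first by rewrite lee_fin le_max lexx.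
  by apply: ereal_sup_ubound; exists n.
have mG : measurable_fun [set: borel X] G.
  apply: (@emeasurable_fun_cvg _ (borel X) R setT (fun n y => (phi n y)%:E)) => //.
  by move=> y _; rewrite GE; exact: ereal_nondecreasing_cvgn.
have phi0 n y : (0 <= (phi n y)%:E)%E by rewrite lee_fin (le_trans (ltW c0)).
apply: (@le_trans _ _ (line_integral h G)).
  apply: ge0_le_integral => //.
  - exact: measurable_along.
  - exact: measurable_along.
  - by move=> t /=; rewrite in_itv /= => /hO /rhoG.
rewrite /line_integral /G monotone_convergence//; last first.
  by move=> n; apply: (measurable_along (f := EFin \o phi n)).
apply: lime_le.
  apply: ereal_nondecreasing_is_cvgn => m n mn; apply: ge0_le_integral => //.
  - by apply: (measurable_along (f := EFin \o phi m)).
  - by apply: (measurable_along (f := EFin \o phi n)).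
  - by move=> t _; exact: ndphi.
by apply: nearW => n; exact: hphi.
Qed.

Lemma capacitary_test_function : exists (v : X -> R) (f : X -> \bar R),
  [/\ continuous v, forall y, 0 <= v y <= 1, forall y, Z y -> v y = 1,
      v x <= 1 / 2 & (forall y, ~ Omega y -> v y = 0) /\
      [/\ upper_gradient (EFin \o v) f, (Lp_integral mu p f < +oo)%E &
      forall y, 2 * d <= delta y -> (f y <= F y)%E]].
Proof.
have [n nP] := V_large.
have bb0 : 0 < bb n by rewrite lt_max M0 orbT.
(* [N * delta] dominates [phi n] as soon as [delta >= d / 4]. Cutting the density off below that
   level gives it finite energy, and does no harm because [v] vanishes where [delta <= d / 2]. *)
pose N := 4 * bb n / d.
have N0 : 0 < N by rewrite divr_gt0// mulr_gt0.
pose psi y := Num.min (phi n y) (N * delta y).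
have psi_lip : lipschitz_fun (Num.max (kk n) (N * 1)) psi.
  apply: lipschitz_fun_min; first by apply: lipschitz_funW (phi_lip n); rewrite le_max lexx.
  apply: (@lipschitz_funW _ _ (N * 1)); first by rewrite le_max lexx orbT.
  by apply: lipschitz_funZ => //; exact: ltW.
have delta0 y : 0 <= delta y by exact: dist1_ge0.
have phi0 y : 0 <= phi n y by rewrite (le_trans (ltW c0)).
have psi0 y : 0 <= psi y by rewrite le_min phi0 mulr_ge0// ltW.
have psi_out y : ~ Omega y -> psi y = 0.
  by move=> nOy; rewrite /psi /delta dist1_eq0// mulr0 min_r.
have psi_in y : d / 4 <= delta y -> psi y = phi n y.
  move=> yd; rewrite /psi min_l//.
  have /andP[_ /le_trans] := phi_bounds n y; apply.
  have -> : bb n = N * (d / 4) by rewrite /N; field; rewrite gt_eqF.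
  by rewrite ler_wpM2l// ltW.
have cV : continuous (V n) := chain_dist_continuous c0 (phi_bounds n) (e0 n).
have V01 y : 0 <= V n y <= 1.
  by rewrite (chain_dist_ge0 _ _ c0 (phi_bounds n)) (chain_dist_le1 _ _ c0 (phi_bounds n)).
pose v y := 1 - V n y.
exists v, (EFin \o psi); split.
- by move=> y; apply: cvgB; [exact: cvg_cst|exact: cV].
- by move=> y; have /andP[? ?] := V01 y; rewrite /v; apply/andP; split; lra.
- by move=> y Zy; rewrite /v /V (chain_dist_eq0 _ c0 (phi_bounds n))// subr0.
- by rewrite /v; lra.
split.
  move=> y nOy; rewrite /v V_boundary ?subrr// /delta dist1_eq0//.
  by rewrite divr_ge0// ltW.
have mpsi := lipschitz_borel psi_lip.
split.
- split; first by split=> // y; rewrite lee_fin.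
  move=> h nh; split=> // _.
  (* The bound [d / 4] ensures that a step with one end in [delta > d / 2] has both ends where [psi]
     equals [phi n]. *)
  pose e := Num.min (n.+1%:R^-1 / bb n) (d / 4).
  have ep : 0 < e by rewrite lt_min !divr_gt0.
  apply: (local_slope_upper_gradient ep psi_lip psi0).
  move=> y z; rewrite le_min => /andP[yz1 yz2].
  have -> : v y - v z = V n z - V n y by rewrite /v; ring.
  rewrite distrC; have slope := chain_dist_slope Z c0 (phi_bounds n) yz1.
  have [_ /(_ y z)] := delta_lip; rewrite mul1r ler_norml => /andP[h1 h2].
  have [yd|dy] := leP (delta y) (d / 2).
    have [zd|dz] := leP (delta z) (d / 2).
      by rewrite !V_boundary// subrr normr0 mulr_ge0 ?mdist_ge0// le_max psi0.
    by rewrite !psi_in//; lra.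
  by rewrite !psi_in//; lra.
- rewrite Lp_integralE; last by move=> y; rewrite lee_fin.
  apply: (@le_lt_trans _ _ (\int[mu]_(y in Omega) (bb n `^ p)%:E)%E); last first.
    rewrite integral_cst/=; last exact: measurable_open.
    by rewrite lte_mul_pinfty// lee_fin powR_ge0.
  rewrite [leRHS]integral_mkcond; apply: ge0_le_integral => //.
  + by move=> y _; exact: poweR_ge0.
  + exact: measurable_poweR_comp.
  + apply/(measurable_restrictT _ _).1; first exact: measurable_open.
    exact: measurable_cst.
  move=> y _; rewrite patchE; case: ifPn => [_|].
    rewrite /= lee_fin; apply: ge0_ler_powR; rewrite ?nnegrE ?(ltW p0) ?(ltW bb0)//.
    have /andP[_ /le_trans] := phi_bounds n y => le; rewrite /psi ge_min.
    by rewrite le.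
  by rewrite notin_setE => /psi_out /= ->; rewrite powR0 ?gt_eqF.
move=> y yd; apply: (@le_trans _ _ (g n y)%:E); last first.
  by apply: ereal_sup_ubound; exists n.
rewrite lee_fin /psi ge_min /phi pen_far// max_l ?lexx//.
by have /andP[/(le_trans (ltW c0))] := g_bounds n y.
Qed.

End at_a_point.
End capacitary_test_function.

(** * Energy along John curves *)

Section geometric_telescoping.
Context {R : realType}.

Lemma exprn_small (q e : R) : 0 <= q -> q < 1 -> 0 < e -> exists n, q ^+ n < e.
Proof.
move=> q0 q1 e0; have := @cvg_expr R q; rewrite ger0_norm// => /(_ q1).
move=> /cvgrPdist_lt/(_ e e0)[n _ /(_ n (leqnn n))] /=.
by rewrite sub0r normrN ger0_norm ?exprn_ge0//; exists n.
Qed.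

Lemma geometric_telescoping (m : nat -> R) (w : R) (s : R) : 0 <= w -> w < 1 -> 0 <= s ->
  (forall i, `|m i.+1 - m i| <= s * (1 - w) * w ^+ i) ->
  forall n, `|m n - m 0%N| <= s.
Proof.
move=> w0 w1 s0 H n; suff : `|m n - m 0%N| <= s * (1 - w ^+ n).
  move=> /le_trans; apply; rewrite -[leRHS]mulr1 ler_wpM2l//.
  by rewrite gerBl exprn_ge0.
elim: n => [|n ih]; first by rewrite subrr normr0 expr0 subrr mulr0.
have -> : m n.+1 - m 0%N = (m n.+1 - m n) + (m n - m 0%N) by ring.
apply: (le_trans (ler_normD _ _)); have := H n; rewrite exprS => h.
have -> : s * (1 - w * w ^+ n) = s * (1 - w) * w ^+ n + s * (1 - w ^+ n) by ring.
exact: lerD.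
Qed.

End geometric_telescoping.

Section energy_along_curve.
Context {R : realType} {X : completeMetricType R}.
Variables (mu : {measure set (borel X) -> \bar R}) (p Q : R).
Hypothesis p1 : 1 <= p.
Hypothesis mu_balls : balls_pos_finite mu.
Hypothesis mu_doubling : doubling mu.
Hypothesis mu_Q : lower_mass_exponent mu Q.
Hypothesis p_gtQ : Q - 1 < p.
Variables (CP lambda : R).
Hypothesis CP0 : 0 < CP.
Hypothesis lambda1 : 1 <= lambda.
Hypothesis PI : oscillation_energy_bound mu p CP lambda.

Let p0 : 0 < p. Proof. exact: lt_le_trans p1. Qed.

Lemma ball_mean_cst (v : X -> R) (x : X) (r : R) (a : R) : 0 < r ->
  (forall y, ball x r y -> v y = a) -> ball_mean mu v x r = a.
Proof.
move=> r0 va; rewrite /ball_mean.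
have -> : \int[mu]_(y in ball x r) v y = \int[mu]_(y in ball x r) a.
  by apply: eq_Rintegral => y; rewrite inE => /va.
rewrite Rintegral_cst; last exact: measurable_mball.
by rewrite mulrCA mulVf ?mulr1// gt_eqF// fine_mu_ball_gt0.
Qed.

Lemma ball_mean_near (v : X -> R) (x : X) (r a e : R) : 0 < r ->
  measurable_fun [set: borel X] (EFin \o v) -> (forall y, 0 <= v y <= 1) ->
  (forall y, ball x r y -> `|v y - a| <= e) -> `|ball_mean mu v x r - a| <= e.
Proof.
move=> r0 mv v01 va; apply: (le_trans (ball_mean_sub_le mu_balls mv v01 a x r0)).
have m0 := fine_mu_ball_gt0 mu_balls x r0.
rewrite mulrC ler_pdivrMr// -(Rintegral_cst mu (measurable_mball x r)).
apply: le_Rintegral => //; first exact: measurable_mball.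
- by have := integrable_abse (integrable_ball_dist mu_balls mv v01 a x r0).
- apply: (@measurable_bounded_integrable _ (borel X)).
  + exact: measurable_mball.
  + by have /andP[] := mu_balls x r0.
  + exact: measurable_cst.
  + exists `|e|; split; first by rewrite num_real.
    by move=> M eM y _ /=; exact: ltW.
Qed.

Lemma fine_mu_ball_le (x y : X) (r s : R) : 0 < r -> 0 < s -> ball x r `<=` ball y s ->
  fine (mu (ball x r)) <= fine (mu (ball y s)).
Proof.
move=> r0 s0 sub; apply: fine_le; try exact: mu_ball_fin.
by apply: le_measure; rewrite ?inE//; exact: measurable_mball.
Qed.

(* If every consecutive difference of the means over the balls B_i = B(y_i, a t_i)
   were at most a small multiple of (1 - a)^(beta i), v could not drop from 1 to 1/2.
   The exponent beta = (1 + p - Q) / p turns the energy of the exceptional ball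
   into a multiple of its radius. *)
Lemma energy_along_curve (a L0 R0 : R) (z0 : X) : 0 < a -> a <= 4^-1 ->
  0 < L0 -> L0 <= R0 ->
  exists2 c : R, 0 < c &
  forall (v : X -> R) (f : X -> \bar R) (g : R -> X) (l : R),
    continuous v -> (forall y, 0 <= v y <= 1) ->
    (forall y, ~ ball z0 R0 y -> v y = 0) ->
    upper_gradient (EFin \o v) f -> (Lp_integral mu p f < +oo)%E ->
    0 < l -> l <= L0 ->
    (forall s t, 0 <= s <= l -> 0 <= t <= l -> mdist (g s) (g t) <= `|s - t|) ->
    (forall t, 0 <= t <= l -> ball z0 R0 (g t)) ->
    v (g 0) <= 1 / 2 -> (forall y, ball (g l) (a * l) y -> v y = 1) ->
    exists t, [/\ 0 < t, t <= l &
      ((c * (a * t))%:E <=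
        \int[mu]_(y in ball (g t) (2 * lambda * (a * t))) (f y `^ p))%E].
Proof.
move=> a0 a4 L00 LR.
have [Cd Cd0 dbl] := mu_doubling.
have [CQ CQ0 massQ] := mu_Q.
have R00 : 0 < R0 by exact: lt_le_trans LR.
have dblf x r : 0 < r -> fine (mu (ball x (2 * r))) <= Cd * fine (mu (ball x r)).
  move=> r0; have r20 : 0 < 2 * r by rewrite mulr_gt0.
  by rewrite -lee_fin EFinM !fineK ?mu_ball_fin// dbl.
(* One doubling compares the ball of radius [2 * r i] with the one of radius [r i] at the same
   center; two doublings compare it with the next ball. *)
pose D := Cd + Cd ^+ 2.
have D0 : 0 < D by rewrite addr_gt0 ?exprn_gt0.
pose q := 1 - a.
have q0 : 0 < q by rewrite /q; lra.
have q1 : q < 1 by rewrite /q; lra.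
pose beta := (1 + p - Q) / p.
have beta0 : 0 < beta by rewrite divr_gt0//; have := p_gtQ; lra.
pose w := q `^ beta.
have w0 : 0 < w by rewrite powR_gt0.
have w1 : w < 1.
  have := @gt0_ltr_powR R beta beta0 q 1; rewrite powR1; apply => //.
  - by rewrite nnegrE ltW.
  - by rewrite nnegrE.
have wE i : w ^+ i = (q ^+ i) `^ beta.
  by rewrite -(powR_mulrn i (ltW w0)) -(powR_mulrn i (ltW q0)) /w powRAC.
(* With 32 the threshold in [osc] becomes [(1 - w) / 16 * w ^+ i], half of what is available. *)
pose K1 := (1 - w) / (32 * CP * D).
have K10 : 0 < K1 by rewrite divr_gt0 ?subr_gt0// !mulr_gt0.
pose K2 := K1 / (a * L0) `^ beta.
have aL0 : 0 < a * L0 by rewrite mulr_gt0.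
have K20 : 0 < K2 by rewrite divr_gt0// powR_gt0.
have mu0 := fine_mu_ball_gt0 mu_balls z0 R00.
pose K3 := CQ^-1 * R0^-1 `^ Q * fine (mu (ball z0 R0)).
have K30 : 0 < K3 by rewrite !mulr_gt0 ?invr_gt0// powR_gt0// invr_gt0.
exists (K2 `^ p * K3); first by rewrite mulr_gt0// powR_gt0.
move=> v f g l cv v01 vsupp uf ffin l0 lL gl gB v_start v_end.
(* As [q = 1 - a], consecutive parameters differ by exactly [a * t i], the radius of the i-th
   ball. *)
pose t i := l * q ^+ i.
have qi0 i : 0 < q ^+ i by rewrite exprn_gt0.
have qi1 i : q ^+ i <= 1 by rewrite exprn_ile1 ?ltW.
have t0 i : 0 < t i by rewrite mulr_gt0.
have tl i : t i <= l by rewrite /t ler_piMr// ltW.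
have tI i : 0 <= t i <= l by rewrite tl ltW.
pose r i := a * t i.
have r0 i : 0 < r i by rewrite mulr_gt0.
have tS i : t i.+1 = q * t i by rewrite /t exprS mulrCA.
pose y i := g (t i).
have yS i : mdist (y i) (y i.+1) <= r i.
  apply: (le_trans (gl _ _ (tI i) (tI i.+1))).
  rewrite ger0_norm tS /r /q; last by rewrite -[X in X - _]mul1r -mulrBl subKr mulr_ge0// ltW.
  by rewrite mulrBl mul1r opprB addrC subrK.
have rS i : r i.+1 = (1 - a) * r i by rewrite /r tS /q mulrCA.
have rS_le i : r i.+1 <= r i by rewrite rS ler_piMl ?(ltW (r0 i))//; lra.
have rS_ge i : 3 * r i <= 4 * r i.+1.
  rewrite rS; have -> : 4 * ((1 - a) * r i) = (4 * (1 - a)) * r i by ring.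
  by apply: ler_wpM2r; [exact: ltW|lra].
have mv := continuous_borel cv.
pose m i := ball_mean mu v (y i) (r i).
pose M i := ball_mean mu v (y i) (2 * r i).
have r20 i : 0 < 2 * r i by rewrite mulr_gt0.
have m0 : m 0%N = 1.
  apply: ball_mean_cst => // z; rewrite /y /r /t expr0 mulr1; exact: v_end.
have [N mN] : exists N, m N <= 5 / 8.
  have e8 : 0 < 8^-1 :> R by rewrite invr_gt0.
  have /nbhs_ballP[e /= e0 eP] : nbhs (g 0) (v @^-1` ball (v (g 0)) 8^-1).
    exact: cv (nbhsx_ballx _ _ e8).
  have [N NP] : exists N, q ^+ N < e / (2 * l).
    by apply: exprn_small; rewrite ?ltW ?divr_gt0 ?mulr_gt0.
  exists N; have : `|m N - v (g 0)| <= 8^-1.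
    apply: ball_mean_near => // z; rewrite mballE => yz.
    have : ball (v (g 0)) 8^-1 (v z); last by rewrite /ball/= distrC => /ltW.
    apply: eP; rewrite mballE; apply: (le_lt_trans (metric_triangle _ (y N) _)).
    have I0 : (0 : R) <= 0 <= l by apply/andP; split=> //; exact: ltW.
    have := gl 0 (t N) I0 (tI N); rewrite sub0r normrN gtr0_norm// => d1.
    have rt : r N <= t N by rewrite /r ler_piMl ?(ltW (t0 N))//; lra.
    have : 2 * t N < e.
      by rewrite /t mulrA mulrC -ltr_pdivlMr// mulr_gt0.
    by move: yz; rewrite -/(y N) => yz; have d2 : mdist (g 0) (y N) <= t N by []; lra.
  by rewrite ler_norml => /andP[_ ?]; lra.
(* The means fall from 1 to at most 5/8, hence by 3/8, whereas the excluded increments would sum to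
   at most 1/4. *)
have [i gap] : exists i, 1 / 4 * (1 - w) * w ^+ i < `|m i.+1 - m i|.
  apply: contrapT => /forallNP H.
  have q4 : 0 <= 1 / 4 :> R by lra.
  have := @geometric_telescoping R m w (1 / 4) (ltW w0) w1 q4.
  have H' i : `|m i.+1 - m i| <= 1 / 4 * (1 - w) * w ^+ i by rewrite leNgt; apply/negP/H.
  move=> /(_ H' N); rewrite m0 ler_norml => /andP[? _]; lra.
exists (t i); split=> //.
pose tau := K1 * w ^+ i / r i.
have tau0 : 0 <= tau by rewrite ltW// divr_gt0// mulr_gt0// exprn_gt0.
have osc : CP * D * (2 * r i) * tau < 1 / 8 * (1 - w) * w ^+ i.
  have -> : CP * D * (2 * r i) * tau = (1 - w) / 16 * w ^+ i.
    by rewrite /tau /K1; field; rewrite !gt_eqF.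
  have w10 : 0 < (1 - w) * w ^+ i by rewrite mulr_gt0 ?subr_gt0// exprn_gt0.
  rewrite mulrAC; have -> : 1 / 8 * (1 - w) * w ^+ i = (1 - w) * w ^+ i / 8 by ring.
  by lra.
have main : ((tau `^ p)%:E * mu (ball (y i) (lambda * (2 * r i))) <=
    \int[mu]_(z in ball (y i) (lambda * (2 * r i))) (f z `^ p))%E.
  (* Both balls lie in the doubled ball with mean [M i]; one of the two means must differ from [M i]
     by half the gap. *)
  have [g1|g1] := ltP (1 / 8 * (1 - w) * w ^+ i) `|m i - M i|.
    apply: (PI mv v01 R00 vsupp uf ffin (r20 i) (r0 i) _ D0 _ tau0 (lt_trans osc g1)).
      by apply: mballS; rewrite mdistxx add0r mulr_natl mulr2n lerDl ltW.
    apply: (le_trans (dblf _ _ (r0 i))); rewrite ler_wpM2r ?fine_ge0//.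
    by rewrite /D lerDl exprn_ge0// ltW.
  have g2 : 1 / 8 * (1 - w) * w ^+ i < `|m i.+1 - M i|.
    have := ler_normD (m i.+1 - M i) (M i - m i).
    rewrite subrKA (distrC (M i)) => h.
    have -> : 1 / 8 * (1 - w) * w ^+ i = 1 / 4 * (1 - w) * w ^+ i - 1 / 8 * (1 - w) * w ^+ i.
      by field.
    by rewrite ltrBlDr (lt_le_trans gap)// (le_trans h)// lerD2l.
  apply: (PI mv v01 R00 vsupp uf ffin (r20 i) (r0 i.+1) _ D0 _ tau0 (lt_trans osc g2)).
    apply: mballS; rewrite [leRHS]mulr_natl mulr2n; apply: lerD => //.
  apply: (@le_trans _ _ (fine (mu (ball (y i.+1) (2 * (2 * r i.+1)))))).
    apply: fine_mu_ball_le => //; first by rewrite mulr_gt0.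
    apply: mballS; rewrite metric_sym mulrA -natrM.
    by have := yS i; have := rS_ge i; lra.
  apply: (le_trans (dblf _ _ (r20 i.+1))).
  apply: (@le_trans _ _ (Cd * (Cd * fine (mu (ball (y i.+1) (r i.+1)))))).
    by rewrite ler_wpM2l ?(ltW Cd0)//; exact: dblf.
  rewrite mulrA ler_wpM2r ?fine_ge0//.
  by rewrite /D expr2 lerDr ltW.
have -> : 2 * lambda * (a * t i) = lambda * (2 * r i) by rewrite /r; ring.
apply: le_trans main.
have ri0 := r0 i; have ri0' := ltW ri0.
have lr0 : 0 < lambda * (2 * r i) by rewrite mulr_gt0// (lt_le_trans ltr01).
have riL : r i <= a * L0 by rewrite /r ler_wpM2l ?(ltW a0)// (le_trans (tl i)).
have riR : r i <= R0.
  apply: (le_trans riL); apply: le_trans LR; rewrite ler_piMl ?(ltW L00)//.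
  by apply: (le_trans a4); rewrite invf_le1// ler1n.
have mass : K3 * r i `^ Q <= fine (mu (ball (y i) (lambda * (2 * r i)))).
  apply: (@le_trans _ _ (fine (mu (ball (y i) (r i))))); last first.
    apply: fine_mu_ball_le => //; apply: mballS; rewrite mdistxx add0r.
    rewrite mulrA ler_peMl// (le_trans lambda1)// ler_peMr ?ler1n//.
    exact: le_trans lambda1.
  have := massQ z0 (y i) (r i) R0 ri0 riR (gB _ (tI i)).
  rewrite ler_pdivlMr// powRM ?invr_ge0 ?(ltW R00)//.
  by apply: le_trans; rewrite /K3 le_eqVlt; apply/orP; left; apply/eqP; ring.
(* Since [l <= L0], the weight [w ^+ i] dominates a power of the radius; this bounds [tau] below by
   the radius alone, uniformly over the curves. *)
have wi : r i `^ beta / (a * L0) `^ beta <= w ^+ i.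
  rewrite ler_pdivrMr ?powR_gt0// wE -powRM ?(ltW (qi0 i)) ?(ltW aL0)//.
  apply: ge0_ler_powR; rewrite ?nnegrE ?(ltW beta0)//.
    by rewrite mulr_ge0 ?(ltW (qi0 i)) ?(ltW aL0).
  have -> : r i = q ^+ i * (a * l) by rewrite /r /t; ring.
  by apply: ler_wpM2l; [exact: ltW|rewrite ler_wpM2l// ltW].
have taub : K2 * r i `^ (beta - 1) <= tau.
  rewrite powRB; last by apply/implyP => _; rewrite gt_eqF.
  rewrite powRr1// /K2 /tau mulrA ler_wpM2r ?invr_ge0//.
  by rewrite -mulrA (mulrC _ (r i `^ beta)) ler_wpM2l// ltW.
have tp : K2 `^ p * r i `^ ((beta - 1) * p) <= tau `^ p.
  rewrite powRrM -powRM ?powR_ge0 ?(ltW K20)//.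
  apply: ge0_ler_powR; rewrite ?nnegrE ?(ltW p0)//.
  by rewrite mulr_ge0 ?powR_ge0 ?(ltW K20).
rewrite -(fineK (mu_ball_fin mu_balls (y i) lr0)) -EFinM lee_fin.
apply: (@le_trans _ _ ((K2 `^ p * r i `^ ((beta - 1) * p)) * (K3 * r i `^ Q))); last first.
  apply: ler_pM => //; first by rewrite mulr_ge0 ?powR_ge0.
  by rewrite mulr_ge0 ?powR_ge0 ?(ltW K30).
have re : r i `^ ((beta - 1) * p) * r i `^ Q = r i.
  rewrite -powRD; last by apply/implyP => _; rewrite gt_eqF.
  have -> : (beta - 1) * p + Q = 1 by rewrite /beta; field; rewrite gt_eqF.
  by rewrite powRr1.
rewrite -/(r i) -[X in _ * X <= _]re le_eqVlt; apply/orP; left; apply/eqP; ring.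
Qed.

End energy_along_curve.

(** * Covering of a connected set *)

Section covering.
Context {R : realType} {X : completeMetricType R}.
Local Notation leb := (@lebesgue_measure R).

Lemma seq_max_radius (L : seq (X * R)) : L != [::] ->
  exists2 j, j \in L & forall i, i \in L -> i.2 <= j.2.
Proof.
elim: L => // i L ih _; have [->|/ih[j jL jmax]] := eqVneq L [::].
  by exists i; [rewrite mem_head|move=> k; rewrite inE => /eqP ->].
have [ij|/ltW ji] := leP i.2 j.2.
  exists j; first by rewrite inE jL orbT.
  by move=> k; rewrite inE => /predU1P[->|/jmax].
exists i; first by rewrite mem_head.
move=> k; rewrite inE => /predU1P[->//|/jmax kj]; exact: le_trans ji.
Qed.

(* Greedy selection of pairwise disjoint balls; the energies of the selected balls
   are paid for by disjoint parts of U. *)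
Lemma vitali_energy (mu : {measure set (borel X) -> \bar R}) (h : X -> \bar R)
    (c S Lam : R) (L : seq (X * R)) (U : set X) :
  nonneg_borel h -> 0 < S -> Lam <= S -> measurable (U : set (borel X)) ->
  (forall i, i \in L -> [/\ 0 < i.2, ball i.1 (Lam * i.2) `<=` U &
     ((c * i.2)%:E <= \int[mu]_(y in ball i.1 (Lam * i.2)) h y)%E]) ->
  exists D : seq (X * R), [/\ {subset D <= L},
    ((\sum_(j <- D) c * j.2)%:E <= \int[mu]_(y in U) h y)%E &
    forall i, i \in L -> exists2 j, j \in D & mdist j.1 i.1 + S * i.2 <= 3 * S * j.2].
Proof.
move=> nh S0 LS; have [n nL] := ubnP (size L); elim: n L U nL => // n ih L U nL mU HL.
have [mh h0] := nh.
have [L0|Ln] := eqVneq L [::].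
  exists [::]; rewrite L0; split=> //.
  by rewrite big_nil; apply: integral_ge0.
have [j jL jmax] := seq_max_radius Ln.
have [j0 jU jE] := HL j jL.
(* Balls whose [S]-dilate meets that of the largest ball [j] are absorbed by its [3 * S]-dilate. The
   others carry their energy outside [B], because [Lam <= S]. *)
pose L' := [seq i <- L | `[< ball i.1 (S * i.2) `&` ball j.1 (S * j.2) = set0 >] ].
pose B := ball j.1 (Lam * j.2).
have mB : measurable (B : set (borel X)) by exact: measurable_mball.
have subS (i : X * R) : 0 < i.2 -> ball i.1 (Lam * i.2) `<=` ball i.1 (S * i.2).
  by move=> i0; apply: mballS; rewrite mdistxx add0r ler_wpM2r// ltW.
have sL' : (size L' < n)%N.
  move: nL; rewrite ltnS; apply: leq_trans; rewrite size_filter.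
  set P := fun i => _; rewrite -[X in (_ < X)%N](count_predC P) -[ltnLHS]addn0 ltn_add2l.
  rewrite -has_count; apply/hasP; exists j => //=; rewrite /P; apply/asboolPn => dj.
  have : (ball j.1 (S * j.2) `&` ball j.1 (S * j.2)) j.1.
    by split; apply: mball_center; exact: mulr_gt0.
  by rewrite dj.
have mUB : measurable (U `\` B : set (borel X)) by exact: (@measurableD _ (borel X)).
have [|D [DL DE Dcov]] := ih L' (U `\` B) sL' mUB.
  move=> i; rewrite mem_filter => /andP[/asboolP dij iL].
  have [i0 iU iE] := HL i iL; split=> // z iz; split; first exact: iU.
  move=> jz; have : (ball i.1 (S * i.2) `&` ball j.1 (S * j.2)) z.
    by split; exact: subS.
  by rewrite dij.
exists (j :: D); split.
- move=> i; rewrite inE => /predU1P[->//|/DL]; rewrite mem_filter => /andP[]//.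
- rewrite big_cons EFinD; have -> : U = B `|` (U `\` B) by rewrite setDUK.
  rewrite ge0_integral_setU//; first by apply: leeD.
  + by apply: measurable_funTS.
  + by rewrite disj_set2E setDIK.
- move=> i iL; case: (boolP (i \in L')) => [/Dcov[k kD ik]|].
    by exists k => //; rewrite inE kD orbT.
  rewrite mem_filter iL andbT => /asboolPn/eqP/set0P[z [iz jz]].
  exists j; first by rewrite mem_head.
  move: iz jz; rewrite !mballE => iz jz.
  have [i0 _ _] := HL i iL; have ij := jmax i iL.
  have Sij : S * i.2 <= S * j.2 by rewrite ler_wpM2l// ltW.
  have := metric_triangle j.1 z i.1.
  rewrite (metric_sym z) -mulrA; lra.
Qed.

Lemma connected_distance_onto (E : set X) (u w : X) (s : R) :
  connected E -> E u -> E w -> 0 <= s -> s <= mdist u w ->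
  exists2 z, E z & mdist u z = s.
Proof.
move=> cE Eu Ew s0 sw.
have cont : continuous (mdist u).
  apply: (@lipschitz_fun_continuous _ _ 1); split=> // y z.
  by rewrite mul1r !(metric_sym u) mdist_diff.
have cI : connected (mdist u @` E).
  by apply: connected_continuous_connected => //; exact: continuous_subspaceT.
have [z Ez zs] : (mdist u @` E) s.
  move/connected_intervalP : cI => /(_ 0 (mdist u w)); apply.
  - by exists u => //; rewrite mdistxx.
  - by exists w.
  - by rewrite s0.
by exists z.
Qed.

(** A ball in [R] has length twice its radius. The countable family will come from a content cover,
    the finite one from the Vitali selection. *)
Lemma segment_cover_length (d : R) (cr : nat -> R * R) (D : seq (R * R)) :
  0 <= d -> (forall n, 0 <= (cr n).2) -> (forall j, j \in D -> 0 <= j.2) ->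
  `[0, d]%classic `<=` \bigcup_n ball (cr n).1 (cr n).2 `|`
    \bigcup_(j in [set` D]) ball j.1 j.2 ->
  (d%:E <= 2%:E * \sum_(n <oo) (cr n).2%:E + (\sum_(j <- D) 2 * j.2)%:E)%E.
Proof.
move=> d0 cr0 D0; rewrite bigcup_seq => sub.
pose ib (j : R * R) : set R := ball j.1 j.2.
have mib j : measurable (ib j) by exact: measurable_ball.
have mU1 : measurable (\bigcup_n ib (cr n)) by exact: bigcupT_measurable.
have -> : (d%:E = leb `[0%R, d]%classic)%E.
  rewrite lebesgue_measure_itv/= lte_fin; case: ltP => [_|d0']; first by rewrite -EFinB subr0.
  by congr (_%:E); apply/eqP; rewrite eq_le d0 d0'.
have mU2 : measurable (\big[setU/set0]_(j <- D) ib j).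
  by apply: bigsetU_measurable => j _; exact: mib.
apply: (@le_trans _ _ (leb (\bigcup_n ib (cr n) `|` \big[setU/set0]_(j <- D) ib j))).
  by apply: le_measure; rewrite ?inE//; exact: measurableU.
apply: (le_trans (@measureU2 _ _ _ leb _ _ mU1 mU2)); apply: leeD.
  apply: (@le_trans _ _ (\sum_(n <oo) leb (ib (cr n)))%E).
    have H := @measure_sigma_subadditive _ _ _ leb.
    by apply: (H _ (fun n => ib (cr n))) => [n| |]; [exact: mib|exact: mU1|].
  rewrite -nneseriesZl//; last by move=> n _; rewrite lee_fin.
  apply: lee_nneseries => n _.
    by move=> _; exact: measure_ge0.
  by rewrite /ib lebesgue_measure_ball// -[(_ *+ 2)%R]mulr_natl EFinM.
elim: D D0 {sub mU2} => [|j D ih] D0.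
  by rewrite !big_nil measure0.
rewrite !big_cons EFinD.
have mD : measurable (\big[setU/set0]_(j <- D) ib j).
  by apply: bigsetU_measurable => i _; exact: mib.
apply: (le_trans (@measureU2 _ _ _ leb _ _ (mib j) mD)); apply: leeD.
  have j0 : 0 <= j.2 by rewrite D0// mem_head.
  by have := lebesgue_measure_ball j.1 j0; rewrite -[(_ *+ 2)%R]mulr_natl => <-.
by apply: ih => i iD; apply: D0; rewrite inE iD orbT.
Qed.

(* The distance to u maps the balls covering E to intervals covering [0, d], which
   is compact. *)
Lemma connected_energy (mu : {measure set (borel X) -> \bar R}) (h : X -> \bar R)
    (c S Lam d : R) (E U : set X) (u w : X) (xr : nat -> X * R) :
  nonneg_borel h -> 0 < c -> 0 < S -> Lam <= S -> measurable (U : set (borel X)) ->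
  connected E -> E u -> E w -> 0 <= d -> d <= mdist u w ->
  (forall n, 0 < (xr n).2) ->
  (forall x, E x -> (\bigcup_n ball (xr n).1 (xr n).2) x \/
    exists i : X * R, [/\ 0 < i.2, ball i.1 (S * i.2) x, ball i.1 (Lam * i.2) `<=` U &
      ((c * i.2)%:E <= \int[mu]_(y in ball i.1 (Lam * i.2)) h y)%E]) ->
  (d%:E <= 2%:E * \sum_(n <oo) (xr n).2%:E + (6 * S / c)%:E * \int[mu]_(y in U) h y)%E.
Proof.
move=> nh c0 S0 LS mU cE Eu Ew d0 duw xr0 cov.
pose item (i : X * R) := [/\ 0 < i.2, ball i.1 (Lam * i.2) `<=` U &
  ((c * i.2)%:E <= \int[mu]_(y in ball i.1 (Lam * i.2)) h y)%E].
(* Left indices are balls of the given countable cover, right indices balls carrying energy.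
   Compactness serves to make the second kind finite, as [vitali_energy] needs; the first enters
   through its full sum. *)
pose valid := [set k : nat + X * R | if k is inr i then item i else True].
pose O (k : nat + X * R) : set R := match k with
  | inl n => ball (mdist u (xr n).1) (xr n).2
  | inr i => ball (mdist u i.1) (S * i.2) end.
have near_z (j : X * R) z : ball j.1 j.2 z -> ball (mdist u j.1) j.2 (mdist u z).
  rewrite mballE /ball /= => jz; apply: le_lt_trans jz.
  by rewrite !(metric_sym u) mdist_diff.
have : cover_compact (`[0, d]%classic : set R).
  by rewrite -compact_cover; exact: segment_compact.
move=> /(_ _ valid O)[||K Kval Kcov].
- by move=> [n|i] _; exact: ball_open.
- move=> s; rewrite /= in_itv /= => /andP[s0 sd].
  have [z Ez zs] := connected_distance_onto cE Eu Ew s0 (le_trans sd duw).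
  case: (cov z Ez) => [[n _ nz]|[i [i0 iz iU iE]]].
    by exists (inl n) => //; rewrite /O -zs; exact: near_z.
  exists (inr i); first by split.
  by rewrite /O -zs; apply: (near_z (i.1, S * i.2)).
pose L := pmap (fun k : nat + X * R => if k is inr i then Some i else None) (finmap.enum_fset K).
have Litem i : i \in L -> item i.
  rewrite mem_pmap => /mapP[[//|j] jK [->]].
  by have := Kval _ jK; rewrite inE.
have [D [DL DE Dcov]] := vitali_energy nh S0 LS mU Litem.
have len := @segment_cover_length d (fun n => (mdist u (xr n).1, (xr n).2))
  [seq (mdist u j.1, 3 * S * j.2) | j <- D] d0.
apply: (le_trans (len _ _ _)).
- by move=> n /=; rewrite ltW.
- move=> _ /mapP[j jD ->] /=.
  by have [j0 _ _] := Litem j (DL j jD); rewrite !mulr_ge0// ltW.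
- move=> s /Kcov[[n|i] kK /=]; first by move=> ns; left; exists n.
  move=> si; right.
  have iL : i \in L.
    by rewrite mem_pmap; apply/mapP; exists (inr i).
  have [j jD ij] := Dcov i iL.
  exists (mdist u j.1, 3 * S * j.2); first by apply/mapP; exists j.
  have := mdist_diff i.1 j.1 u; rewrite !(metric_sym _ u) (metric_sym i.1) => jd.
  move: si; rewrite /ball /= => si; apply: le_lt_trans (_ : mdist j.1 i.1 + `|mdist u i.1 - s| < _).
    rewrite distrC in jd; apply: le_trans (lerD jd (lexx _)).
    by rewrite (_ : mdist u j.1 - s = (mdist u j.1 - mdist u i.1) + (mdist u i.1 - s)) ?ler_normD//; ring.
  lra.
apply: leeD => //; rewrite big_map /=.
apply: le_trans (_ : (6 * S / c)%:E * (\sum_(j <- D) c * j.2)%:E <= _)%E; last first.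
  by apply: lee_wpmul2l => //; rewrite lee_fin divr_ge0 ?mulr_ge0 ?ltW.
rewrite -EFinM lee_fin mulr_sumr; apply: ler_sum => j _.
by rewrite le_eqVlt; apply/orP; left; apply/eqP; field; rewrite gt_eqF.
Qed.

End covering.

(** * Balls of large energy near points of a John subdomain *)

Section energy_near_john_points.
Context {R : realType} {X : completeMetricType R}.
Variables (mu : {measure set (borel X) -> \bar R}) (p Q : R).
Hypothesis p1 : 1 <= p.
Hypothesis mu_balls : balls_pos_finite mu.
Hypothesis mu_doubling : doubling mu.
Hypothesis mu_Q : lower_mass_exponent mu Q.
Hypothesis p_gtQ : Q - 1 < p.
Hypothesis mu_poincare : poincare mu p.
Let proper : forall A : set X, closed A -> mbounded A -> compact A :=
  compact_closed_bounded mu_balls mu_Q.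
Let p0 : 0 < p. Proof. exact: lt_le_trans p1. Qed.

Variables (Omega : set X) (Omega' : set X) (CJ kappa : R) (x0 : X).
Hypothesis oOmega : open Omega.
Hypothesis bOmega : mbounded Omega.
Hypothesis nOmega : exists z, ~ Omega z.
Hypothesis sOmega : Omega' `<=` Omega.
Hypothesis oOmega' : open Omega'.
Hypothesis CJ1 : 1 <= CJ.
Hypothesis kappa0 : 0 < kappa.
Hypothesis kappa_ball : ball x0 kappa `<=` Omega'.
Hypothesis john : forall x, Omega' x -> exists g : curve,
  [/\ curve_in g Omega', g 0 = x, g (len g) = x0 &
    forall t : R, 0 <= t <= len g ->
      (t%:E <= CJ%:E * set_dist [set g t] (~` Omega'))%E].
Let Z : set X := [set z | mdist x0 z <= kappa / 4].

Lemma bounded_mu_fin (A : set X) : measurable (A : set (borel X)) -> mbounded A ->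
  (mu A < +oo)%E.
Proof.
move=> mA [x [r Ar]].
apply: (@le_lt_trans _ _ (mu (ball x (Num.max 1 r)))).
  apply: le_measure; rewrite ?inE//; first exact: measurable_mball.
  by apply: subset_trans Ar _; apply: mballS; rewrite mdistxx add0r le_max lexx orbT.
have r1 : 0 < Num.max 1 r by rewrite lt_max ltr01.
by have /andP[_] := mu_balls x r1.
Qed.

Lemma closed_mdist_le (x : X) (r : R) : closed [set z | mdist x z <= r].
Proof.
move=> z zcl; rewrite /= leNgt; apply/negP => xz.
have e0 : 0 < mdist x z - r by rewrite subr_gt0.
have [y [/= xy zy]] := zcl _ (nbhsx_ballx z _ e0).
move: zy; rewrite mballE; apply/negP; rewrite -leNgt.
by have := metric_triangle x y z; rewrite (metric_sym y z); lra.
Qed.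

(** [Lam] and [c] precede [rho] and [x]: the energy of [rho] will be chosen small in terms of [c].
    Only the auxiliary distance [d] in the proof depends on [x], and it does not enter the
    constants. *)
Lemma john_point_energy : exists (Lam c : R), [/\ 0 < Lam, Lam <= 1, 0 < c &
  forall (rho : X -> \bar R) (c0 : R) (g : nat -> X -> R) (k b : nat -> R) (x : X),
  let F x := ereal_sup (range (fun n => (g n x)%:E)) in
  nonneg_borel rho -> 0 < c0 -> (forall n, lipschitz_fun (k n) (g n)) ->
  (forall n x, c0 <= g n x <= b n) -> (forall n x, g n x <= g n.+1 x) ->
  (forall x, Omega x -> (rho x <= F x)%E) -> nonneg_borel F ->
  (forall h : curve, joining_curves [set x] Z Omega h -> (1 <= line_integral h rho)%E) ->
  Omega' x -> ~ Z x ->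
  exists i : X * R, [/\ 0 < i.2, ball i.1 (2 * i.2) x, ball i.1 (Lam * i.2) `<=` Omega &
    ((c * i.2)%:E <= \int[mu]_(y in ball i.1 (Lam * i.2)) (F y `^ p))%E] ].
Proof.
have [CP [lambda [CP0 lambda1 PI]]] := poincare_oscillation p1 mu_balls mu_poincare.
have [z1 nz1] := nOmega.
have [z0 [r0 Or0]] := bOmega.
have CJ0 : 0 < CJ by exact: lt_le_trans CJ1.
have lam0 : 0 < lambda by exact: lt_le_trans lambda1.
have x0O : Omega' x0 by apply: kappa_ball; exact: mball_center.
have far w : ~ Omega' w -> kappa <= mdist x0 w.
  by move=> nw; rewrite leNgt; apply/negP; rewrite -mballE => /kappa_ball.
have nz1' : ~ Omega' z1 by move/sOmega.
(* The John condition at the center [x0], tested on the outer point [z1], bounds the length of every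
   John curve by [L0]. *)
pose L0 := CJ * mdist x0 z1.
have L00 : 0 < L0 by rewrite mulr_gt0// (lt_le_trans kappa0)// far.
pose R0 := Num.max r0 L0.
have OR0 : Omega `<=` ball z0 R0.
  by apply: subset_trans Or0 _; apply: mballS; rewrite mdistxx add0r le_max lexx.
pose s := CJ^-1.
have s0 : 0 < s by rewrite invr_gt0.
have s1 : s <= 1 by rewrite invf_le1.
(* The first bound keeps the dilated balls within half the distance that the John condition
   guarantees; the second puts the ball around the end of the curve inside [Z]. *)
pose a := Num.min (4^-1 * lambda^-1 * s) (kappa / (8 * L0)).
have a0 : 0 < a.
  rewrite /a lt_min; apply/andP; split; last by rewrite divr_gt0// mulr_gt0.
  by apply: mulr_gt0 => //; apply: mulr_gt0; rewrite invr_gt0.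
have las : 2 * lambda * a <= s / 2.
  apply: (@le_trans _ _ (2 * lambda * (4^-1 * lambda^-1 * s))).
    by rewrite ler_wpM2l ?ge_min ?lexx// mulr_ge0// ltW.
  by rewrite le_eqVlt; apply/orP; left; apply/eqP; field; rewrite gt_eqF.
have a4 : a <= 4^-1.
  have : 2 * a <= 2 * lambda * a.
    by rewrite ler_wpM2r ?(ltW a0)//; have := lambda1; lra.
  by have := s1; lra.
have aL l : l <= L0 -> a * l <= kappa / 8.
  move=> lL; apply: (@le_trans _ _ (kappa / (8 * L0) * L0)); last first.
    by rewrite le_eqVlt; apply/orP; left; apply/eqP; field; rewrite gt_eqF.
  apply: (@le_trans _ _ (a * L0)); first by rewrite ler_wpM2l// ltW.
  by rewrite ler_wpM2r ?ge_min ?lexx ?orbT// ltW.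
have LR : L0 <= R0 by rewrite le_max lexx orbT.
have [c1 c10 energy] := energy_along_curve p1 mu_balls mu_doubling mu_Q p_gtQ CP0
  lambda1 PI z0 a0 a4 L00 LR.
exists (2 * lambda * a), (c1 * a); split.
- by rewrite !mulr_gt0.
- by apply: (le_trans las); have := s1; lra.
- by rewrite mulr_gt0.
move=> rho c0 g k b x F nrho c00 g_lip g_bounds g_nd rhoF nF rho_adm Ox nZx.
have [gam [gamO gam0 gaml gamJ]] := john Ox.
pose l := len gam.
have Jt t w : 0 <= t <= l -> ~ Omega' w -> t <= CJ * mdist (gam t) w.
  move=> tl nw; rewrite -lee_fin; apply: (le_trans (gamJ t tl)).
  rewrite EFinM; apply: lee_wpmul2l; first by rewrite lee_fin ltW.
  by apply: ereal_inf_lbound; exists (gam t) => //; exists w.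
have Zx0 : Z x0 by rewrite /Z /= mdistxx divr_ge0// ltW.
have l0 : 0 < l.
  rewrite lt_neqAle len_ge0 andbT; apply/eqP => ll; apply: nZx.
  by rewrite -gam0 ll gaml.
have ll : 0 <= l <= l by rewrite lexx ltW.
have lL : l <= L0 by have := Jt l z1 ll nz1'; rewrite gaml.
pose th := dist1 (~` Omega') x.
have th0 : 0 < th.
  by apply: dist1_gt0; [exact: open_closedC|move=> /(_ Ox)].
have th1 : th <= 1 by exact: dist1_le1.
have thw w : ~ Omega' w -> th <= mdist x w by move=> nw; exact: dist1_le.
(* [2 * d] must not exceed the distance to the complement of [Omega] from [Z], which is at least
   [3 * kappa / 4], nor from the balls along the curve, for which [th * s / 6] is a lower bound. *)
pose d := Num.min (th * s / 12) (3 * kappa / 8).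
have d0 : 0 < d by rewrite /d lt_min !divr_gt0// ?mulr_gt0.
have dth : 2 * d <= th * s / 6.
  have : d <= th * s / 12 by rewrite ge_min lexx.
  lra.
have dk : 2 * d <= 3 * kappa / 4.
  have : d <= 3 * kappa / 8 by rewrite ge_min lexx orbT.
  lra.
have ths : th * s <= th by rewrite ler_piMr// ltW.
have d1 : 2 * d <= 1 by lra.
have Zd z : Z z -> 2 * d <= dist1 (~` Omega) z.
  rewrite /Z /= => Zz; apply: dist1_ge => // w nw.
  have := far w (fun h => nw (sOmega h)); have := metric_triangle x0 z w; lra.
have xd : 2 * d <= dist1 (~` Omega) x.
  apply: dist1_ge => // w nw; have := thw w (fun h => nw (sOmega h)); lra.
pose M := 2 / d.
have M0 : 0 < M by rewrite divr_gt0.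
have Md : M * d = 2 by rewrite /M divfK// gt_eqF.
have Ofin : (mu Omega < +oo)%E by apply: bounded_mu_fin => //; exact: measurable_open.
have cZ : closed Z by exact: closed_mdist_le.
have [v [f [cv v01 vZ vx [vO [fug fp fF]]]]] := capacitary_test_function proper p1
  oOmega bOmega Ofin nrho c00 g_lip g_bounds g_nd rhoF cZ d0 nZx Zd xd rho_adm M0 Md.
have [|||||t [t0 tl Et]] := energy v f gam l cv v01 _ fug fp l0 lL.
- by move=> y ny; apply: vO => /OR0.
- by move=> t1 t2 ? ?; exact: curve_lipschitz.
- by move=> t tl; apply: OR0; apply: sOmega; exact: gamO.
- by rewrite gam0.
- rewrite gaml => y; rewrite mballE => x0y; apply: vZ; rewrite /Z /=.
  have := aL l lL; have := kappa0; lra.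
have tl' : 0 <= t <= l by rewrite tl ltW.
have xt : mdist x (gam t) <= t.
  rewrite -gam0; have := curve_lipschitz (_ : 0 <= 0 <= l) tl'.
  by rewrite sub0r normrN gtr0_norm//; apply; rewrite lexx ltW.
(* Far along the curve the John condition keeps the ball away from the boundary;
   near x the position of x itself does. *)
have ballfar y w : ball (gam t) (2 * lambda * a * t) y -> ~ Omega' w -> 2 * d <= mdist y w.
  rewrite mballE => ty nw.
  have ty2 : mdist (gam t) y < s * t / 2.
    apply: (lt_le_trans ty); rewrite (mulrAC s).
    exact: ler_wpM2r (ltW t0) _ _ las.
  have tw : s * t <= mdist (gam t) w.
    by rewrite /s mulrC ler_pdivrMr// mulrC; exact: Jt.
  have h1 := metric_triangle (gam t) y w.
  have h2 := metric_triangle x (gam t) w.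
  have h3 := thw w nw.
  have [th3|th3] := leP (th / 3) t.
    have : th / 3 * s <= t * s by rewrite ler_wpM2r// ltW.
    rewrite (mulrC t); lra.
  have : s * t <= t by rewrite ler_piMl// ltW.
  lra.
exists (gam t, t) => /=; split=> //.
- by rewrite mballE metric_sym; lra.
- move=> y ty; apply: contrapT => nOy.
  have := ballfar y y ty (fun h => nOy (sOmega h)); rewrite mdistxx; lra.
move: Et; rewrite !mulrA => Et; apply: (le_trans Et).
have [[mf f0] _] := fug; have [mF F0] := nF.
apply: ge0_le_integral.
- exact: measurable_mball.
- by move=> y _; exact: poweR_ge0.
- by apply: measurable_funTS; exact: measurable_poweR_comp.
- by apply: measurable_funTS; exact: measurable_poweR_comp.
- move=> y ty; apply: poweR_le; [exact: ltW|exact: f0|].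
  apply: fF; apply: dist1_ge => // w nw.
  by apply: ballfar => // /sOmega.
Qed.

End energy_near_john_points.

(** * Impressions of Mod_p-chains and the conclusion *)

Section mod_chain_impression.
Context {R : realType} {X : completeMetricType R}.
Variables (mu : {measure set (borel X) -> \bar R}) (p Q : R) (Omega : set X).
Hypothesis mu_balls : balls_pos_finite mu.
Hypothesis p1 : 1 <= p.
Hypothesis mu_doubling : doubling mu.
Hypothesis mu_poincare : poincare mu p.
Hypothesis mu_Q : lower_mass_exponent mu Q.
Hypothesis Omega_john : almost_john_domain Omega.
Hypothesis p_gtQ : Q - 1 < p.
Let proper : forall A : set X, closed A -> mbounded A -> compact A :=
  compact_closed_bounded mu_balls mu_Q.
Let p0 : 0 < p. Proof. exact: lt_le_trans p1. Qed.

Lemma closure_far_points (A : set X) (a b : X) (d : R) : closure A a -> closure A b ->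
  d < mdist a b -> exists u w, [/\ A u, A w & d <= mdist u w].
Proof.
move=> cla clb; rewrite -subr_gt0 => dab.
have e0 : 0 < (mdist a b - d) / 2 by rewrite divr_gt0.
have [u [Au]] := cla _ (nbhsx_ballx a _ e0); have [w [Aw]] := clb _ (nbhsx_ballx b _ e0).
rewrite !mballE => bw au; exists u, w; split=> //.
have := metric_triangle a u b; have := metric_triangle u w b.
by rewrite (metric_sym w b); lra.
Qed.

Lemma mod_chain_impression_singleton E : mod_chain Omega mu p E ->
  exists x, impression E = [set x].
Proof.
move=> [cE modE]; have [a Ea] := impression_nonempty proper cE.
exists a; apply/seteqP; split=> [b Eb|_ ->//]; apply: contrapT => ba.
have ab0 : 0 < mdist a b.
  by rewrite lt_neqAle mdist_ge0 andbT; apply/eqP => /esym/mdist_positivity/esym.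
pose d := mdist a b / 2.
have d0 : 0 < d by rewrite divr_gt0.
have d80 : 0 < d / 8 by rewrite divr_gt0.
have [[[_ nO] oO _ _ bO] /(_ _ d80)[F [_ _ Fd]]] := Omega_john.
move=> [[_ oO' _ _ _] [CJ [x0 [CJ1 x0O' john]]]].
have [z1 nz1] : exists z, ~ Omega z.
  by apply: contrapT => /forallNP H; apply: nO => z _; apply: contrapT; exact: H.
have [_ [xr [xr0 Fxr] <-] xrd] := ereal_inf_lt Fd.
have sO : Omega `\` F `<=` Omega by move=> ? [].
have [kappa /= k0 kO'] : exists2 kappa : R, 0 < kappa & ball x0 kappa `<=` Omega `\` F.
  by apply/nbhs_ballP; apply: open_nbhs_nbhs.
have [Lam [c [Lam0 Lam1 c0 energy]]] := john_point_energy p1 mu_balls mu_doubling mu_Q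
  p_gtQ mu_poincare oO bO (ex_intro _ z1 nz1) sO oO' CJ1 k0 kO' john.
pose Z : set X := [set z | mdist x0 z <= kappa / 4].
have ZO : Z `<=` Omega.
  by move=> z Zz; apply: sO; apply: kO'; rewrite mballE; apply: le_lt_trans Zz _; lra.
have cZ : closed Z by exact: closed_mdist_le.
have mO : measurable (Omega : set (borel X)) by exact: measurable_open.
have Ofin : (mu Omega < +oo)%E by exact: bounded_mu_fin.
have OfinE : mu Omega \is a fin_num by rewrite ge0_fin_numE.
(* The final estimate is [2 * (d / 8) + 12 / c * I0 = d / 2], which is less than [d]. *)
pose I0 := c * d / 48.
have I00 : 0 < I0 by rewrite divr_gt0// mulr_gt0.
pose m := fine (mu Omega).
have m0 : 0 <= m by exact: fine_ge0.
(* The floor [c'], the energy of [rho] and the error of the majorant contribute at most [I0 / 4]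
   each to the energy in [Omega]; [y] is the p-th power of the floor. *)
pose y := I0 / 4 / (m + 1).
have m10 : 0 < m + 1 by rewrite ltr_wpDl.
have y0 : 0 < y by do 2!apply: divr_gt0 => //.
pose c' := y `^ p^-1.
have c'0 : 0 < c' by rewrite powR_gt0.
have c'p : c' `^ p = y by rewrite -powRrM mulVf ?gt_eqF// powRr1// ltW.
pose K := 2 * 2 `^ p : R.
have K0 : 0 < K by rewrite mulr_gt0// powR_gt0.
pose eta := I0 / 4 / K.
have eta0 : 0 < eta by do 2!apply: divr_gt0 => //.
have e0 : 0 < I0 / 4 by rewrite divr_gt0.
have compZ : compact Z.
  apply: proper => //; exists x0, kappa => z Zz.
  by rewrite mballE; apply: le_lt_trans Zz _; lra.
have [N _ NP] : \forall k \near \oo,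
    (Modp mu p (joining_curves (E k) Z Omega) < eta%:E)%E.
  apply: (modE Z compZ ZO [set x | (x < eta%:E)%E]).
  by apply: open_nbhs_nbhs; split; [exact: open_ereal_lt_ereal|rewrite /= lte_fin].
(* The impression lies on the boundary of [Omega], away from [Z]; points of [E k] must avoid [Z] for
   [john_point_energy] to apply. *)
have [k1 Ek1] : exists k, closure (E k) `<=` ~` Z.
  apply: (impression_sub_open proper cE); first exact: closed_openC.
  have [_ _ _ impE] := cE.
  move=> z /impE[_ +] /ZO; rewrite (interior_id _).1 => //.
pose k := maxn N k1.
have [accE decE _ _] := cE.
have Ek : E k `<=` ~` Z.
  apply: subset_trans (subset_trans _ Ek1); last exact: subset_closure.
  by apply: nested_sub => //; exact: leq_maxr.
have [_ [rho [nrho rho_adm] <-] rho_eta] := ereal_inf_lt (NP k (leq_maxl _ _)).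
have [g [kl [b' [glip gb gnd rhoF [nF FI]]]]] :=
  lipschitz_majorant p1 oO Ofin nrho c'0 e0.
set G := fun x => ereal_sup _ in rhoF nF FI.
have [mG G0] := nF.
have [u [w [Eu Ew duw]]] : exists u w, [/\ E k u, E k w & d <= mdist u w].
  by apply: (@closure_far_points _ a b) => //; [exact: Ea|exact: Eb|rewrite /d; lra].
have nGp : nonneg_borel (fun z => G z `^ p)%E.
  by split; [exact: measurable_poweR_comp|move=> z; exact: poweR_ge0].
have [_ conE [EO _] _] := accE k.
have Lam2 : Lam <= 2 by lra.
have := connected_energy nGp c0 (ltr0n _ 2) Lam2 mO conE Eu Ew (ltW d0) duw xr0.
move=> /(_ mu) H; have {}H : (d%:E <= 2%:E * \sum_(n <oo) (xr n).2%:E +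
    (6 * 2 / c)%:E * \int[mu]_(y in Omega) (G y `^ p))%E.
  apply: H => x Ex; have [Fx|nFx] := pselect (F x); [left; exact: Fxr|right].
  apply: (energy rho c' g kl b' x) => //.
  - move=> h [h1 h2 h3 h4]; apply: rho_adm; split=> //.
    by rewrite h3.
  - by split => //; exact: EO.
  - exact: Ek.
have IG : (\int[mu]_(y in Omega) (G y `^ p) <= I0%:E)%E.
  apply: (le_trans FI).
  have -> : (mu Omega = m%:E)%E by rewrite fineK.
  apply: (@le_trans _ _ ((I0 / 4)%:E + (I0 / 4)%:E + (I0 / 4)%:E)%E).
    apply: leeD => //; apply: leeD.
      rewrite -EFinM lee_fin c'p /y mulrAC ler_pdivrMr; last by lra.
      by rewrite ler_wpM2l// ?ltW//; lra.
    apply: (@le_trans _ _ (K%:E * eta%:E)%E).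
      by apply: lee_wpmul2l; [rewrite lee_fin ltW|exact: ltW].
    by rewrite -EFinM lee_fin /eta mulrC divfK// gt_eqF.
  by rewrite -!EFinD lee_fin; lra.
have : (d%:E < d%:E)%E; last by rewrite ltxx.
apply: (le_lt_trans H).
apply: (@le_lt_trans _ _ (2%:E * (d / 8)%:E + (6 * 2 / c)%:E * I0%:E)%E).
  apply: leeD; apply: lee_wpmul2l => //; first exact: ltW.
  by rewrite lee_fin divr_ge0// ?ltW//; lra.
rewrite -!EFinM -EFinD lte_fin.
have -> : 6 * 2 / c * I0 = d / 4 by rewrite /I0; field; rewrite gt_eqF.
lra.
Qed.

End mod_chain_impression.

Theorem theorem11p9 (R : realType) (X : completeMetricType R)
  (mu : {measure set (borel X) -> \bar R}) (p Q : R) (Omega : set X)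
  (X_gt1 : exists x y : X, x <> y)
  (mu_balls : balls_pos_finite mu)
  (p_ge1 : 1 <= p)
  (mu_doubling : doubling mu)
  (X_poincare : poincare mu p)
  (Q_gt0 : 0 < Q)
  (mu_Q : lower_mass_exponent mu Q)
  (Omega_domain : bounded_domain Omega)
  (Omega_john : almost_john_domain Omega)
  (p_gtQ : Q - 1 < p) :
  forall e : set (nat -> set X), mod_end Omega mu p e ->
    prime_end Omega e /\ singleton_impression e.
Proof.
move=> _ [[G cG ->] [E [cE [GE EG]] modE]].
have [x Ex] := mod_chain_impression_singleton mu_balls p_ge1 mu_doubling X_poincare
  mu_Q Omega_john p_gtQ modE.
suff -> : [set F | chain Omega F /\ equivalent_chains G F] =
          [set F | chain Omega F /\ equivalent_chains E F].
  exact: prime_end_of_singleton (compact_closed_bounded mu_balls mu_Q) _ _ _ cE Ex.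
apply/seteqP; split=> F [cF [H1 H2]]; split=> //; split.
- exact: divides_trans EG H1.
- exact: divides_trans H2 GE.
- exact: divides_trans GE H1.
- exact: divides_trans H2 EG.
Qed.
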